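(* Let $\alpha\in[0,1)$ and $k\in\mathbb{Z}$. On $L^2(\mathbb{R})\cong L^2(\mathbb{R}^-)\oplus L^2(\mathbb{R}^+)$ let $A_\alpha(k)=A^-_\alpha(k)\oplus A^+_\alpha(k)$, where $A^\pm_\alpha(k)$ acts as $S_{\alpha,k}=-\frac{\mathrm{d}^2}{\mathrm{d}x^2}+k^2|x|^{2\alpha}+\frac{\alpha(2+\alpha)}{4x^2}$ on the domain $C^\infty_c(\mathbb{R}^\pm)$. Each self-adjoint extension $B_\alpha(k)$ of $A_\alpha(k)$ acts as $B_\alpha(k)g=S_{\alpha,k}g^-\oplus S_{\alpha,k}g^+$, and the family of self-adjoint extensions of $A_\alpha(k)$ consists of: (Friedrichs) $A_{\alpha,F}(k)=A^-_{\alpha,F}(k)\oplus A^+_{\alpha,F}(k)$, whose domain consists of the $g\in\mathcal{D}(A_\alpha(k)^* )$ with $g^\pm_0=0$; (Family $\mathrm{I_R}$) $\{A^{[\gamma]}_{\alpha,R}(k)\mid\gamma\in\mathbb{R}\}$ with $\mathcal{D}(A^{[\gamma]}_{\alpha,R}(k))=\{g\in\mathcal{D}(A_\alpha(k)^* )\mid g^-_0=0,\ g^+_1=\gamma g^+_0\}$; (Family $\mathrm{I_L}$) $\{A^{[\gamma]}_{\alpha,L}(k)\mid\gamma\in\mathbb{R}\}$ with $\mathcal{D}(A^{[\gamma]}_{\alpha,L}(k))=\{g\in\mathcal{D}(A_\alpha(k)^* )\mid g^+_0=0,\ g^-_1=\gamma g^-_0\}$; (Family $\mathrm{II}_a$,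 $a\in\mathbb{C}$) $\{A^{[\gamma]}_{\alpha,a}(k)\mid\gamma\in\mathbb{R}\}$ with $\mathcal{D}(A^{[\gamma]}_{\alpha,a}(k))=\{g\in\mathcal{D}(A_\alpha(k)^* )\mid g^+_0=ag^-_0,\ g^-_1+\overline{a}g^+_1=\gamma g^-_0\}$; (Family $\mathrm{III}$) $\{A^{[\Gamma]}_\alpha(k)\mid\Gamma=(\gamma_1,\gamma_2,\gamma_3,\gamma_4)\in\mathbb{R}^4\}$ with $\mathcal{D}(A^{[\Gamma]}_\alpha(k))=\{g\in\mathcal{D}(A_\alpha(k)^* )\mid g^-_1=\gamma_1g^-_0+\zeta g^+_0,\ g^+_1=\overline{\zeta}g^-_0+\gamma_4g^+_0\}$ where $\zeta=\gamma_2+\mathrm{i}\gamma_3$. The families $\mathrm{I_R}$, $\mathrm{I_L}$, $\mathrm{II}_a$ for all $a\in\mathbb{C}\setminus\{0\}$, and $\mathrm{III}$ are mutually disjoint and, together with the Friedrichs extension, exhaust the family of self-adjoint extensions of $A_\alpha(k)$.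
   Context: Elements $g\in L^2(\mathbb{R})$ are written $g=g^-\oplus g^+$ with $g^\pm=g|_{\mathbb{R}^\pm}$. $A^\pm_{\alpha,F}(k)$ is the Friedrichs extension of $A^\pm_\alpha(k)$ in $L^2(\mathbb{R}^\pm)$. $A_\alpha(k)^*=A^-_\alpha(k)^*\oplus A^+_\alpha(k)^*$, where $\mathcal{D}(A^\pm_\alpha(k)^* )=\{g^\pm\in L^2(\mathbb{R}^\pm)\mid S_{\alpha,k}g^\pm\in L^2(\mathbb{R}^\pm)\}$ (weak derivatives). For $g\in\mathcal{D}(A_\alpha(k)^* )$ the numbers $g^\pm_0=\lim_{x\to0^\pm}|x|^{\alpha/2}g^\pm(x)$ and $g^\pm_1=\lim_{x\to0^\pm}|x|^{-(1+\alpha/2)}\big(g^\pm(x)-g^\pm_0|x|^{-\alpha/2}\big)$ exist and are finite, so that $g^\pm(x)=g^\pm_0|x|^{-\alpha/2}+g^\pm_1|x|^{1+\alpha/2}+o(|x|^{3/2})$ as $x\to0^\pm$. *)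

(* Defs.v *)
(* mathcomp-analysis over an abstract R : realType,
   complex numbers R[i] from mathcomp-real-closed. *)
From mathcomp Require Import all_boot all_order all_algebra.
From mathcomp Require Import all_classical all_reals all_analysis.
From mathcomp Require Import complex.
Set Implicit Arguments.
Unset Strict Implicit.
Unset Printing Implicit Defensive.
Import Order.TTheory GRing.Theory Num.Theory.
Import numFieldNormedType.Exports.
Local Open Scope classical_set_scope.
Local Open Scope ring_scope.

Section Defs.
Variable R : realType.
Local Notation C := (R[i]).
Local Notation mu := (@lebesgue_measure R).

(* real embedding, real and imaginary parts *)
Definition cR (x : R) : C := (x%:C)%C.
Definition reF (f : R -> C) : R -> R := fun x => complex.Re (f x).
Definition imF (f : R -> C) : R -> R := fun x => complex.Im (f x).

(* square-integrable (complex-valued, Lebesgue measure on R) *)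
Definition L2 (f : R -> C) : Prop :=
  measurable_fun setT (reF f) /\ measurable_fun setT (imF f) /\
  (\int[mu]_x (((reF f x) ^+ 2 + (imF f x) ^+ 2)%:E) < +oo)%E.

(* squared L^2 norm *)
Definition nrm2 (f : R -> C) : R :=
  Rintegral mu setT (fun x => (reF f x) ^+ 2 + (imF f x) ^+ 2).

(* inner product <f, g> = \int f * conj g  (linear in the first argument) *)
Definition ip (f g : R -> C) : C :=
  cR (Rintegral mu setT (fun x => complex.Re (f x * (g x)^*)%C)) +
  (Complex 0 1) * cR (Rintegral mu setT (fun x => complex.Im (f x * (g x)^*)%C)).

(* f and g agree almost everywhere *)
Definition aeeq (f g : R -> C) : Prop :=
  exists N : set R, mu.-negligible N /\ forall x, ~ N x -> f x = g x.

(* real-valued C^infinity functions with compact support in R \ {0} *)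
Definition smooth (u : R -> R) : Prop :=
  forall (n : nat) (x : R), derivable (derive1n n u) x 1.
Definition supp_cpt0 (u : R -> R) : Prop :=
  exists e M : R, 0 < e /\ forall x, (`|x| < e \/ M < `|x|) -> u x = 0.

(* C_c^infinity(R^-) (+) C_c^infinity(R^+), complex-valued *)
Definition test_fun (phi : R -> C) : Prop :=
  exists u v : R -> R, smooth u /\ smooth v /\ supp_cpt0 u /\ supp_cpt0 v /\
    phi = (fun x => Complex (u x) (v x)).

(* potential k^2 |x|^(2 alpha) + alpha (2 + alpha) / (4 x^2) *)
Definition pot (alpha : R) (k : int) (x : R) : R :=
  (k%:~R) ^+ 2 * (`|x| `^ (2 * alpha)) + alpha * (2 + alpha) / (4 * x ^+ 2).

(* S_{alpha,k} phi = - phi'' + pot * phi (classical derivatives) *)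
Definition Sop (alpha : R) (k : int) (phi : R -> C) : R -> C :=
  fun x => Complex (- derive1n 2 (reF phi) x + pot alpha k x * reF phi x)
                   (- derive1n 2 (imF phi) x + pot alpha k x * imF phi x).

(* operators in L^2(R) are represented by their graphs
   (sets of pairs of representatives) *)
Definition graph := set ((R -> C) * (R -> C)).

(* graph of A_alpha(k) = A^- (+) A^+ on C_c^infinity(R^-) (+) C_c^infinity(R^+) *)
Definition graphA (alpha : R) (k : int) : graph :=
  [set p | test_fun p.1 /\ p.2 = Sop alpha k p.1].

(* Hilbert-space adjoint of a (linear relation / operator) graph *)
Definition adj (G : graph) : graph :=
  [set p | L2 p.1 /\ L2 p.2 /\ forall q, G q -> ip q.2 p.1 = ip q.1 p.2].

Definition Astar (alpha : R) (k : int) : graph := adj (graphA alpha k).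

Definition self_adjoint (G : graph) : Prop := G = adj G.

Definition sa_extension (alpha : R) (k : int) (G : graph) : Prop :=
  self_adjoint G /\ graphA alpha k `<=` G.

(* limit of a complex-valued function at 0^- / 0^+ (componentwise) *)
Definition climL (f : R -> C) (c : C) : Prop :=
  reF f x @[x --> 0^'-] --> complex.Re c /\ imF f x @[x --> 0^'-] --> complex.Im c.
Definition climR (f : R -> C) (c : C) : Prop :=
  reF f x @[x --> 0^'+] --> complex.Re c /\ imF f x @[x --> 0^'+] --> complex.Im c.

(* boundary values g^-_0, g^-_1, g^+_0, g^+_1 of (some representative of) g *)
Definition bvals (alpha : R) (g : R -> C) (g0m g1m g0p g1p : C) : Prop :=
  exists h : R -> C, aeeq h g /\
    climL (fun x => cR (`|x| `^ (alpha / 2)) * h x) g0m /\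
    climL (fun x => cR (`|x| `^ (- (1 + alpha / 2))) *
                    (h x - g0m * cR (`|x| `^ (- (alpha / 2))))) g1m /\
    climR (fun x => cR (`|x| `^ (alpha / 2)) * h x) g0p /\
    climR (fun x => cR (`|x| `^ (- (1 + alpha / 2))) *
                    (h x - g0p * cR (`|x| `^ (- (alpha / 2))))) g1p.

(* restriction of A_alpha(k) star to a domain given by a boundary condition *)
Definition restrA (alpha : R) (k : int) (P : C -> C -> C -> C -> Prop) : graph :=
  [set p | Astar alpha k p /\
     exists g0m g1m g0p g1p, bvals alpha p.1 g0m g1m g0p g1p /\ P g0m g1m g0p g1p].

(* Friedrichs extension: A star restricted to D(A star) intersected with the form
   domain (closure of C_c^infinity in the norm of the form
   ||phi||^2 + <A phi, phi>). *)
Definition form_dom (alpha : R) (k : int) : set (R -> C) :=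
  [set g | exists phi : nat -> R -> C, (forall n, test_fun (phi n)) /\
     (nrm2 (fun x => phi n x - g x) @[n --> \oo] --> (0 : R)) /\
     (forall e : R, 0 < e -> exists N : nat, forall n m : nat, (N <= n)%N -> (N <= m)%N ->
        complex.Re (ip (Sop alpha k (fun x => phi n x - phi m x))
                       (fun x => phi n x - phi m x)) < e)].

Definition friedrichs (alpha : R) (k : int) : graph :=
  [set p | Astar alpha k p /\ form_dom alpha k p.1].

(* the families of the theorem *)
Definition domF : C -> C -> C -> C -> Prop :=
  fun g0m g1m g0p g1p => g0m = 0 /\ g0p = 0.
Definition ext_IR (alpha : R) (k : int) (gamma : R) : graph :=
  restrA alpha k (fun g0m g1m g0p g1p => g0m = 0 /\ g1p = cR gamma * g0p).
Definition ext_IL (alpha : R) (k : int) (gamma : R) : graph :=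
  restrA alpha k (fun g0m g1m g0p g1p => g0p = 0 /\ g1m = cR gamma * g0m).
Definition ext_II (alpha : R) (k : int) (a : C) (gamma : R) : graph :=
  restrA alpha k (fun g0m g1m g0p g1p =>
    g0p = a * g0m /\ g1m + (a^*)%C * g1p = cR gamma * g0m).
Definition ext_III (alpha : R) (k : int) (g1 g2 g3 g4 : R) : graph :=
  restrA alpha k (fun g0m g1m g0p g1p =>
    g1m = cR g1 * g0m + Complex g2 g3 * g0p /\
    g1p = ((Complex g2 g3)^*)%C * g0m + cR g4 * g0p).

End Defs.

(* Main.v *)
(** Near [0] the equation [S g = h] is a perturbation of the Euler equation with
    solutions [x^(1+alpha/2)] and [x^(-alpha/2)]; variation of constants shows
    that the two coefficients of [g] converge, which gives the boundary values.
    Integrability of [g] and [h] at infinity forces [g'] to be square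
    integrable there, so the Wronskian vanishes along a sequence and the Green
    identity expresses [<S g, f> - <g, S f>] as [(1 + alpha)] times a symplectic
    form in the boundary values, which fill all of [C^4].  Self-adjoint
    extensions thus correspond to Lagrangian subspaces of [C^4], classified by
    the rank (0, 1 or 2) of their projection on [(g^-_0, g^+_0)].

    For the Friedrichs extension, [|u(x)|^2 <= |x| <S u, u>] for test functions
    forces [g_0 = 0] on the form domain.  Conversely, if [g_0 = 0], a sequence
    of test functions minimizing the form norm distance to [g] converges to some
    [P], and [N = g - P] solves [S N = - N] with [N_0 = 0], whence [N = 0] by
    positivity of [S] on [{g_0 = 0}]. *)
Require Import Defs.
From mathcomp Require Import all_boot all_order all_algebra.
From mathcomp Require Import all_classical all_reals all_analysis.
From mathcomp Require Import complex.
From mathcomp Require Import measurable_realfun ring lra.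
Import Order.TTheory GRing.Theory Num.Theory.
Import numFieldNormedType.Exports.
Set Implicit Arguments.
Unset Strict Implicit.
Unset Printing Implicit Defensive.
Local Open Scope classical_set_scope.
Local Open Scope ring_scope.

(** * Integrable and square-integrable real functions *)

(** All analysis is done for real functions on (0,+oo). As [S] has real, even coefficients,
    reflection carries the results to the negative axis, and real and imaginary parts carry them to
    complex functions. Absolute continuity is expressed by an integral identity on segments
    ([prim]), so regularity of weak solutions reduces to du Bois-Reymond's lemma.

    The assumption alpha < 1 makes both x^(1+alpha/2) and x^(-alpha/2) square integrable at 0, so
    that both coefficients of g have limits; it also makes the error in g_0, which is
    O(x^(3/2+alpha/2)), small enough for g_1 to exist. The factor 1 + alpha is the Wronskian of the
    two powers.

    The minimizer in the Friedrichs part is obtained without completing the form domain: the energy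
    controls values pointwise, so a minimizing sequence converges everywhere, and Fatou's lemma
    identifies the pointwise limit as the limit in L^2. Since the boundary map is onto, different
    boundary conditions give different operators, which yields disjointness. *)

Section Integrable.
Variable R : realType.
Local Notation mu := (@lebesgue_measure R).
Implicit Types (A B : set R) (f g F G : R -> R).

(** This fact and the next hold by conversion; they recast measurability in [measurableTypeR R], the
    carrier on which [mu] is declared, so that the general integration lemmas unify. *)
Lemma measurableT_R A : measurable A -> @measurable _ (measurableTypeR R) A.
Proof. by []. Qed.

Lemma measurable_funT_R A f : measurable_fun A f ->
  @measurable_fun _ _ (measurableTypeR R) _ A f.
Proof. by []. Qed.

Definition intble (A : set R) f : Prop := mu.-integrable A (EFin \o f).

Lemma intble_measurable A f : measurable A -> intble A f -> measurable_fun A f.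
Proof. by move=> mA /integrableP[/measurable_EFinP]. Qed.

Lemma intbleD A f g : measurable A -> intble A f -> intble A g ->
  intble A (fun x => f x + g x).
Proof. by move=> /measurableT_R mA If Ig; exact: (integrableD mA If Ig). Qed.

Lemma intbleZ A c f : measurable A -> intble A f -> intble A (fun x => c * f x).
Proof. by move=> /measurableT_R mA If; exact: (integrableZl mA c If). Qed.

Lemma intbleN A f : measurable A -> intble A f -> intble A (fun x => - f x).
Proof. by move=> mA If; exact: (integrableN If). Qed.

Lemma intbleB A f g : measurable A -> intble A f -> intble A g ->
  intble A (fun x => f x - g x).
Proof. by move=> mA If Ig; apply: intbleD => //; apply: intbleN. Qed.

Lemma intble_norm A f : measurable A -> intble A f -> intble A (fun x => `|f x|).
Proof. by move=> mA If; exact: integrable_norm. Qed.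

Lemma eq_intble A f g : measurable A -> (forall x, A x -> f x = g x) ->
  intble A f -> intble A g.
Proof.
move=> /measurableT_R mA fg; apply: eq_integrable => // x; rewrite inE => Ax /=.
by rewrite fg.
Qed.

Lemma le_intble A f g : measurable A -> measurable_fun A f ->
  (forall x, A x -> `|f x| <= g x) -> intble A g -> intble A f.
Proof.
move=> /measurableT_R mA /measurable_funT_R mf fg.
apply: le_integrable => //; first exact/measurable_EFinP.
by move=> x Ax /=; rewrite lee_fin (le_trans (fg _ Ax))// ler_norm.
Qed.

Lemma intbleS A B f : measurable A -> measurable B -> B `<=` A ->
  intble A f -> intble B f.
Proof. by move=> /measurableT_R mA /measurableT_R mB BA; exact: integrableS. Qed.

Lemma intble_set0 f : intble set0 f.
Proof. exact: integrable_set0. Qed.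

Lemma RintN A f : measurable A -> intble A f ->
  \int[mu]_(x in A) (- f x) = - \int[mu]_(x in A) f x.
Proof.
move=> /measurableT_R mA If; rewrite -mulN1r -RintegralZl//.
by apply: eq_Rintegral => x _; rewrite mulN1r.
Qed.

Lemma eq_Rint A f g : (forall x, A x -> f x = g x) ->
  \int[mu]_(x in A) f x = \int[mu]_(x in A) g x.
Proof. by move=> fg; apply: eq_Rintegral => x; rewrite inE; exact: fg. Qed.

Lemma Rint_subset A B f : measurable A -> measurable B -> B `<=` A ->
  intble A f -> (forall x, A x -> 0 <= f x) ->
  \int[mu]_(x in B) f x <= \int[mu]_(x in A) f x.
Proof.
move=> /measurableT_R mA /measurableT_R mB BA If f0; rewrite fine_le//.
- exact: (integrable_fin_num mB (intbleS mA mB BA If)).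
- exact: (integrable_fin_num mA If).
- by apply: ge0_subset_integral => //; move/measurable_int : If.
Qed.

Lemma intble_itvU x y z f : x <= y -> y <= z ->
  intble `[x, y] f -> intble `[y, z] f -> intble `[x, z] f.
Proof.
move=> xy yz I1 I2; rewrite /intble (@itv_bndbnd_setU _ _ _ (BRight y))//=.
have m1 : measurable `[x, y] by [].
have m2 : measurable `]y, z] by [].
have I2' : intble `]y, z] f by apply: intbleS I2 => //; exact: subset_itv_oc_cc.
have mU : @measurable_fun _ _ (measurableTypeR R) _ (`[x, y] `|` `]y, z]) f.
  by apply/measurable_funU => //; split; exact: intble_measurable.
apply/integrableP; split; first exact/measurable_EFinP.
rewrite ge0_integral_setU//=.
- apply: lte_add_pinfty; first by case/integrableP : I1.
  by case/integrableP : I2'.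
- exact/measurable_EFinP/measurableT_comp.
- by apply/disj_set2P; rewrite -subset0 => t/=; rewrite !in_itv/= => -[/andP[_]];
    rewrite leNgt => /negbTE ->.
Qed.

Lemma Rint_chasles x y z f : x <= y -> y <= z -> intble `[x, z] f ->
  \int[mu]_(t in `[x, z]) f t = \int[mu]_(t in `[x, y]) f t + \int[mu]_(t in `[y, z]) f t.
Proof.
move=> xy yz I1; rewrite -(@Rintegral_itv_obnd_cbnd _ y); last first.
  apply: intbleS I1 => //.
  by apply: subset_itv; rewrite bnd_simp.
by rewrite -(Rintegral_itvB I1)//; lra.
Qed.

Lemma Rint_itv1 x f : \int[mu]_(t in `[x, x]) f t = 0.
Proof. by rewrite set_itv1 Rintegral_set1. Qed.

Definition sq (A : set R) f : Prop := measurable_fun A f /\ intble A (fun x => f x ^+ 2).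

Lemma sqM A f g : measurable A -> sq A f -> sq A g -> intble A (fun x => f x * g x).
Proof.
move=> mA [mf If] [mg Ig].
apply: (@le_intble _ _ (fun x => 2^-1 * (f x ^+ 2 + g x ^+ 2))) => //.
- exact: measurable_funM.
- move=> x Ax; rewrite ler_norml; apply/andP; split.
    by have := sqr_ge0 (f x + g x); rewrite sqrrD; lra.
  by have := sqr_ge0 (f x - g x); rewrite sqrrB; lra.
- by apply: intbleZ => //; apply: intbleD.
Qed.

Lemma sqD A f g : measurable A -> sq A f -> sq A g -> sq A (fun x => f x + g x).
Proof.
move=> mA sf sg; have Ifg := sqM mA sf sg.
case: sf sg => mf If [mg Ig]; split; first exact: measurable_funD.
apply: (@eq_intble _ (fun x => (f x ^+ 2 + 2 * (f x * g x)) + g x ^+ 2)) => //.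
  by move=> x _; ring.
by apply: intbleD => //; apply: intbleD => //; apply: intbleZ.
Qed.

Lemma sqZ A c f : measurable A -> sq A f -> sq A (fun x => c * f x).
Proof.
move=> mA [mf If]; split; first exact: measurable_funM.
apply: (@eq_intble _ (fun x => c ^+ 2 * (f x ^+ 2))) => //.
  by move=> x _; ring.
exact: intbleZ.
Qed.

Lemma sqB A f g : measurable A -> sq A f -> sq A g -> sq A (fun x => f x - g x).
Proof.
move=> mA sf sg; have := sqD mA sf (sqZ (-1) mA sg).
by congr sq; apply/funext => x; rewrite mulN1r.
Qed.

Lemma sqS A B f : measurable A -> measurable B -> B `<=` A -> sq A f -> sq B f.
Proof.
move=> mA mB BA [mf If]; split; first exact: (measurable_funS mA BA mf).
exact: (intbleS mA mB BA If).
Qed.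

Lemma le_sq A f g : measurable A -> measurable_fun A f ->
  (forall x, A x -> `|f x| <= `|g x|) -> sq A g -> sq A f.
Proof.
move=> mA mf fg [mg Ig]; split => //.
apply: le_intble Ig => //; first exact: measurable_funX.
move=> x Ax; rewrite normrX -[leRHS]real_normK ?num_real//.
by rewrite ler_pXn2r ?nnegrE// fg.
Qed.

Lemma intble_bdM A f g M : measurable A -> measurable_fun A f ->
  (forall x, A x -> `|f x| <= M) -> intble A g -> intble A (fun x => f x * g x).
Proof.
move=> mA mf fM Ig; apply: (@le_intble _ _ (fun x => M * `|g x|)) => //.
- by apply: measurable_funM => //; exact: intble_measurable.
- by move=> x Ax; rewrite normrM ler_wpM2r// fM.
- by apply: intbleZ => //; apply: intble_norm.
Qed.

Lemma sq_bdM A f g M : measurable A -> measurable_fun A f ->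
  (forall x, A x -> `|f x| <= M) -> sq A g -> sq A (fun x => f x * g x).
Proof.
move=> mA mf fM sg; apply: (@le_sq _ _ (fun x => M * g x)) (sqZ M mA sg) => //.
  by apply: measurable_funM => //; exact: sg.1.
move=> x Ax; rewrite !normrM ler_wpM2r// (le_trans (fM _ Ax))// ler_norm//.
Qed.

Lemma intble_cst x y (c : R) : intble `[x, y] (fun=> c).
Proof.
apply: measurable_bounded_integrable => //.
  rewrite /= lebesgue_measure_itv/=.
  by case: ifP => _; rewrite -?EFinD ltry.
exact/bounded_cst.
Qed.

Lemma sq_intble x y f : sq `[x, y] f -> intble `[x, y] f.
Proof.
move=> [mf If]; apply: (@le_intble _ _ (fun t => 1 + f t ^+ 2)) => //.
  move=> t _; have h1 := sqr_ge0 (f t - 1); have h2 := sqr_ge0 (f t + 1).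
  by rewrite ler_norml; apply/andP; split; nra.
by apply: intbleD => //; exact: intble_cst.
Qed.

Lemma RintD A f g : measurable A -> intble A f -> intble A g ->
  \int[mu]_(x in A) (f x + g x) = \int[mu]_(x in A) f x + \int[mu]_(x in A) g x.
Proof. by move=> /measurableT_R mA If Ig; rewrite RintegralD. Qed.

Lemma RintB A f g : measurable A -> intble A f -> intble A g ->
  \int[mu]_(x in A) (f x - g x) = \int[mu]_(x in A) f x - \int[mu]_(x in A) g x.
Proof. by move=> /measurableT_R mA If Ig; rewrite RintegralB. Qed.

Lemma RintZ A c f : measurable A -> intble A f ->
  \int[mu]_(x in A) (c * f x) = c * \int[mu]_(x in A) f x.
Proof. by move=> /measurableT_R mA If; rewrite RintegralZl. Qed.

Lemma le_Rint A f g : measurable A -> intble A f -> intble A g ->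
  (forall x, A x -> f x <= g x) ->
  \int[mu]_(x in A) f x <= \int[mu]_(x in A) g x.
Proof. by move=> /measurableT_R mA If Ig fg; exact: le_Rintegral. Qed.

Lemma normr_Rint A f : measurable A -> intble A f ->
  `|\int[mu]_(x in A) f x| <= \int[mu]_(x in A) `|f x|.
Proof. by move=> /measurableT_R mA If; exact: le_normr_Rintegral. Qed.

Lemma Rint_cst x y (c : R) : x <= y -> \int[mu]_(t in `[x, y]) c = c * (y - x).
Proof.
move=> xy; rewrite Rintegral_cst//= lebesgue_measure_itv/=.
by case: ltP => //; rewrite lee_fin => yx; congr (_ * _) => /=; lra.
Qed.

End Integrable.

(** * Locally absolutely continuous functions on the half-line *)

Section Primitive.
Variable R : realType.
Local Notation mu := (@lebesgue_measure R).
Local Notation Rp := (`](0 : R), +oo[%classic : set R).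
Implicit Types (A B : set R) (f g F G : R -> R) (x y z t c : R).

(** Real induction along a segment. The supremum of the points reached from [a] is itself reached by
    locality, and locality would carry [P] past it if it lay below [b]. It turns the local error
    bound in [primM] into a global one. *)
Lemma local_to_global (a b : R) (P : R -> R -> Prop) : a <= b ->
  (forall x y z, a <= x -> x <= y -> y <= z -> z <= b -> P x y -> P y z -> P x z) ->
  (forall t, a <= t -> t <= b -> exists2 d, 0 < d &
    forall x y, a <= x -> x <= t -> t <= y -> y <= b -> y - x < d -> P x y) ->
  P a b.
Proof.
move=> ab Ptr Ploc.
pose S := [set y | a <= y <= b /\ P a y].
have Sa : S a.
  split; first by rewrite lexx ab.
  have [d d0] := Ploc a (lexx a) ab; apply => //; lra.
have Sub : ubound S b by move=> y [/andP[]].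
have hS : has_sup S by split; [exists a|exists b].
have sa : a <= sup S by apply: ub_le_sup => //; exists b.
have sb : sup S <= b by apply: ge_sup => //; exists a.
have [d d0 Pd] := Ploc _ sa sb.
have d20 : 0 < d / 2 by lra.
have [y0 [/andP[ay0 y0b] Py0] y0s] := sup_adherent d20 hS.
have y0S : y0 <= sup S by apply: ub_le_sup; [exists b|split => //; rewrite ay0].
set s := sup S in sa sb Pd y0s y0S.
have Ps : P a s.
  by apply: (Ptr _ y0) => //; apply: Pd => //; lra.
have [sltb|bles] := ltP s b; last by have -> : b = s by lra.
set z := Order.min b (s + d / 2).
have sz : s < z by rewrite /z lt_min; apply/andP; split; lra.
have zb : z <= b by rewrite /z ge_min lexx.
have zs : z <= s + d / 2 by rewrite /z ge_min lexx orbT.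
have Sz : S z.
  split; first by apply/andP; split => //; lra.
  apply: (Ptr _ s) => //; first by lra.
  by apply: Pd => //; lra.
have : z <= s by apply: ub_le_sup => //; exists b.
by lra.
Qed.

Lemma continuous_seg_bounded x y F : x <= y ->
  {within `[x, y], continuous F} -> exists M, forall t, `[x, y]%classic t -> `|F t| <= M.
Proof.
move=> xy cF.
have [|c _ H] := @EVT_max R (fun t => `|F t|) x y xy.
  by move=> t; apply: cvg_norm; exact: cF.
by exists `|F c| => t; exact: H.
Qed.

Definition contp F := forall x, 0 < x -> {for x, continuous F}.

Lemma contp_within F x y : contp F -> 0 < x -> {within `[x, y], continuous F}.
Proof.
move=> cF x0; apply: continuous_in_subspaceT => t; rewrite inE/= in_itv/= => /andP[xt _].
by apply: cF; lra.
Qed.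

Lemma contp_measurable F : contp F -> measurable_fun Rp F.
Proof.
move=> cF; apply: open_continuous_measurable_fun => //.
by move=> t; rewrite inE/= in_itv/= andbT; exact: cF.
Qed.

Lemma subset_itv_pos x y : 0 < x -> `[x, y] `<=` Rp.
Proof. by move=> x0 t /=; rewrite !in_itv/= andbT => /andP[xt _]; lra. Qed.

Lemma contp_itv_measurable F x y : contp F -> 0 < x -> measurable_fun `[x, y] F.
Proof.
move=> cF x0; apply: measurable_funS (contp_measurable cF) => //.
exact: subset_itv_pos.
Qed.

Lemma contp_bounded F x y : contp F -> 0 < x ->
  exists M, forall t, `[x, y]%classic t -> `|F t| <= M.
Proof.
move=> cF x0; have [xy|yx] := leP x y.
  by apply: continuous_seg_bounded => //; exact: contp_within.
by exists 0 => t /=; rewrite in_itv/=; lra.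
Qed.

Lemma contp_intbleM F f x y : contp F -> 0 < x -> intble `[x, y] f ->
  intble `[x, y] (fun t => F t * f t).
Proof.
move=> cF x0 If; have [M FM] := contp_bounded y cF x0.
by apply: (intble_bdM _ _ FM) => //; exact: contp_itv_measurable.
Qed.

Lemma contp_intble F x y : contp F -> 0 < x -> intble `[x, y] F.
Proof.
move=> cF x0; have := contp_intbleM cF x0 (intble_cst x y 1).
by congr intble; apply/funext => t; rewrite mulr1.
Qed.

(* [F] is a locally absolutely continuous function on the open half-line
   (0,+oo) with almost everywhere derivative [f]. *)
Definition prim F f := forall x y, 0 < x -> x <= y ->
  intble `[x, y] f /\ F y - F x = \int[mu]_(t in `[x, y]) f t.

Lemma prim_intble F f x y : prim F f -> 0 < x -> intble `[x, y] f.
Proof.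
move=> pF x0; have [xy|yx] := leP x y; first by have [] := pF x y x0 xy.
by rewrite set_itv_ge -?leNgt ?bnd_simp//; exact: intble_set0.
Qed.

Lemma primE F f x y : prim F f -> 0 < x -> x <= y ->
  F y - F x = \int[mu]_(t in `[x, y]) f t.
Proof. by move=> pF x0 xy; have [] := pF x y x0 xy. Qed.

Lemma prim_contp F f : prim F f -> contp F.
Proof.
move=> pF x x0.
have ab : x / 2 < x * 2 by lra.
have x20 : 0 < x / 2 by lra.
have If := prim_intble (x * 2) pF x20.
have := parameterized_integral_continuous (ltW ab) If.
move/(continuous_within_itvP _ ab) => [+ _ _].
have xab : x \in `]x / 2, x * 2[ by rewrite in_itv/=; lra.
move=> /(_ x xab) cx.
apply: (@cvg_trans _ ((fun y => F (x / 2) + parameterized_integral mu (x / 2) y f) y @[y --> x])).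
  apply: near_eq_cvg.
  near=> y.
  rewrite /parameterized_integral -(primE pF x20); last first.
    by near: y; apply: lt_le_nbhsr; lra.
  by lra.
have -> : F x = F (x / 2) + parameterized_integral mu (x / 2) x f.
  rewrite /parameterized_integral -(primE pF x20); lra.
exact: (cvgD (cvg_cst _) cx).
Unshelve. all: by end_near. Qed.

Lemma prim_cst c : prim (fun=> c) (fun=> 0).
Proof.
move=> x y x0 xy; split; first exact: intble_cst.
by rewrite Rint_cst// mul0r subrr.
Qed.

Lemma eq_prim F f g : (forall x, 0 < x -> f x = g x) -> prim F f -> prim F g.
Proof.
move=> fg pF x y x0 xy; have [If FE] := pF x y x0 xy.
have fgxy t : `[x, y]%classic t -> f t = g t.
  by rewrite /= in_itv/= => /andP[xt _]; apply: fg; lra.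
by split; [exact: eq_intble If|rewrite FE; exact: eq_Rint].
Qed.

Lemma eq_priml F G f : (forall x, 0 < x -> F x = G x) -> prim F f -> prim G f.
Proof.
move=> FG pF x y x0 xy; have [If FE] := pF x y x0 xy.
by split => //; rewrite -FE !FG//; lra.
Qed.

Lemma primD F G f g : prim F f -> prim G g ->
  prim (fun x => F x + G x) (fun x => f x + g x).
Proof.
move=> pF pG x y x0 xy; have [If FE] := pF x y x0 xy; have [Ig GE] := pG x y x0 xy.
split; first exact: intbleD.
by rewrite RintD// -FE -GE; ring.
Qed.

Lemma primZ c F f : prim F f -> prim (fun x => c * F x) (fun x => c * f x).
Proof.
move=> pF x y x0 xy; have [If FE] := pF x y x0 xy.
split; first exact: intbleZ.
by rewrite RintZ// -FE; ring.
Qed.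

Lemma primB F G f g : prim F f -> prim G g ->
  prim (fun x => F x - G x) (fun x => f x - g x).
Proof.
move=> pF pG; have := primD pF (primZ (-1) pG).
by congr prim; apply/funext => x; rewrite mulN1r.
Qed.

(** Product rule without exchanging integrals: on a short segment [a,b] the defect F b G b - F a G a
    - int h equals the integral of (F b - F u) g u + (G a - G u) f u, hence is at most e times int
    (|f| + |g|) by continuity. This bound is additive in the segment, so [local_to_global] extends
    it to [x,y], and e is arbitrary. *)
Lemma primM F G f g : prim F f -> prim G g ->
  prim (fun x => F x * G x) (fun x => F x * g x + G x * f x).
Proof.
move=> pF pG x y x0 xy.
have cF := prim_contp pF; have cG := prim_contp pG.
set h := fun t => _ + _.
have Ih (a b : R) : 0 < a -> intble `[a, b] h.
  by move=> a0; apply: intbleD => //; apply: contp_intbleM => //; [exact: prim_intble pG a0|exact: prim_intble pF a0].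
split; first exact: Ih.
set Phi : R -> R := fun t => `|f t| + `|g t|.
have IPhi (a b : R) : 0 < a -> intble `[a, b] Phi.
  by move=> a0; apply: intbleD => //; apply: intble_norm => //; [exact: prim_intble pF a0|exact: prim_intble pG a0].
apply/eqP; rewrite -subr_eq0 -normr_le0; apply/eqP.
suff H (e : R) : 0 < e -> `|F y * G y - F x * G x - \int[mu]_(t in `[x, y]) h t| <=
    e * \int[mu]_(t in `[x, y]) Phi t.
  have P0 : 0 <= \int[mu]_(t in `[x, y]) Phi t.
    by apply: Rintegral_ge0 => t _; rewrite addr_ge0.
  set n := `|_| in H *; set p := (\int[mu]_(t in _) _)%R in H P0.
  apply/eqP/ler_addgt0Pl => e e0; rewrite addr0.
  have /H : 0 < e / (p + 1) by rewrite divr_gt0//; lra.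
  move=> /le_trans; apply.
  rewrite -mulrA ler_piMr ?(ltW e0)// mulrC ler_pdivrMr; lra.
move=> e0.
pose P (a b : R) := `|F b * G b - F a * G a - \int[mu]_(t in `[a, b]) h t| <=
    e * \int[mu]_(t in `[a, b]) Phi t.
apply: (@local_to_global x y P) => //.
  move=> a b c xa ab bc cy; rewrite /P => Pab Pbc.
  have a0 : 0 < a by lra.
  rewrite (@Rint_chasles _ a b c h)//; last exact: Ih.
  rewrite (@Rint_chasles _ a b c Phi)//; last exact: IPhi.
  rewrite mulrDr (le_trans _ (lerD Pab Pbc))// (le_trans _ (ler_normD _ _))//.
  by rewrite le_eqVlt; apply/orP; left; apply/eqP; congr `|_|; ring.
move=> t xt ty; have t0 : 0 < t by lra.
have e20 : 0 < e / 2 by lra.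
have /cvgrPdist_lt /(_ _ e20) [d1 /= d10 Fd] := cF t t0.
have /cvgrPdist_lt /(_ _ e20) [d2 /= d20 Gd] := cG t t0.
exists (Order.min d1 d2); first by rewrite lt_min d10.
move=> a b xa at_ tb by_ ba; rewrite /P.
move: ba; rewrite lt_min => /andP[ba1 ba2].
have a0 : 0 < a by lra.
have ab : a <= b by lra.
have FE u v : `[a, b]%classic u -> `[a, b]%classic v -> `|F u - F v| <= e.
  rewrite /= !in_itv/= => /andP[au ub] /andP[av vb].
  have /Fd : ball t d1 u by rewrite /ball/= ltr_norml; apply/andP; split; lra.
  have /Fd : ball t d1 v by rewrite /ball/= ltr_norml; apply/andP; split; lra.
  rewrite !ltr_norml ler_norml => /andP[? ?] /andP[? ?]; apply/andP; split; lra.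
have GE u v : `[a, b]%classic u -> `[a, b]%classic v -> `|G u - G v| <= e.
  rewrite /= !in_itv/= => /andP[au ub] /andP[av vb].
  have /Gd : ball t d2 u by rewrite /ball/= ltr_norml; apply/andP; split; lra.
  have /Gd : ball t d2 v by rewrite /ball/= ltr_norml; apply/andP; split; lra.
  rewrite !ltr_norml ler_norml => /andP[? ?] /andP[? ?]; apply/andP; split; lra.
have Faa : `[a, b]%classic a by rewrite /= in_itv/= lexx.
have Fbb : `[a, b]%classic b by rewrite /= in_itv/= lexx ab.
have If := prim_intble b pF a0.
have Ig := prim_intble b pG a0.
have -> : F b * G b - F a * G a - \int[mu]_(t in `[a, b]) h t =
    \int[mu]_(t in `[a, b]) (F b * g t + G a * f t - h t).
  rewrite RintB//; [|by apply: intbleD => //; exact: intbleZ|exact: Ih].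
  rewrite [X in _ = X - _]RintD//; [|exact: intbleZ|exact: intbleZ].
  by rewrite !RintZ// -(primE pF)// -(primE pG)//; ring.
rewrite (le_trans (normr_Rint _ _))//.
  by apply: intbleB => //; [apply: intbleD => //; exact: intbleZ|exact: Ih].
rewrite -RintZ//; last exact: IPhi.
apply: le_Rint => //.
- apply: intble_norm => //.
  by apply: intbleB => //; [apply: intbleD => //; exact: intbleZ|exact: Ih].
- by apply: intbleZ => //; exact: IPhi.
- move=> u abu; rewrite /h /Phi.
  have -> : F b * g u + G a * f u - (F u * g u + G u * f u) =
      (F b - F u) * g u + (G a - G u) * f u by ring.
  rewrite (le_trans (ler_normD _ _))// !normrM mulrDr addrC lerD//.
    by rewrite ler_wpM2r// GE.
  by rewrite ler_wpM2r// FE.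
Qed.

Lemma prim_derive F f : (forall x : R, 0 < x -> is_derive x 1 F (f x)) ->
  contp f -> prim F f.
Proof.
move=> dF cf x y x0 xy; split; first exact: contp_intble.
move: xy; rewrite le_eqVlt => /predU1P[<-|xy]; first by rewrite Rint_itv1 subrr.
have cF z : 0 < z -> {for z, continuous F}.
  by move=> z0; apply/differentiable_continuous/derivable1_diffP; have [] := dF z z0.
rewrite /Rintegral (@continuous_FTC2 _ f F) => //.
- exact: contp_within.
- split.
  + by move=> t; rewrite in_itv/= => /andP[xt _]; have [|//] := dF t; lra.
  + by apply/cvg_at_right_filter; apply: cF.
  + by apply/cvg_at_left_filter; apply: cF; lra.
- move=> t; rewrite in_itv/= => /andP[xt _].
  by rewrite derive1E; have [|] := dF t; [lra|].
Qed.

End Primitive.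

(** * Integrals over half-lines and limits of primitives at the origin *)

Section Improper.
Variable R : realType.
Local Notation mu := (@lebesgue_measure R).
Local Notation Rp := (`](0 : R), +oo[%classic : set R).
Implicit Types (A B : set R) (f g F G : R -> R) (x y z t c : R).

Lemma cvg_Rint_bigcup (T_ : nat -> set R) f :
  (forall n, measurable (T_ n)) -> {homo T_ : n m / (n <= m)%N >-> n `<=` m} ->
  (forall n x, T_ n x -> 0 <= f x) ->
  (forall n, measurable_fun (T_ n) f) ->
  (\int[mu]_(x in T_ n) (f x)%:E @[n --> \oo] --> \int[mu]_(x in \bigcup_n T_ n) (f x)%:E)%E.
Proof.
move=> mT hT f0 mTf.
apply: (@ge0_nondecreasing_set_cvg_integral _ (measurableTypeR R) R T_ (EFin \o f) mu) => //.
- by move=> n m nm; rewrite subsetEset; exact: hT.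
- by move=> n; apply/measurable_EFinP; exact: mTf.
Qed.

Lemma intble_bigcup (T_ : nat -> set R) f C :
  (forall n, measurable (T_ n)) -> {homo T_ : n m / (n <= m)%N >-> n `<=` m} ->
  (forall n, intble (T_ n) f) ->
  (forall n x, T_ n x -> 0 <= f x) ->
  (forall n, \int[mu]_(x in T_ n) f x <= C) -> intble (\bigcup_n T_ n) f.
Proof.
move=> mT hT iT f0 TC.
have mTf : forall n, measurable_fun (T_ n) f by move=> n; exact: intble_measurable.
have mUf : @measurable_fun _ _ (measurableTypeR R) _ (\bigcup_n T_ n) f.
  by apply/measurable_fun_bigcup.
apply/integrableP; split; first exact/measurable_EFinP.
have := cvg_Rint_bigcup mT hT f0 mTf.
rewrite (@eq_integral _ _ _ mu _ (EFin \o f) (fun x => `|(EFin \o f) x|%E)); last first.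
  by move=> x; rewrite inE => -[n _ Tx] /=; rewrite ger0_norm// (f0 n).
move=> cT; apply: (@le_lt_trans _ _ C%:E); last exact: ltry.
apply: (cvge_to_le cT); apply: nearW => n.
rewrite -[leLHS]fineK ?lee_fin; first exact: TC.
exact: (integrable_fin_num (measurableT_R (mT n)) (iT n)).
Qed.

Lemma Rint_setD A B f : measurable A -> measurable B -> A `<=` B -> intble B f ->
  \int[mu]_(x in B) f x - \int[mu]_(x in A) f x = \int[mu]_(x in B `\` A) f x.
Proof.
move=> mA mB AB If.
have mBA : measurable (B `\` A) by exact: measurableD.
rewrite -[in X in X - _](setDUK AB) Rintegral_setU ?setDUK//; first by ring.
by apply/disj_set2P; rewrite setIDA setDE setIAC setICr set0I.
Qed.

Lemma Rint_setD_norm A B f : measurable A -> measurable B -> A `<=` B -> intble B f ->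
  `|\int[mu]_(x in B) f x - \int[mu]_(x in A) f x| <=
    \int[mu]_(x in B) `|f x| - \int[mu]_(x in A) `|f x|.
Proof.
move=> mA mB AB If.
have mBA : measurable (B `\` A) by exact: measurableD.
rewrite !Rint_setD//; last exact: intble_norm.
by apply: normr_Rint => //; apply: intbleS If => // x [].
Qed.

Lemma bigcup_seg_pos : \bigcup_n `[(n.+1%:R)^-1, n.+1%:R]%classic = Rp.
Proof.
apply/seteqP; split => x /=.
  by move=> [n _] /=; rewrite !in_itv/= andbT => /andP[+ _]; apply: lt_le_trans; rewrite invr_gt0.
rewrite in_itv/= andbT => x0.
exists (Num.truncn (Order.max x (x^-1))) => //=.
have := truncnS_gt (Order.max x x^-1).
rewrite gt_max => /andP[h1 h2]; rewrite in_itv/= (ltW h1) andbT.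
by rewrite -[leRHS]invrK lef_pV2 ?posrE ?invr_gt0// ltW.
Qed.

Lemma seg_pos_homo : {homo (fun n => `[(n.+1%:R)^-1, n.+1%:R]%classic : set R) :
  n m / (n <= m)%N >-> n `<=` m}.
Proof.
move=> n m nm x /=; rewrite !in_itv/= => /andP[h1 h2]; apply/andP; split.
  by apply: le_trans h1; rewrite lef_pV2 ?posrE// ler_nat.
by rewrite (le_trans h2)// ler_nat.
Qed.

Lemma seg_pos n : `[(n.+1%:R)^-1, n.+1%:R] `<=` Rp.
Proof. by apply: subset_itv_pos; rewrite invr_gt0. Qed.

(** Monotone convergence for |f| gives the threshold, and the error for f on any larger segment is
    at most the mass of |f| outside. Uniformity in [x] and [y] leaves both endpoints free to be
    moved to where boundary terms are small. *)
Lemma exhaustion f : intble Rp f -> forall e, 0 < e ->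
  exists n : nat, forall x y, 0 < x -> x <= n.+1%:R^-1 -> n.+1%:R <= y ->
  `|\int[mu]_(t in Rp) f t - \int[mu]_(t in `[x, y]) f t| < e.
Proof.
move=> If e e0.
have mf := intble_measurable (measurable_itv _) If.
have INf := intble_norm (measurable_itv _) If.
have mT n : measurable `[(n.+1%:R : R)^-1, n.+1%:R] by [].
have mNf n : measurable_fun `[(n.+1%:R : R)^-1, n.+1%:R] (fun x => `|f x|).
  by apply: measurableT_comp => //; apply: measurable_funS mf => //; exact: seg_pos.
have := cvg_Rint_bigcup mT seg_pos_homo (fun n x _ => normr_ge0 _) mNf.
rewrite bigcup_seg_pos => ct.
have [N _ /(_ N (leqnn N))] : \forall n \near \oo,
    `|\int[mu]_(t in Rp) `|f t| -
      \int[mu]_(t in `[(n.+1%:R)^-1, n.+1%:R]) `|f t| | < e.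
  have : (\int[mu]_(t in `[(n.+1%:R)^-1, n.+1%:R]) `|f t|)%R @[n --> \oo] -->
      (\int[mu]_(t in Rp) `|f t|)%R.
    apply: fine_cvg; rewrite fineK//.
    exact: (integrable_fin_num (measurableT_R (measurable_itv _)) INf).
  by move/cvgrPdist_lt; exact.
move=> Ne; exists N => x y x0 xN Ny.
apply: le_lt_trans Ne.
apply: (le_trans (Rint_setD_norm _ _ (@subset_itv_pos _ x y x0) If)) => //.
apply: le_trans (ler_norm _); rewrite lerB//.
apply: Rint_subset => //.
  by apply: subset_itv; rewrite bnd_simp.
by apply: intbleS INf => //; exact: subset_itv_pos.
Qed.

Lemma intble_small f c : intble `[c, +oo[ f -> forall e, 0 < e -> exists2 y, c <= y & `|f y| < e.
Proof.
move=> If e e0; apply: contrapT => /forall2NP H.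
have Hf x : c <= x -> e <= `|f x|.
  by move=> cx; have [//|/negP] := H x; rewrite -leNgt.
have INf := intble_norm (measurable_itv _) If.
set I := (\int[mu]_(t in `[c, +oo[) `|f t|)%R.
have I0 : 0 <= I by apply: Rintegral_ge0 => t _.
(* With this choice e (y - c) = I + e, more than the whole integral of |f| allows. *)
set y := c + (I / e + 1).
have cy : c <= y by rewrite /y lerDl addr_ge0// divr_ge0// ltW.
have sub : `[c, y]%classic `<=` `[c, +oo[%classic.
  by move=> t /=; rewrite !in_itv/= andbT => /andP[].
have h1 : (\int[mu]_(t in `[c, y]) `|f t|)%R <= I.
  by apply: Rint_subset.
have h2 : (\int[mu]_(t in `[c, y]) e)%R <= (\int[mu]_(t in `[c, y]) `|f t|)%R.
  apply: le_Rint => //; first exact: intble_cst.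
    exact: intbleS INf.
  by move=> t /=; rewrite in_itv/= => /andP[ct _]; exact: Hf.
move: h2; rewrite Rint_cst// => h2.
have : e * (y - c) = I + e by rewrite /y; field; rewrite gt_eqF.
by move=> E; move: h2; rewrite E; lra.
Qed.

(** A bound along arbitrarily large [y] suffices because the integral is monotone; [sq_deriv]
    controls the boundary term at infinity only along such points. *)
Lemma intble_ray f C : (forall x, 1 <= x -> 0 <= f x) ->
  (forall y, intble `[1, y] f) ->
  (forall N, exists2 y, N <= y & \int[mu]_(x in `[1, y]) f x <= C) ->
  intble `[1, +oo[ f.
Proof.
move=> f0 If HC.
have -> : `[(1 : R), +oo[%classic = \bigcup_n `[1, n%:R]%classic.
  apply/seteqP; split => x /=; rewrite in_itv/=.
    rewrite andbT => x1; exists (Num.truncn x).+1 => //=.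
    by rewrite in_itv/= x1 ltW// truncnS_gt.
  by move=> [n _] /=; rewrite in_itv/= => /andP[->].
apply: (@intble_bigcup _ _ C) => //.
- move=> n m nm x /=; rewrite !in_itv/= => /andP[-> h2].
  by rewrite (le_trans h2)// ler_nat.
- by move=> n x /=; rewrite in_itv/= => /andP[x1 _]; exact: f0.
- move=> n; have [y ny yC] := HC n%:R; apply: le_trans yC.
  apply: Rint_subset => //.
  + by apply: subset_itv; rewrite bnd_simp.
  + by move=> x /=; rewrite in_itv/= => /andP[x1 _]; exact: f0.
Qed.

(** The limit is F 1 minus the integral over ]0,1]. The exact formula for F - l is kept because it
    yields a rate of convergence in [coef_lim]. *)
Lemma prim_lim0 F f : prim F f -> intble `]0, 1] f ->
  exists l, (F x @[x --> 0^'+] --> l) /\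
    forall x, 0 < x -> x <= 1 -> F x - l = \int[mu]_(t in `]0, x]) f t.
Proof.
move=> pF If.
have If01 : intble `[0, 1] f.
  have /measurable_fun_itv_obnd_cbndP mf := intble_measurable (measurable_itv _) If.
  apply/integrableP; split; first exact/measurable_EFinP.
  rewrite -integral_itv_obnd_cbnd; first by case/integrableP : If.
  have mf1 := intble_measurable (measurable_itv _) If.
  by apply/measurable_EFinP; apply: measurableT_comp.
have E x : 0 < x -> x <= 1 ->
    F x - (F 1 - \int[mu]_(t in `]0, 1]) f t) = \int[mu]_(t in `]0, x]) f t.
  move=> x0 x1.
  have Ix : intble `]0, x] f by apply: intbleS If => //; apply: subset_itvl; rewrite bnd_simp.
  have IS : intble `]x, 1] f by apply: intbleS If => //; apply: subset_itvr; rewrite bnd_simp ltW.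
  have := Rintegral_itvB If (_ : (BRight 0 <= BRight x)%O) x1.
  rewrite bnd_simp (ltW x0) => /(_ isT); rewrite (@Rintegral_itv_obnd_cbnd _ x)// -(primE pF)//; lra.
exists (F 1 - \int[mu]_(t in `]0, 1]) f t); split => //.
set l := F 1 - _ in E *.
have c0 : parameterized_integral mu 0 x f @[x --> 0^'+] --> (0 : R).
  exact: (cvg_at_right_filter (parameterized_integral_cvg_left ltr01 If01)).
apply: (@cvg_trans _ ((fun x => l + parameterized_integral mu 0 x f) x @[x --> 0^'+])).
  apply: near_eq_cvg; near=> x.
  have x0 : 0 < x by near: x; exact: nbhs_right_gt.
  have x1 : x <= 1 by near: x; exact: nbhs_right_le.
  rewrite /parameterized_integral -Rintegral_itv_obnd_cbnd -?E//; first by ring.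
  by apply: intbleS If => //; apply: subset_itvl; rewrite bnd_simp.
by rewrite -[in nbhs l](addr0 l); exact: (cvgD (cvg_cst _) c0).
Unshelve. all: by end_near. Qed.

End Improper.

(** * Smooth cut-off functions *)

Section Derivatives.
Variable R : realType.
Implicit Types (f g u v : R -> R) (x a b c : R).

Lemma is_derive_add f g x a b : is_derive x 1 f a -> is_derive x 1 g b ->
  is_derive x 1 (fun y => f y + g y) (a + b).
Proof. by move=> df dg; exact: (is_deriveD df dg). Qed.

Lemma is_derive_mul f g x a b : is_derive x 1 f a -> is_derive x 1 g b ->
  is_derive x 1 (fun y => f y * g y) (f x * b + g x * a).
Proof. by move=> df dg; exact: (is_deriveM df dg). Qed.

Lemma is_derive_scale c f x a : is_derive x 1 f a ->
  is_derive x 1 (fun y => c * f y) (c * a).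
Proof. by move=> df; exact: (is_deriveZ c df). Qed.

Lemma is_derive_val f x a b : a = b -> is_derive x 1 f a -> is_derive x 1 f b.
Proof. by move=> <-. Qed.

Lemma is_derive_near f g x a : (\forall y \near x, f y = g y) ->
  is_derive x 1 f a -> is_derive x 1 g a.
Proof. by move=> fg df; exact: (near_eq_is_derive fg df). Qed.

Lemma is_derive_affine c d x : is_derive x 1 (fun y => c * y + d) c.
Proof.
by apply: (@is_derive_val _ _ (c * 1 + 0)); ring.
Qed.

Lemma derive1_fun f g : (forall x, is_derive x 1 f (g x)) -> f^`()%classic = g.
Proof.
by move=> dfg; apply/funext => x; rewrite derive1E; have [_ ->] := dfg x.
Qed.

Lemma smooth_is_derive u x : smooth u -> is_derive x 1 u (u^`()%classic x).
Proof. by move=> su; rewrite derive1E; apply: derivableP; exact: (su 0%N x). Qed.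

Lemma smooth_derive1 u : smooth u -> smooth u^`()%classic.
Proof. by move=> su n x; rewrite -derive1Sn; exact: su. Qed.

(** Algebra of functions generated by [B] and the constants. If the derivatives of the generators
    stay in it, so do all iterated derivatives; this avoids Leibniz and chain formulas of higher
    order. *)
Inductive alg (B : set (R -> R)) : (R -> R) -> Prop :=
| alg_base f : B f -> alg B f
| alg_cst c : alg B (fun=> c)
| alg_add f g : alg B f -> alg B g -> alg B (fun x => f x + g x)
| alg_mul f g : alg B f -> alg B g -> alg B (fun x => f x * g x).

Lemma alg_smooth (B : set (R -> R)) :
  (forall f, B f -> exists f', (forall x, is_derive x 1 f (f' x)) /\ alg B f') ->
  forall f, alg B f -> smooth f.
Proof.
move=> HB f af.
have step h : alg B h -> exists h', (forall x, is_derive x 1 h (h' x)) /\ alg B h'.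
  elim=> {h}.
  - exact: HB.
  - by move=> c; exists (fun=> 0); split => [x|]; [exact: is_derive_cst|exact: alg_cst].
  - move=> h k _ [h' [dh ah]] _ [k' [dk ak]]; exists (fun x => h' x + k' x); split.
      by move=> x; exact: is_derive_add.
    exact: alg_add.
  - move=> h k ah [h' [dh ah']] ak [k' [dk ak']].
    exists (fun x => h x * k' x + k x * h' x); split.
      by move=> x; exact: is_derive_mul.
    by apply: alg_add; apply: alg_mul.
have aD n : alg B (f^`(n))%classic.
  elim: n => [//|n /step[h' [dh ah]]].
  by rewrite derive1nS (derive1_fun dh).
by move=> n x; have [h' [dh _]] := step _ (aD n); exact: ex_derive.
Qed.

Lemma smooth_alg f : alg (@smooth R) f -> smooth f.
Proof.
apply: alg_smooth => u su; exists (u^`())%classic; split.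
  by move=> x; exact: smooth_is_derive.
by apply: alg_base; exact: smooth_derive1.
Qed.

Lemma smooth_cst c : smooth (fun _ : R => c).
Proof. exact/smooth_alg/alg_cst. Qed.

Lemma smoothD u v : smooth u -> smooth v -> smooth (fun x => u x + v x).
Proof. by move=> su sv; apply/smooth_alg/alg_add; apply: alg_base. Qed.

Lemma smoothM u v : smooth u -> smooth v -> smooth (fun x => u x * v x).
Proof. by move=> su sv; apply/smooth_alg/alg_mul; apply: alg_base. Qed.

Lemma smoothZ c u : smooth u -> smooth (fun x => c * u x).
Proof. by move=> su; exact: (smoothM (@smooth_cst c) su). Qed.

Lemma smoothB u v : smooth u -> smooth v -> smooth (fun x => u x - v x).
Proof.
move=> su sv; have := smoothD su (@smoothZ (-1) _ sv).
by congr smooth; apply/funext => x; rewrite mulN1r.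
Qed.

Lemma smooth_affine u c d : smooth u -> smooth (fun x => u (c * x + d)).
Proof.
move=> su.
apply: (@alg_smooth [set f | exists2 v, smooth v & f = fun x => v (c * x + d)]); last first.
  by apply: alg_base; exists u.
move=> _ [v sv ->]; exists (fun x => v^`()%classic (c * x + d) * c); split.
  move=> x; apply: (is_derive1_comp (g := fun y => c * y + d)).
    exact: smooth_is_derive.
  exact: is_derive_affine.
apply: alg_mul (alg_cst _ _); apply: alg_base; exists (v^`())%classic => //.
exact: smooth_derive1.
Qed.

Lemma smooth_continuous u : smooth u -> continuous u.
Proof.
by move=> su x; apply/differentiable_continuous/derivable1_diffP; exact: (su 0%N x).
Qed.

(** [flat 0] is the classical function exp (-1/x) extended by zero. The weights x^(-n) make the
    family stable under differentiation up to linear combinations, as [alg_smooth] requires. *)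
Definition flat (n : nat) x : R := if 0 < x then x ^- n * expR (- x^-1) else 0.

(** With N = n + 1 and t = 1/x, the inequality exp (t/N) >= t/N raised to the power N gives exp (-t)
    <= (N x)^N. *)
Lemma flat_le n x : 0 < x -> flat n x <= n.+1%:R ^+ n.+1 * x.
Proof.
move=> x0; rewrite /flat x0 expRN.
have N0 : 0 < n.+1%:R :> R by [].
have t0 : 0 < x^-1 / n.+1%:R by rewrite divr_gt0// invr_gt0.
have : (x^-1 / n.+1%:R) ^+ n.+1 <= expR (x^-1).
  have -> : x^-1 = x^-1 / n.+1%:R * n.+1%:R by rewrite divfK// gt_eqF.
  rewrite expRM_natr mulfK ?gt_eqF//.
  rewrite ler_pXn2r ?nnegrE ?expR_ge0 ?ltW//.
  by rewrite (lt_le_trans _ (expR_ge1Dx _))// ltrDr.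
rewrite -lef_pV2 ?posrE ?expR_gt0 ?exprn_gt0// => h.
rewrite (le_trans (ler_wpM2l _ h))//; first by rewrite invr_ge0 exprn_ge0// ltW.
rewrite exprMn -[in leLHS]exprVn !exprVn invfM !invrK [x ^+ n.+1]exprS.
rewrite le_eqVlt; apply/orP; left; apply/eqP; field.
by rewrite gt_eqF// exprn_gt0.
Qed.

Lemma flat_ge0 n x : 0 <= flat n x.
Proof.
rewrite /flat; case: ifP => // x0; rewrite mulr_ge0 ?expR_ge0//.
by rewrite invr_ge0 exprn_ge0// ltW.
Qed.

Lemma is_derive_flat n x : is_derive x 1 (flat n) (flat n.+2 x + (- n%:R) * flat n.+1 x).
Proof.
have [x0|x0|<-] := ltgtP 0 x.
- apply: (@is_derive_near (fun y => (y ^- n) * expR (- y^-1))).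
    near=> y; rewrite /flat ifT//; near: y; exact: lt_nbhsr.
  have xn0 : x != 0 by rewrite gt_eqF.
  have dV : is_derive x 1 (fun y => y^-1) (- x ^- 2).
    have := is_deriveV xn0 (is_derive_id x 1).
    by apply: is_derive_val; rewrite /GRing.scale/= mulr1.
  have dVn m : is_derive x 1 (fun y => y ^- m) (- m%:R * x ^- m.+1).
    elim: m => [|m IH].
      apply: (@is_derive_val _ _ 0); first by rewrite oppr0 mul0r.
      have -> : (fun y : R => y ^- 0) = (fun=> 1) by apply/funext => y; rewrite expr0 invr1.
      exact: is_derive_cst.
    have -> : (fun y : R => y ^- m.+1) = (fun y => y^-1 * y ^- m).
      by apply/funext => y; rewrite exprS invfM.
    have := is_derive_mul dV IH; apply: is_derive_val.
    by rewrite !exprS -natr1; field; rewrite expf_neq0.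
  have dE : is_derive x 1 (fun y => expR (- y^-1)) (expR (- x^-1) * x ^- 2).
    apply: (is_derive1_comp (g := fun y => - y^-1)).
    have := is_derive_scale (-1) dV; rewrite mulN1r opprK.
    by congr is_derive; apply/funext => y; rewrite mulN1r.
  have := is_derive_mul (dVn n) dE; apply: is_derive_val.
  by rewrite /flat x0 !exprS; field; rewrite xn0 expf_neq0.
- apply: (@is_derive_near (fun=> 0)).
    near=> y; rewrite /flat ifF//; apply/negbTE; rewrite -leNgt ltW//.
    by near: y; exact: lt_nbhsl.
  rewrite /flat ifF ?ifF; last 2 first.
    by apply/negbTE; rewrite -leNgt ltW.
    by apply/negbTE; rewrite -leNgt ltW.
  by rewrite mulr0 addr0; exact: is_derive_cst.
- rewrite /flat ltxx mulr0 addr0 -/(flat n).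
  have H : (h^-1 *: ((flat n \o shift 0) (h *: 1) - flat n 0)) @[h --> (0:R)^'] --> (0 : R).
    (* For h > 0 the difference quotient of [flat n] at 0 is [flat n.+1 h], which [flat_le] bounds
       by K h. *)
    pose K : R := n.+2%:R ^+ n.+2.
    apply/cvgr0Pnorm_le => e e0.
    have K0 : 0 < K + 1 by rewrite /K ltr_wpDl ?exprn_ge0.
    near=> h.
    rewrite /= /GRing.scale/= mulr1 addr0 {2}/flat ltxx subr0.
    rewrite normrM normfV ger0_norm ?flat_ge0//.
    have hn0 : h != 0 by near: h; exact: nbhs_dnbhs_neq.
    have [h0|h0] := ltP 0 h; last first.
      by rewrite /flat ifF ?mulr0 ?ltW//; apply/negbTE; rewrite -leNgt.
    have := flat_le n.+1 h0; rewrite {1}/flat h0 exprSr invfM -/K => HK.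
    rewrite gtr0_norm// /flat h0 mulrCA mulrA (le_trans HK)//.
    rewrite (@le_trans _ _ ((K + 1) * h))// ?ler_wpM2r ?lerDl ?(ltW h0)//.
    rewrite mulrC -ler_pdivlMr// (le_trans (ler_norm _))//.
    by near: h; apply: dnbhs0_le; rewrite divr_gt0.
  by apply: DeriveDef; [apply/cvg_ex; exists 0|exact/cvg_lim].
Unshelve. all: by end_near. Qed.

Lemma flat_smooth n : smooth (flat n).
Proof.
apply: (@alg_smooth (range flat)); last by apply: alg_base; exists n.
move=> _ [m _ <-]; exists (fun x => flat m.+2 x + (- m%:R) * flat m.+1 x); split.
  by move=> x; exact: is_derive_flat.
by apply: alg_add; [|apply: alg_mul; [exact: alg_cst|]]; apply: alg_base; [exists m.+2|exists m.+1].
Qed.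

(** Smooth, bounded by 1, supported in [a,b] for every [n], and tending pointwise to 1 on ]a,b[ as
    [n] grows: it stands for the indicator function in dominated convergence. *)
Definition plateau a b (n : nat) x := flat 0 (n%:R * (x - a)) * flat 0 (n%:R * (b - x)).

Lemma plateau_smooth a b n : smooth (plateau a b n).
Proof.
have -> : plateau a b n = fun x =>
    flat 0 (n%:R * x + - (n%:R * a)) * flat 0 (- n%:R * x + n%:R * b).
  by apply/funext => x; rewrite /plateau; congr (flat 0 _ * flat 0 _); ring.
by apply: smoothM; apply: (@smooth_affine (flat 0)); exact: flat_smooth.
Qed.

Lemma plateau_out a b n x : x <= a \/ b <= x -> plateau a b n x = 0.
Proof.
move=> H; rewrite /plateau /flat; case: H => H.
  rewrite ifF ?mul0r//; apply/negbTE; rewrite -leNgt.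
  by rewrite mulr_ge0_le0// subr_le0.
rewrite [X in _ * X]ifF ?mulr0//; apply/negbTE; rewrite -leNgt.
by rewrite mulr_ge0_le0// subr_le0.
Qed.

Lemma flat0_le1 x : flat 0 x <= 1.
Proof.
rewrite /flat; case: ifP => // x0.
by rewrite expr0 invr1 mul1r -expR0 ler_expR oppr_le0 invr_ge0 ltW.
Qed.

Lemma plateau_le1 a b n x : `|plateau a b n x| <= 1.
Proof.
by rewrite ger0_norm ?mulr_ge0 ?flat_ge0// /plateau mulr_ile1 ?flat_ge0 ?flat0_le1.
Qed.

Lemma flat0_cvg x : 0 < x -> flat 0 (n%:R * x) @[n --> \oo] --> (1 : R).
Proof.
move=> x0.
suff : flat 0 (n%:R * x) @[n --> \oo] --> expR (- (0 * x^-1)).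
  by rewrite mul0r oppr0 expR0.
apply: (@cvg_trans _ ((fun n => expR (- (n%:R^-1 * x^-1))) n @[n --> \oo])).
  apply: near_eq_cvg; near=> n.
  have n0 : (0 : R) < n%:R.
    by rewrite ltr0n; near: n; exact: nbhs_infty_gt.
  by rewrite /flat mulr_gt0// expr0 invr1 mul1r invfM.
apply: (@continuous_cvg _ _ _ _ _ (fun n : nat => - (n%:R^-1 * x^-1)) expR).
  exact: continuous_expR.
have H : (n%:R^-1 : R) @[n --> \oo] --> (0 : R).
  by rewrite -cvg_shiftS; exact: cvg_harmonic.
exact: (cvgN (cvgM H (cvg_cst _))).
Unshelve. all: by end_near. Qed.

Lemma plateau_cvg a b x : a < x -> x < b -> plateau a b n x @[n --> \oo] --> (1 : R).
Proof.
move=> ax xb; have ax0 : 0 < x - a by rewrite subr_gt0.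
have xb0 : 0 < b - x by rewrite subr_gt0.
have H := cvgM (flat0_cvg ax0) (flat0_cvg xb0); rewrite mulr1 in H.
exact: H.
Qed.

End Derivatives.

(** * Weak solutions *)

Section DuBoisReymond.
Variable R : realType.
Local Notation mu := (@lebesgue_measure R).
Local Notation Rp := (`](0 : R), +oo[%classic : set R).
Implicit Types (A B : set R) (f g u v : R -> R) (x y z t a b c : R).

Lemma Rint_supp A B f : A `<=` B -> (forall x, B x -> ~ A x -> f x = 0) ->
  \int[mu]_(x in B) f x = \int[mu]_(x in A) f x.
Proof.
move=> AB f0; rewrite -[in RHS](setIidr AB) Rintegral_mkcondr.
apply: eq_Rint => x Bx; rewrite patchE; case: ifPn => //.
by rewrite notin_setE => Ax; exact: f0.
Qed.

Lemma intble_supp A B f : measurable A -> measurable B -> A `<=` B ->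
  (forall x, B x -> ~ A x -> f x = 0) -> intble A f -> intble B f.
Proof.
move=> mA mB AB f0 If.
have h : intble B (f \_ A).
  by rewrite /intble -restrict_EFin; apply/integrable_restrict => //; rewrite setIidr.
apply: eq_intble h => // x Bx; rewrite patchE; case: ifPn => //.
by rewrite notin_setE => Ax; rewrite f0.
Qed.

(** Test functions of (0,+oo) already extended by zero: the condition x < e covers the negative
    axis, unlike in [htest]. *)
Definition ptest u := smooth u /\
  exists e M : R, 0 < e /\ forall x, (x < e \/ M < x) -> u x = 0.

Lemma ptest_supp u : ptest u -> exists e M : R, [/\ 0 < e, e < M &
  forall x, (x < e \/ M < x) -> u x = 0].
Proof.
move=> [su [e [M [e0 H]]]]; exists e, (Order.max M (e + 1)); split => //.
  by rewrite lt_max; apply/orP; right; rewrite ltrDl.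
by move=> x [xe|]; [apply: H; left|rewrite gt_max => /andP[Mx _]; apply: H; right].
Qed.

Lemma ptestB u v c : ptest u -> ptest v -> ptest (fun x => u x - c * v x).
Proof.
move=> pu pv; have [e [M [e0 eM Hu]]] := ptest_supp pu.
have [e' [M' [e'0 eM' Hv]]] := ptest_supp pv.
split; first by apply: smoothB; [case: pu|apply: smoothZ; case: pv].
exists (Order.min e e'), (Order.max M M'); split; first by rewrite lt_min e0.
move=> x; rewrite lt_min gt_max => -[|] /andP[h1 h2]; rewrite Hu ?Hv; try by [left|right].
  by rewrite mulr0 subr0.
by rewrite mulr0 subr0.
Qed.

Lemma ptest_derive1 u : ptest u -> ptest u^`()%classic.
Proof.
move=> [su [e [M [e0 H]]]]; split; first exact: smooth_derive1.
exists e, M; split => // x Hx.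
have : is_derive x 1 u 0.
  apply: (@is_derive_near _ (fun=> 0)) => //.
  case: Hx => Hx; near=> y; rewrite H//.
    by left; near: y; exact: lt_nbhsl.
  by right; near: y; exact: lt_nbhsr.
by rewrite derive1E => -[].
Unshelve. all: by end_near. Qed.

Definition locint f := forall x y, 0 < x -> intble `[x, y] f.

Lemma continuous_contp u : continuous u -> contp u.
Proof. by move=> cu x _; exact: cu. Qed.

Lemma ptest_contp u : ptest u -> contp u.
Proof. by move=> [su _]; apply: continuous_contp; exact: smooth_continuous. Qed.

Lemma locint_ptest f u : locint f -> ptest u -> intble Rp (fun x => f x * u x).
Proof.
move=> lf pu; have [e [M [e0 eM H]]] := ptest_supp pu.
apply: (@intble_supp `[e, M]) => //; first exact: subset_itv_pos.
  move=> x _ /=; rewrite in_itv/= => /negP; rewrite negb_and -!ltNge => /orP Hx.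
  by rewrite H ?mulr0.
have := contp_intbleM (ptest_contp pu) e0 (lf _ M e0).
by congr intble; apply/funext => x; rewrite mulrC.
Qed.

Lemma plateau_int f a b : intble `]a, b[ f -> a < b ->
  \int[mu]_(x in `]a, b[) (f x * plateau a b n x) @[n --> \oo] -->
  \int[mu]_(x in `]a, b[) f x.
Proof.
move=> If ab.
have mf := intble_measurable (measurable_itv _) If.
apply: fine_cvg; rewrite fineK; last first.
  exact: (integrable_fin_num (measurableT_R (measurable_itv _)) If).
have mp n : measurable_fun `]a, b[ (plateau a b n).
  apply: measurable_funTS; apply: continuous_measurable_fun.
  by apply: smooth_continuous; exact: plateau_smooth.
have [] := @dominated_convergence _ (measurableTypeR R) R mu `]a, b[%classic
  (measurableT_R (measurable_itv _))
  (fun n x => (f x * plateau a b n x)%:E) (EFin \o f) (EFin \o (fun x => `|f x|)).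
- by move=> n; apply/measurable_EFinP; apply: measurable_funM; [exact: mf|exact: mp].
- exact/measurable_EFinP.
- apply: aeW => x /=; rewrite in_itv/= => /andP[ax xb].
  apply: cvg_EFin; first exact: nearW.
  have := cvgM (cvg_cst (f x)) (plateau_cvg ax xb); rewrite mulr1; exact.
- exact: intble_norm.
- apply: aeW => x n _ /=; rewrite lee_fin normrM.
  by rewrite -[leRHS]mulr1 ler_wpM2l// plateau_le1.
- by move=> _ _; exact.
Qed.

Lemma plateau_ptest a b n : 0 < a -> ptest (plateau a b n).
Proof.
move=> a0; split; first exact: plateau_smooth.
exists a, b; split => // x [xa|bx]; apply: plateau_out; [left|right]; exact: ltW.
Qed.

Lemma Rint_plateau f a b n : 0 < a ->
  \int[mu]_(x in Rp) (f x * plateau a b n x) =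
  \int[mu]_(x in `]a, b[) (f x * plateau a b n x).
Proof.
move=> a0; apply: Rint_supp.
  by move=> x /=; rewrite !in_itv/= andbT => /andP[ax _]; exact: lt_trans ax.
move=> x _ /=; rewrite in_itv/= => /negP; rewrite negb_and -!leNgt => /orP Hx.
by rewrite plateau_out ?mulr0.
Qed.

Lemma test_zero_int f : locint f ->
  (forall u, ptest u -> \int[mu]_(x in Rp) (f x * u x) = 0) ->
  forall a b, 0 < a -> a <= b -> \int[mu]_(x in `[a, b]) f x = 0.
Proof.
move=> lf H a b a0; rewrite le_eqVlt => /predU1P[<-|ab]; first exact: Rint_itv1.
have Ioo : intble `]a, b[ f by apply: intbleS (lf a b a0) => //; exact: subset_itv_oo_cc.
have Ioc : intble `]a, b] f by apply: intbleS (lf a b a0) => //; exact: subset_itv_oc_cc.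
rewrite -Rintegral_itv_obnd_cbnd// -Rintegral_itv_bndo_bndc//.
have /cvg_lim <- := plateau_int Ioo ab; last exact: Rhausdorff.
have -> : (fun n => \int[mu]_(x in `]a, b[) (f x * plateau a b n x)) = fun=> 0.
  by apply/funext => n; rewrite -Rint_plateau// H//; exact: plateau_ptest.
by rewrite lim_cst.
Qed.

Definition aep (P : R -> Prop) := mu.-negligible [set x | 0 < x /\ ~ P x].

(** Lebesgue differentiation on each compact segment [A k]: the indefinite integral of [f] cut off
    to [A k] vanishes identically, and its derivative is almost everywhere the cut-off function. *)
Lemma ae_zero f : locint f ->
  (forall a b, 0 < a -> a <= b -> \int[mu]_(x in `[a, b]) f x = 0) ->
  aep (fun x => f x = 0).
Proof.
move=> lf H.
pose A k : set R := `[(k.+1%:R)^-1, k.+1%:R]%classic.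
have Ak k : 0 < (k.+1%:R)^-1 :> R by rewrite invr_gt0.
have IA k : intble (A k) f by exact: lf.
have mA k : measurable (A k) by exact: measurable_itv.
have IT k : intble setT (f \_ (A k)).
  apply: (@intble_supp (A k)) => //; first by move=> x _ Ax; rewrite patchE memNset.
  by apply: eq_intble (IA k) => // x Ax; rewrite patchE mem_set.
have Z k y : \int[mu]_(x in `]-oo, y]) ((f \_ (A k)) x) = 0.
  rewrite -Rintegral_mkcondr; have [yk|ky] := ltP y (k.+1%:R)^-1.
    rewrite (_ : _ `&` _ = set0) ?Rintegral_set0//.
    apply/seteqP; split => x //=; rewrite /A /= !in_itv/= => -[h1 /andP[h2 _]].
    by have := le_lt_trans (le_trans h2 h1) yk; rewrite ltxx.
  rewrite (_ : _ `&` _ = `[(k.+1%:R)^-1, Order.min y k.+1%:R]%classic).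
    rewrite H// le_min ky/=.
    by rewrite (@le_trans _ _ 1)// ?invf_le1 ?ler1n.
  apply/seteqP; split => x /=; rewrite /A /= !in_itv/= le_min.
    by move=> [-> /andP[-> ->]].
  by move=> /andP[-> /andP[-> ->]].
have N k : mu.-negligible [set x | A k x /\ f x <> 0].
  have [N [mN N0 sN]] := @FTC1Ny R (f \_ (A k))
    (fun y => intbleS measurableT (measurable_itv _) (@subsetT _ _) (IT k))
    (integrable_locally (measurable_itv _) (IA k)).
  exists N; split => // x [Ax fx]; apply: sN => /= -[_].
  have -> : (fun x0 => \int[mu]_(t in `]-oo, x0]) ((f \_ (A k)) t)) = fun=> 0.
    by apply/funext => y; exact: Z.
  by rewrite derive1_cst patchE mem_set// => /esym.
apply: negligibleS (negligible_bigcup N) => x /= [x0 fx].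
have : Rp x by rewrite /= in_itv/= x0.
by rewrite -bigcup_seg_pos => -[k _ Akx]; exists k.
Qed.

(** The zero mean makes the primitive from 0 vanish again beyond the support. *)
Lemma ptest_antiderivative u : ptest u -> \int[mu]_(x in Rp) u x = 0 ->
  exists2 v, ptest v & v^`()%classic = u.
Proof.
move=> pu u0; have [e [M [e0 eM H]]] := ptest_supp pu.
have cu := smooth_continuous pu.1.
pose v x := \int[mu]_(t in `[0, x]) u t.
have Iu y : intble `[0, y] u.
  apply: continuous_compact_integrable; first exact: segment_compact.
  exact: continuous_subspaceT.
have vlt x : x < e -> v x = 0.
  move=> xe; rewrite /v (@eq_Rint _ _ _ (fun=> 0)).
    by rewrite Rintegral_cst// mul0r.
  by move=> t /=; rewrite in_itv/= => /andP[_ tx]; apply: H; left; lra.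
have vgt x : M < x -> v x = 0.
  move=> Mx; rewrite -u0 /v.
  have sub : `[e, x] `<=` Rp by exact: subset_itv_pos.
  rewrite (@Rint_supp `[e, x] Rp)//; last first.
    move=> t _ /=; rewrite in_itv/= => /negP; rewrite negb_and -!ltNge => /orP [te|xt].
      by apply: H; left.
    by apply: H; right; lra.
  apply: Rint_supp; first by apply: subset_itvr; rewrite bnd_simp ltW.
  move=> t /=; rewrite !in_itv/= => /andP[_ ->]; rewrite andbT => /negP.
  by rewrite -ltNge => te; apply: H; left.
have dv x : is_derive x 1 v (u x).
  have [xe|ex] := ltP x e.
    rewrite H; last by left.
    apply: (@is_derive_near _ (fun=> 0)) => //.
    by near=> y; rewrite vlt//; near: y; exact: lt_nbhsl.
  have x0 : 0 < x by lra.
  have xx1 : x < x + 1 by lra.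
  have [d1 d2] := @continuous_FTC1_closed R u 0 x (x + 1) xx1 (Iu _) x0 (cu x).
  by apply: DeriveDef => //; rewrite -derive1E.
exists v; last exact: derive1_fun.
split; last first.
  by exists e, M; split => // x [xe|Mx]; [exact: vlt|exact: vgt].
move=> [|n] x; first exact: ex_derive.
by rewrite derive1Sn (derive1_fun dv); exact: pu.1.
Unshelve. all: by end_near. Qed.

Lemma ptest_is_derive u x : ptest u -> is_derive x 1 u (u^`()%classic x).
Proof. by move=> [su _]; exact: smooth_is_derive. Qed.

Lemma prim_ptest u : ptest u -> prim u u^`()%classic.
Proof.
move=> pu; apply: prim_derive => [x _|]; first exact: ptest_is_derive.
exact/ptest_contp/ptest_derive1.
Qed.

Lemma prim_id : prim (@id R) (fun=> 1).
Proof. by apply: prim_derive => x _; exact: cvg_cst. Qed.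

Lemma prim_supp F f e M : prim F f -> 0 < e ->
  (forall x, (x < e \/ M < x) -> F x = 0) ->
  (forall x, 0 < x -> (x < e \/ M < x) -> f x = 0) ->
  \int[mu]_(x in Rp) f x = 0.
Proof.
move=> pF e0 HF Hf.
pose a := e / 2; pose b := Order.max M e + 1.
have a0 : 0 < a by rewrite /a; lra.
have ae : a < e by rewrite /a; lra.
have Mb : M < b by rewrite /b ltr_pwDr// le_max lexx.
have eb : e < b by rewrite /b ltr_pwDr// le_max lexx orbT.
rewrite (@Rint_supp `[a, b])//; last 2 first.
- exact: subset_itv_pos.
- move=> x /=; rewrite in_itv/= andbT => x0; rewrite in_itv/= => /negP.
  rewrite negb_and -!ltNge => /orP[xa|bx]; apply: Hf => //; [left|right]; lra.
rewrite -(primE pF)//; last by lra.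
by rewrite (HF a) ?(HF b) ?subrr//; [right|left].
Qed.

(** Fix a test function [eta] of mean 1. Subtracting suitable multiples of [eta] and its derivative
    from u leaves the second derivative of a test function, so T u = c T eta + d T eta' with c the
    integral of u and d linear in the first two moments of u. This expresses T u as integration of u
    against an affine function. *)
Lemma du_bois_reymond f : locint f ->
  (forall u, ptest u -> \int[mu]_(x in Rp) (f x * u^`(2)%classic x) = 0) ->
  exists A B : R, aep (fun x => f x = A + B * x).
Proof.
move=> lf Hf.
have [eta peta eta1] : exists2 u, ptest u & \int[mu]_(x in Rp) u x = 1.
  have I1 : intble `](1:R), 2[ (fun=> 1).
    by apply: intbleS (intble_cst 1 2 1) => //; exact: subset_itv_oo_cc.
  have l12 : (1 : R) < 2 by lra.
  have h := plateau_int I1 l12.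
  rewrite Rintegral_itv_bndo_bndc// Rintegral_itv_obnd_cbnd in h; last first.
    by apply: intbleS (intble_cst 1 2 1) => //; exact: subset_itv_oc_cc.
  rewrite Rint_cst ?(ltW l12)// mul1r in h.
  have l21 : (0 : R) < 2 - 1 by lra.
  (* The integrals of the plateaus on ]1,2[ tend to 1, so one of them is positive and can be
     normalized. *)
  have [n _ /(_ n (leqnn n)) /= n0] := cvgr_gt _ h _ l21.
  rewrite -Rint_plateau// in n0.
  set c := (\int[mu]_(x in Rp) (1 * plateau 1 2 n x))%R in n0.
  have pp := @plateau_ptest 1 2 n ltr01.
  have Ip := locint_ptest (fun x y _ => intble_cst x y 1) pp.
  exists (fun x => c^-1 * (1 * plateau 1 2 n x)).
    have [sp [e [M [e0 Hp]]]] := pp.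
    split; first by do 2 apply: smoothZ.
    by exists e, M; split => // x Hx; rewrite Hp// !mulr0.
  by rewrite RintZ// -/c mulVf// gt_eqF.
pose T u := \int[mu]_(x in Rp) (f x * u x).
pose m := \int[mu]_(x in Rp) (x * eta x).
have lid : locint (@id R) by move=> x y x0; exact: contp_intble (prim_contp prim_id) x0.
have l1 : locint (fun=> 1 : R) by move=> x y _; exact: intble_cst.
have Iid u : ptest u -> intble Rp (fun x => x * u x) by exact: locint_ptest.
have I1 u : ptest u -> intble Rp u.
  move=> /(locint_ptest l1); congr intble; apply/funext => x; exact: mul1r.
have TB u v c : ptest u -> ptest v -> T (fun x => u x - c * v x) = T u - c * T v.
  move=> pu pv; rewrite /T -RintZ//; last exact: locint_ptest.
  rewrite -RintB//; [|exact: locint_ptest|by apply: intbleZ => //; exact: locint_ptest].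
  by apply: eq_Rint => x _; ring.
exists (T eta + m * T eta^`()%classic), (- T eta^`()%classic).
have TE u : ptest u -> T u = \int[mu]_(x in Rp)
    (((T eta + m * T eta^`()%classic) + - T eta^`()%classic * x) * u x).
  move=> pu; pose c := \int[mu]_(x in Rp) u x.
  have pu1 := ptestB c pu peta.
  have u10 : \int[mu]_(x in Rp) (u x - c * eta x) = 0.
    rewrite RintB//; [|exact: I1|by apply: intbleZ => //; exact: I1].
    by rewrite RintZ ?eta1 ?mulr1 ?subrr//; exact: I1.
  have [v pv dv] := ptest_antiderivative pu1 u10.
  pose d := \int[mu]_(x in Rp) v x.
  have pv1 := ptestB d pv peta.
  have v10 : \int[mu]_(x in Rp) (v x - d * eta x) = 0.
    rewrite RintB//; [|exact: I1|by apply: intbleZ => //; exact: I1].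
    by rewrite RintZ ?eta1 ?mulr1 ?subrr//; exact: I1.
  have [w pw dw] := ptest_antiderivative pv1 v10.
  have ddw : (w^`(2))%classic = fun x => (u x - c * eta x) - d * eta^`()%classic x.
    rewrite derive1nS derive1n1 dw; apply: derive1_fun => x.
    have h1 := ptest_is_derive x pv; rewrite dv in h1.
    have h2 := is_derive_scale (- d) (ptest_is_derive x peta).
    have := is_derive_add h1 h2; rewrite mulNr.
    by congr is_derive; apply/funext => y; rewrite mulNr.
  have := Hf _ pw; rewrite ddw -/(T _) TB//; last exact: ptest_derive1.
  rewrite TB// => Tu.
  (* Integrate (x v)' = x (u - c eta) + v; the total integral is 0 because v has compact support. *)
  have dE : d = - (\int[mu]_(x in Rp) (x * u x)) + c * m.
    have pxv := primM prim_id (prim_ptest pv).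
    have [e [M [e0 eM He]]] := ptest_supp pv.
    have [e' [M' [e'0 eM' He']]] := ptest_supp (ptest_derive1 pv).
    have := @prim_supp _ _ (Order.min e e') (Order.max M M') pxv.
    rewrite lt_min e0 e'0 => /(_ isT).
    have Hx x : (x < Order.min e e' \/ Order.max M M' < x) -> v x = 0 /\ v^`()%classic x = 0.
      rewrite lt_min gt_max => -[|] /andP[h1 h2]; rewrite He ?He' //; by [left|right].
    have H1 x : (x < Order.min e e' \/ Order.max M M' < x) -> id x * v x = 0.
      by move=> /Hx[-> _]; rewrite mulr0.
    have H2 x : 0 < x -> (x < Order.min e e' \/ Order.max M M' < x) ->
        id x * v^`()%classic x + v x * 1 = 0.
      by move=> _ /Hx[-> ->]; rewrite mulr0 mul0r addr0.
    move=> /(_ H1 H2); rewrite dv.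
    rewrite (_ : (fun x => _) = (fun x => (x * u x - c * (x * eta x)) + v x)); last first.
      by apply/funext => x /=; ring.
    rewrite RintD//; [|by apply: intbleB => //; [exact: Iid|apply: intbleZ => //; exact: Iid]|exact: I1].
    rewrite RintB//; [|exact: Iid|by apply: intbleZ => //; exact: Iid].
    rewrite RintZ//; last exact: Iid.
    by rewrite -/d -/m; lra.
  rewrite (_ : (fun x => _) = (fun x => (T eta + m * T eta^`()%classic) * u x -
      T eta^`()%classic * (x * u x))); last by apply/funext => x; ring.
  rewrite RintB//; [|by apply: intbleZ => //; exact: I1|by apply: intbleZ => //; exact: Iid].
  rewrite !RintZ//; [|exact: Iid|exact: I1].
  rewrite -/c (_ : (\int[mu]_(x in Rp) (x * u x))%R = c * m - d); last by lra.
  rewrite (_ : T u = c * T eta + d * T eta^`()%classic); first by ring.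
  lra.
set K := T eta + _ in TE *; set L := T _ in TE *.
have lKL : locint (fun x => K + - L * x).
  move=> x y x0; apply: intbleD => //; first exact: intble_cst.
  by apply: intbleZ => //; exact: lid.
have lg : locint (fun x => f x - (K + - L * x)).
  by move=> x y x0; apply: intbleB => //; [exact: lf|exact: lKL].
have := ae_zero lg (test_zero_int lg _).
have Hg u : ptest u -> \int[mu]_(x in Rp) ((f x - (K + - L * x)) * u x) = 0.
  move=> pu; rewrite (_ : (fun x => _) = (fun x => f x * u x - (K + - L * x) * u x)); last first.
    by apply/funext => x; ring.
  rewrite RintB//; [|exact: locint_ptest|exact: locint_ptest].
  by rewrite -/(T u) TE// subrr.
move=> /(_ Hg); apply: negligibleS => x /= [x0 fx]; split => // /eqP.
by rewrite subr_eq0 => /eqP.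
Qed.

End DuBoisReymond.

(** * Changing functions on null sets *)

Section AlmostEverywhere.
Variable R : realType.
Local Notation mu := (@lebesgue_measure R).
Local Notation Rp := (`](0 : R), +oo[%classic : set R).
Implicit Types (A B : set R) (f g u v : R -> R) (x y z t a b c : R).

Lemma Rint_ae A f g : measurable A -> A `<=` Rp -> intble A f -> measurable_fun A g ->
  aep (fun t => f t = g t) ->
  intble A g /\ \int[mu]_(t in A) f t = \int[mu]_(t in A) g t.
Proof.
move=> mA ARp If mg fg.
have mf := intble_measurable mA If.
have fg' : @ae_eq _ (measurableTypeR R) R mu (fun=> \bar R) A
    (EFin \o f) (EFin \o g).
  apply: negligibleS fg => t /= /not_implyP[] /= /ARp; rewrite /= in_itv/= andbT => t0 H.
  by split => // E; apply: H; rewrite E.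
have mfE : @measurable_fun _ _ (measurableTypeR R) _ A (EFin \o f).
  exact/measurable_EFinP.
have mgE : @measurable_fun _ _ (measurableTypeR R) _ A (EFin \o g).
  exact/measurable_EFinP.
split; last first.
  by congr fine; apply: ae_eq_integral.
apply/integrableP; split => //; case/integrableP : If => _.
have -> // : (\int[mu]_(t in A) `|(EFin \o f) t| =
  \int[mu]_(t in A) `|(EFin \o g) t|)%E.
apply: ae_eq_integral => //.
- exact: measurableT_comp.
- exact: measurableT_comp.
- exact: (ae_eq_abse fg').
Qed.

Lemma prim_ae F f g : prim F f -> (forall x y, 0 < x -> measurable_fun `[x, y] g) ->
  aep (fun t => f t = g t) -> prim F g.
Proof.
move=> pF mg fg x y x0 xy; have [If FE] := pF x y x0 xy.
by have [Ig <-] := Rint_ae (measurable_itv _) (@subset_itv_pos _ x y x0) If (mg x y x0) fg.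
Qed.

Lemma aep_interval P x y : 0 < x -> x < y -> aep P -> exists t, [/\ x < t, t < y & P t].
Proof.
move=> x0 xy aP; apply: contrapT => H.
have : mu `]x, y[ = 0%E.
  apply: measure_negligible => //; apply: negligibleS aP => t /=.
  rewrite in_itv/= => /andP[xt ty]; split; first exact: lt_trans xt.
  by move=> Pt; apply: H; exists t.
rewrite /= lebesgue_measure_itv/= lte_fin xy -EFinD => -[] /eqP.
by rewrite subr_eq0 gt_eqF.
Qed.

Lemma aep_near P Q : aep P -> (\forall x \near 0^'+, Q x) ->
  exists x, [/\ 0 < x, P x & Q x].
Proof.
move=> aP [e /= e0 HQ].
have e20 : 0 < e / 2 by lra.
have e2e : e / 2 < e by lra.
have [x [h1 h2 Px]] := aep_interval e20 e2e aP.
exists x; split => //; first lra.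
apply: HQ => /=; last lra.
by rewrite sub0r normrN gtr0_norm; lra.
Qed.

Lemma aep_and P Q : aep P -> aep Q -> aep (fun x => P x /\ Q x).
Proof.
move=> aP aQ; apply: negligibleS (negligibleU aP aQ) => x /= [x0].
by move=> /not_andP[]; [left|right].
Qed.

Lemma aep_mono (P Q : R -> Prop) : (forall x, 0 < x -> P x -> Q x) -> aep P -> aep Q.
Proof. by move=> PQ; apply: negligibleS => x /= [x0 nQ]; split => // /(PQ _ x0). Qed.

(** A point common to a set of full measure and a right neighbourhood of 0 compares the two limits;
    boundary values therefore do not depend on the representative. *)
Lemma aep_lim f g l m : aep (fun x => f x = g x) ->
  f x @[x --> 0^'+] --> (l : R) -> g x @[x --> 0^'+] --> (m : R) -> l = m.
Proof.
move=> fg fl gm; apply/eqP; apply: contrapT => /negP lm.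
have e0 : 0 < `|l - m| / 2 by rewrite divr_gt0// normr_gt0 subr_eq0.
have N : \forall x \near (0 : R)^'+,
    `|l - f x| < `|l - m| / 2 /\ `|m - g x| < `|l - m| / 2.
  near=> x; split; near: x; [exact: cvgr_dist_lt|exact: cvgr_dist_lt].
have [x [_ fgx [h1 h2]]] := aep_near fg N; rewrite fgx in h1.
have := ler_distD (g x) l m; rewrite [in X in _ <= _ + X]distrC.
by move: h1 h2; set A := `|_|; set B := `|_|; set D := `|_|; lra.
Unshelve. all: by end_near. Qed.

Lemma exists_prim f : locint f -> exists F, prim F f.
Proof.
move=> lf.
pose F x := if 1 <= x then \int[mu]_(t in `[1, x]) f t
  else - \int[mu]_(t in `[x, 1]) f t.
exists F => x y x0 xy; split; first exact: lf.
rewrite /F; have [x1|x1] := leP 1 x.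
  rewrite (le_trans x1 xy) (@Rint_chasles _ 1 x y)//; first by ring.
  exact: lf.
have [y1|y1] := leP 1 y.
  by rewrite (@Rint_chasles _ x 1 y) ?(ltW x1)//; [ring|exact: lf].
by rewrite (@Rint_chasles _ x y 1) ?(ltW y1)//; [ring|exact: lf].
Qed.

End AlmostEverywhere.

(** * Regularity of weak solutions *)

Section WeakSolution.
Variable R : realType.
Local Notation mu := (@lebesgue_measure R).
Local Notation Rp := (`](0 : R), +oo[%classic : set R).
Implicit Types (A B : set R) (f g u v h : R -> R) (x y z t a b c : R).
Variable V : R -> R.
Hypothesis cV : contp V.

Lemma sq_locint f : sq Rp f -> locint f.
Proof.
move=> sf x y x0; apply: sq_intble; apply: sqS sf => //; exact: subset_itv_pos.
Qed.

(* [g] is a solution of [- g'' + V g = h] on (0,+oo), with [g1 = g'] locally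
   absolutely continuous. *)
Definition hsol g g1 h := prim g g1 /\ prim g1 (fun x => V x * g x - h x).

(** Integrating V g - h twice gives G with G'' = V g - h; then g - G annihilates every u'', so it is
    affine, and g agrees almost everywhere with G plus an affine function. *)
Lemma weak_hsol g h : sq Rp g -> sq Rp h ->
  (forall u, ptest u -> \int[mu]_(x in Rp) ((- u^`(2)%classic x + V x * u x) * g x) =
    \int[mu]_(x in Rp) (u x * h x)) ->
  exists g' g1, aep (fun x => g x = g' x) /\ hsol g' g1 h.
Proof.
move=> sg sh Hw.
have lg := sq_locint sg; have lh := sq_locint sh.
pose K x := V x * g x - h x.
have lK : locint K.
  by move=> x y x0; apply: intbleB => //; [apply: contp_intbleM => //; exact: lg|exact: lh].
have [G1 pG1] := exists_prim lK.
have lG1 : locint G1 by move=> x y x0; exact: contp_intble (prim_contp pG1) x0.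
have [G pG] := exists_prim lG1.
have lG : locint G by move=> x y x0; exact: contp_intble (prim_contp pG) x0.
have lgG : locint (fun x => g x - G x).
  by move=> x y x0; apply: intbleB => //; [exact: lg|exact: lG].
have [A [B HAB]] : exists A B : R, aep (fun x => g x - G x = A + B * x).
  apply: du_bois_reymond => // u pu.
  have pu1 := ptest_derive1 pu; have pu2 := ptest_derive1 pu1.
  rewrite derive1nS derive1n1.
  set u2 := (u^`()^`())%classic in pu2 *.
  have Iu2 f : locint f -> intble Rp (fun x => f x * u2 x) by move=> lf; exact: locint_ptest.
  have Iu f : locint f -> intble Rp (fun x => f x * u x) by move=> lf; exact: locint_ptest.
  have lVg : locint (fun x => V x * g x).
    by move=> x y x0; apply: contp_intbleM => //; exact: lg.
  rewrite (_ : (fun x => _) = (fun x => g x * u2 x - G x * u2 x)); last first.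
    by apply/funext => x; rewrite mulrBl.
  rewrite RintB//; [|exact: Iu2|exact: Iu2].
  have E1 : \int[mu]_(x in Rp) (g x * u2 x) = \int[mu]_(x in Rp) (K x * u x).
    have HW := Hw u pu; rewrite derive1nS derive1n1 -/u2 in HW.
    have E3 : \int[mu]_(x in Rp) ((- u2 x + V x * u x) * g x) =
        \int[mu]_(x in Rp) ((V x * g x) * u x) - \int[mu]_(x in Rp) (g x * u2 x).
      rewrite -RintB//; [|exact: Iu|exact: Iu2].
      by apply: eq_Rint => x _; ring.
    have E4 : \int[mu]_(x in Rp) (K x * u x) =
        \int[mu]_(x in Rp) ((V x * g x) * u x) - \int[mu]_(x in Rp) (u x * h x).
      rewrite (@eq_Rint _ _ (fun x => u x * h x) (fun x => h x * u x)); last first.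
        by move=> x _; rewrite mulrC.
      rewrite -RintB//; [|exact: Iu|exact: Iu].
      by apply: eq_Rint => x _; rewrite /K; ring.
    by move: HW; rewrite E3 E4; lra.
  (* The integrand is the derivative of u' G - u G1, a function of compact support. *)
  have E2 : \int[mu]_(x in Rp) (G x * u2 x - K x * u x) = 0.
    have [e [M [e0 eM He]]] := ptest_supp pu.
    have [e1 [M1 [e10 eM1 He1]]] := ptest_supp pu1.
    have [e2 [M2 [e20 eM2 He2]]] := ptest_supp pu2.
    have := primB (primM (prim_ptest pu1) pG) (primM (prim_ptest pu) pG1).
    move=> /eq_prim - /(_ (fun x => G x * u2 x - K x * u x)) pF.
    have {}pF := pF (fun x _ => ltac:(rewrite /u2; ring)).
    apply: (prim_supp (e := Order.min e (Order.min e1 e2))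
      (M := Order.max M (Order.max M1 M2)) pF).
    - by rewrite !lt_min e0 e10.
    - by move=> x; rewrite !lt_min !gt_max => -[|] /and3P[h1 h2 h3];
        rewrite He ?He1 ?mul0r ?subrr//; by [left|right].
    - by move=> x _; rewrite !lt_min !gt_max => -[|] /and3P[h1 h2 h3];
        rewrite He ?He2 ?mulr0 ?subrr//; by [left|right].
  by move: E2; rewrite RintB//; [rewrite E1; lra|exact: Iu2|exact: Iu].
exists (fun x => G x + (A + B * x)), (fun x => G1 x + B); split.
  by apply: aep_mono HAB => x _; lra.
split.
  apply: primD => //.
  have := primD (@prim_cst R A) (@primZ R B _ _ (@prim_id R)).
  by apply: eq_prim => x _; ring.
have pg1 : prim (fun x => G1 x + B) K.
  by have := primD pG1 (@prim_cst R B); apply: eq_prim => x _; rewrite addr0.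
(* So far G1 + B is a primitive of V g - h; the equation for the new representative follows by
   changing the integrand on a null set. *)
apply: (prim_ae pg1).
  move=> x y x0; apply: measurable_funB; last first.
    exact: intble_measurable (lh x y x0).
  apply: measurable_funM; first exact: contp_itv_measurable.
  apply: contp_itv_measurable => //; apply: (@prim_contp _ _ (fun x => G1 x + B)).
  apply: primD => //.
  have := primD (@prim_cst R A) (@primZ R B _ _ (@prim_id R)).
  by apply: eq_prim => z _; ring.
by apply: aep_mono HAB => x _ HE; rewrite /K (_ : g x = G x + (A + B * x))//; lra.
Qed.

End WeakSolution.

(** * Boundary values at the origin *)

Section Powers.
Variable R : realType.
Local Notation Rp := (`](0 : R), +oo[%classic : set R).
Implicit Types (f g F G : R -> R) (x y z t a b c s : R).

Lemma derive_contp F f : (forall x, 0 < x -> is_derive x 1 F (f x)) -> contp F.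
Proof.
move=> dF x x0; apply/differentiable_continuous/derivable1_diffP.
by have [] := dF x x0.
Qed.

Lemma eq_contp F G : (forall x, 0 < x -> F x = G x) -> contp F -> contp G.
Proof.
move=> FG cF x x0; rewrite /prop_for /continuous_at -FG//.
apply: (@cvg_trans _ (F y @[y --> x])); last exact: cF.
by apply: near_eq_cvg; near=> y; rewrite FG//; near: y; exact: lt_nbhsr.
Unshelve. all: by end_near. Qed.

Lemma contpD F G : contp F -> contp G -> contp (fun x => F x + G x).
Proof. by move=> cF cG x x0; exact: (cvgD (cF x x0) (cG x x0)). Qed.

Lemma contpM F G : contp F -> contp G -> contp (fun x => F x * G x).
Proof. by move=> cF cG x x0; exact: (cvgM (cF x x0) (cG x x0)). Qed.

Lemma contp_cst c : contp (fun=> c).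
Proof. by move=> x x0; exact: cvg_cst. Qed.

Lemma powR_add s t x : 0 < x -> x `^ (s + t) = x `^ s * x `^ t.
Proof. by move=> x0; rewrite powRD//; apply/implyP => _; rewrite gt_eqF. Qed.

Lemma powR_B1 s x : 0 < x -> x `^ (s - 1) = x `^ s / x.
Proof.
by move=> x0; rewrite powR_add// powR_inv1 ?ltW.
Qed.

Lemma is_derive_powR s x : 0 < x -> is_derive x 1 (fun y => y `^ s) (s * (x `^ s / x)).
Proof. by move=> x0; rewrite -powR_B1//; exact: is_derive1_powR. Qed.

Lemma contp_powR s : contp (fun x => x `^ s).
Proof. by apply: derive_contp => x x0; exact: is_derive_powR. Qed.

Lemma prim_powR s : prim (fun x => x `^ s) (fun x => s * (x `^ s / x)).
Proof.
apply: prim_derive => [x x0|]; first exact: is_derive_powR.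
apply: (@eq_contp (fun x => s * x `^ (s - 1))).
  by move=> x x0; rewrite powR_B1.
by apply: contpM; [exact: contp_cst|exact: contp_powR].
Qed.

Lemma prim_powR2 s :
  prim (fun x => s * (x `^ s / x)) (fun x => s * (s - 1) * (x `^ s / x ^+ 2)).
Proof.
apply: (@eq_priml _ (fun x => s * x `^ (s - 1))).
  by move=> x x0; rewrite powR_B1.
have := @primZ _ s _ _ (@prim_powR (s - 1)).
apply: eq_prim => x x0; rewrite powR_B1//; field.
by rewrite gt_eqF.
Qed.

Lemma powR_le1 s x : 0 <= s -> 0 < x -> x <= 1 -> x `^ s <= 1.
Proof.
move=> s0 x0 x1; rewrite (_ : 1 = 1 `^ s); last by rewrite powR1.
by apply: ge0_ler_powR => //; rewrite nnegrE ltW.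
Qed.

Lemma intble_powR s : -1 < s -> intble `](0 : R), 1] (fun x => x `^ s).
Proof.
move=> s1; have s10 : 0 < s + 1 by lra.
have -> : `](0 : R), 1]%classic = \bigcup_n `[(n.+1%:R)^-1, 1]%classic.
  apply/seteqP; split => x /=; rewrite in_itv/=.
    move=> /andP[x0 x1].
    have : Rp x by rewrite /= in_itv/= x0.
    rewrite -bigcup_seg_pos => -[n _] /=; rewrite in_itv/= => /andP[nx _].
    by exists n => //=; rewrite in_itv/= nx.
  move=> [n _] /=; rewrite in_itv/= => /andP[nx ->]; rewrite andbT.
  by apply: lt_le_trans nx; rewrite invr_gt0.
have n0 n : 0 < (n.+1%:R)^-1 :> R by rewrite invr_gt0.
have n1 n : (n.+1%:R)^-1 <= 1 :> R by rewrite invf_le1 ?ler1n.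
apply: (@intble_bigcup _ _ _ (s + 1)^-1) => //.
- move=> n m nm x /=; rewrite !in_itv/= => /andP[h ->]; rewrite andbT.
  by apply: le_trans h; rewrite lef_pV2 ?posrE// ler_nat.
- by move=> n; apply: contp_intble => //; exact: contp_powR.
- by move=> n x _; exact: powR_ge0.
- move=> n.
  have pP : prim (fun x => (s + 1)^-1 * x `^ (s + 1)) (fun x => x `^ s).
    have := @primZ _ (s + 1)^-1 _ _ (@prim_powR (s + 1)).
    apply: eq_prim => x x0.
    rewrite mulrA mulVf ?gt_eqF// mul1r -powR_B1//; congr (_ `^ _); ring.
  rewrite -(primE pP)// powR1 mulr1 lerBlDr lerDl.
  by rewrite mulr_ge0 ?powR_ge0// invr_ge0 ltW.
Qed.

End Powers.

(** * Variation of constants near the origin *)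

Section HalfLine.
Variable R : realType.
Local Notation mu := (@lebesgue_measure R).
Local Notation Rp := (`](0 : R), +oo[%classic : set R).
Implicit Types (f g h l F G : R -> R) (x y z t c s : R).
Variables (alpha : R) (k : int).
Hypothesis alpha01 : 0 <= alpha < 1.

(** [p] and [q] are the roots of s (s - 1) = alpha (2 + alpha) / 4. As p + q = 1, the product of x^p
    and x^q is x and their Wronskian is the constant w = p - q. *)
Let p := 1 + alpha / 2.
Let q := - (alpha / 2).
Let w := 1 + alpha.
Let th x := x `^ p.
Let ps x := x `^ q.
Local Notation V := (pot alpha k).

Let alpha_ge0 : 0 <= alpha. Proof. by case/andP : alpha01. Qed.
Let alpha_lt1 : alpha < 1. Proof. by case/andP : alpha01. Qed.
Let w_gt0 : 0 < w. Proof. by have := alpha_ge0; rewrite /w; lra. Qed.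

Lemma pot_ge0 x : 0 <= V x.
Proof.
have a0 := alpha_ge0.
rewrite /pot; apply: addr_ge0; first by rewrite mulr_ge0 ?sqr_ge0 ?powR_ge0.
by rewrite divr_ge0// mulr_ge0 ?sqr_ge0//; lra.
Qed.

Lemma potE x : 0 < x ->
  V x = k%:~R ^+ 2 * x `^ (2 * alpha) + alpha * (2 + alpha) / 4 / x ^+ 2.
Proof. by move=> x0; rewrite /pot gtr0_norm// invfM mulrA. Qed.

Lemma contp_pot : contp V.
Proof.
apply: (@eq_contp _ (fun x => k%:~R ^+ 2 * x `^ (2 * alpha) +
    alpha * (2 + alpha) / 4 * x `^ (- 2))).
  by move=> x x0; rewrite potE// -(@powR_invn _ _ 2) ?ltW// -mulNrn.
apply: contpD; apply: contpM; try exact: contp_cst; exact: contp_powR.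
Qed.

Let th_gt0 x : 0 < x -> 0 < th x. Proof. by move=> x0; rewrite powR_gt0. Qed.
Let ps_gt0 x : 0 < x -> 0 < ps x. Proof. by move=> x0; rewrite powR_gt0. Qed.

Let thps x : 0 < x -> th x * ps x = x.
Proof.
move=> x0; rewrite /th /ps -powR_add//.
by rewrite /p /q addrK powRr1 ?ltW.
Qed.

(* Coefficients of [g] in the basis [x^p, x^q] of solutions of the equation
   [- g'' + alpha (2 + alpha) / (4 x^2) g = 0]; their limits at 0 are [g_1] and
   [g_0]. *)
Definition coefa g g1 x := w^-1 * (g1 x * ps x - g x * (q * (ps x / x))).
Definition coefb g g1 x := w^-1 * (g x * (p * (th x / x)) - g1 x * th x).

Lemma coefE g g1 x : 0 < x -> g x = coefa g g1 x * th x + coefb g g1 x * ps x.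
Proof.
move=> x0; rewrite /coefa /coefb; have := thps x0; set T := th x; set P := ps x => TP.
have xn0 : x != 0 by rewrite gt_eqF.
have wn0 : w != 0 by rewrite gt_eqF.
have -> : w^-1 * (g1 x * P - g x * (q * (P / x))) * T +
  w^-1 * (g x * (p * (T / x)) - g1 x * T) * P =
  w^-1 * g x * (p - q) * (T * P / x) by field; rewrite xn0 wn0.
rewrite TP divff// mulr1 (_ : p - q = w); first by field.
by rewrite /p /q /w; lra.
Qed.

Lemma coefE1 g g1 x : 0 < x -> g1 x =
  coefa g g1 x * (p * (th x / x)) + coefb g g1 x * (q * (ps x / x)).
Proof.
move=> x0; rewrite /coefa /coefb; have := thps x0; set T := th x; set P := ps x => TP.
have xn0 : x != 0 by rewrite gt_eqF.
have wn0 : w != 0 by rewrite gt_eqF.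
have -> : w^-1 * (g1 x * P - g x * (q * (P / x))) * (p * (T / x)) +
  w^-1 * (g x * (p * (T / x)) - g1 x * T) * (q * (P / x)) =
  w^-1 * g1 x * (p - q) * (T * P / x) by field; rewrite xn0 wn0.
rewrite TP divff// mulr1 (_ : p - q = w); first by field.
by rewrite /p /q /w; lra.
Qed.

(** The part k^2 x^(2 alpha) of the potential is bounded near 0 and is moved to the source: g'' - p
    (p - 1) g / x^2 = [rem g h] is an Euler equation whose right-hand side is square integrable on
    ]0,1]. *)
Let rem g h x := k%:~R ^+ 2 * x `^ (2 * alpha) * g x - h x.

Let remE g h x : 0 < x -> V x * g x - h x = rem g h x + p * (p - 1) / x ^+ 2 * g x.
Proof. by move=> x0; rewrite potE// /rem /p; field; rewrite gt_eqF. Qed.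

Lemma prim_coefa g g1 h : hsol V g g1 h ->
  prim (coefa g g1) (fun x => w^-1 * (ps x * rem g h x)).
Proof.
move=> [pg pg1].
have := @primZ _ w^-1 _ _ (primB (primM pg1 (@prim_powR _ q)) (primM pg (@prim_powR2 _ q))).
apply: eq_prim => x x0; rewrite remE// -/(ps x); congr (_ * _).
by rewrite /p /q; field; rewrite gt_eqF.
Qed.

Lemma prim_coefb g g1 h : hsol V g g1 h ->
  prim (coefb g g1) (fun x => w^-1 * - (th x * rem g h x)).
Proof.
move=> [pg pg1].
have := @primZ _ w^-1 _ _ (primB (primM pg (@prim_powR2 _ p)) (primM pg1 (@prim_powR _ p))).
apply: eq_prim => x x0; rewrite remE// -/(th x); congr (_ * _).
by rewrite /p /q; field; rewrite gt_eqF.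
Qed.

Lemma wronskianE g g1 f f1 x : 0 < x -> g1 x * f x - g x * f1 x =
  w * (coefa g g1 x * coefb f f1 x - coefb g g1 x * coefa f f1 x).
Proof.
move=> x0; rewrite (coefE g g1 x0) (coefE f f1 x0) (coefE1 g g1 x0) (coefE1 f f1 x0).
set A := coefa _ _ _; set B := coefb _ _ _; set A' := coefa _ _ _; set B' := coefb _ _ _.
have := thps x0; set T := th x; set P := ps x => TP.
have xn0 : x != 0 by rewrite gt_eqF.
transitivity ((p - q) * (A * B' - B * A') * (T * P / x)); first by field.
by rewrite TP divff// mulr1 (_ : p - q = w)// /p /q /w; lra.
Qed.

Let sub01 : `](0 : R), 1] `<=` Rp.
Proof. by move=> x /=; rewrite !in_itv/= andbT => /andP[]. Qed.

Lemma sq_rem g h : sq Rp g -> sq Rp h -> sq `](0 : R), 1] (rem g h).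
Proof.
move=> sg sh; have s1 f : sq Rp f -> sq `](0 : R), 1] f.
  by apply: sqS => //; exact: sub01.
apply: sqB => //; last exact: s1.
apply: (@sq_bdM _ _ _ _ (k%:~R ^+ 2)) => //; last exact: s1.
  by apply: measurable_funM => //; apply: measurable_funTS; exact: measurable_powR.
move=> x /=; rewrite in_itv/= => /andP[x0 x1].
rewrite ger0_norm ?(mulr_ge0 (sqr_ge0 _) (powR_ge0 _ _))//.
by rewrite ler_piMr ?sqr_ge0// powR_le1// mulr_ge0.
Qed.

(** The limit-circle condition at 0: x^(-alpha) is integrable there because alpha < 1. *)
Lemma sq_ps : sq `](0 : R), 1] ps.
Proof.
split; first by apply: measurable_funTS; exact: measurable_powR.
have : -1 < - alpha by have := alpha_lt1; lra.
move=> /intble_powR; apply: eq_intble => // x /=; rewrite in_itv/= => /andP[x0 _].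
rewrite expr2 /ps -powR_add//; congr (_ `^ _); rewrite /q; lra.
Qed.

(** In place of Cauchy-Schwarz, |f| <= s f^2 + 1/s is integrated over ]0,x] with s = sqrt x. *)
Lemma Rint_abs_sq f : sq `](0 : R), 1] f -> exists2 C, 0 <= C & forall x, 0 < x -> x <= 1 ->
  \int[mu]_(t in `]0, x]) `|f t| <= C * Num.sqrt x.
Proof.
move=> [mf If].
exists (\int[mu]_(t in `](0 : R), 1]) (f t ^+ 2) + 1).
  by rewrite addr_ge0// Rintegral_ge0// => t _; exact: sqr_ge0.
move=> x x0 x1; have sx0 : 0 < Num.sqrt x by rewrite sqrtr_gt0.
have sub : `]0, x]%classic `<=` `]0, 1]%classic by apply: subset_itvl; rewrite bnd_simp.
have Ix : intble `]0, x] (fun t => f t ^+ 2) by apply: intbleS If.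
have sfx : sq `]0, x] f by split => //; exact: measurable_funS mf.
have IC : intble `]0, x] (fun=> (Num.sqrt x)^-1).
  by apply: intbleS (intble_cst 0 x _) => //; exact: subset_itv_oc_cc.
have H : \int[mu]_(t in `]0, x]) `|f t| <=
    \int[mu]_(t in `]0, x]) (Num.sqrt x * f t ^+ 2 + (Num.sqrt x)^-1).
  apply: le_Rint => //.
  - apply: intble_norm => //.
    apply: (@le_intble _ _ _ (fun t => f t ^+ 2 + 1)) => //; first exact: sfx.1.
      move=> t _; have h1 := sqr_ge0 (f t - 1); have h2 := sqr_ge0 (f t + 1).
      by rewrite ler_norml; apply/andP; split; nra.
    apply: intbleD => //.
    by apply: intbleS (intble_cst 0 x 1) => //; exact: subset_itv_oc_cc.
  - by apply: intbleD => //; exact: intbleZ.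
  - move=> t _; rewrite -subr_ge0; set s := Num.sqrt x in sx0 *.
    have -> : s * f t ^+ 2 + s^-1 - `|f t| =
        s^-1 * ((s * `|f t| - 2^-1) ^+ 2 + 3 / 4).
      rewrite -[f t ^+ 2]real_normK ?num_real//; field; by rewrite gt_eqF.
    by rewrite mulr_ge0 ?invr_ge0 ?(ltW sx0)// addr_ge0 ?sqr_ge0//; lra.
apply: (le_trans H); rewrite RintD//; last exact: intbleZ.
rewrite RintZ// mulrDl mulrC lerD//.
  rewrite ler_wpM2r ?sqrtr_ge0//; apply: Rint_subset => //.
  by move=> t _; exact: sqr_ge0.
rewrite Rintegral_itv_obnd_cbnd// Rint_cst ?(ltW x0)// subr0 mul1r.
by rewrite -[X in _ * X](sqr_sqrtr (ltW x0)) expr2 mulKf// gt_eqF.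
Qed.

(** The derivatives of both coefficients are integrable at 0, since the factor x^q is square
    integrable and the factor x^p is bounded. For the rate, x^p is monotone and comes out of the
    integral, and [Rint_abs_sq] gives the remaining sqrt x. The rate matters because g_1 is read off
    after dividing g - g_0 x^q by x^p. *)
Lemma coef_lim g g1 h : hsol V g g1 h -> sq Rp g -> sq Rp h ->
  exists v0 v1 : R, [/\ coefb g g1 x @[x --> 0^'+] --> v0,
    coefa g g1 x @[x --> 0^'+] --> v1 &
    exists2 D, 0 <= D & forall x, 0 < x -> x <= 1 ->
      `|coefb g g1 x - v0| <= D * (th x * Num.sqrt x)].
Proof.
move=> hs sg sh; have sr := sq_rem sg sh.
have Ia : intble `](0 : R), 1] (fun x => w^-1 * (ps x * rem g h x)).
  by apply: intbleZ => //; apply: sqM => //; exact: sq_ps.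
have th1 x : 0 < x -> x <= 1 -> `|th x| <= 1.
  move=> x0 x1; rewrite gtr0_norm ?th_gt0//; apply: powR_le1 => //.
  by have := alpha_ge0; rewrite /p; lra.
have mth : measurable_fun `](0 : R), 1] th.
  by apply: measurable_funTS; exact: measurable_powR.
have Ir : intble `](0 : R), 1] (rem g h).
  apply: (@le_intble _ _ _ (fun t => rem g h t ^+ 2 + 1)) => //; first exact: sr.1.
    move=> t _; have h1 := sqr_ge0 (rem g h t - 1); have h2 := sqr_ge0 (rem g h t + 1).
    by rewrite ler_norml; apply/andP; split; nra.
  apply: intbleD => //; first exact: sr.2.
  by apply: intbleS (intble_cst 0 1 1) => //; exact: subset_itv_oc_cc.
have Ib : intble `](0 : R), 1] (fun x => w^-1 * - (th x * rem g h x)).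
  apply: intbleZ => //; apply: intbleN => //.
  apply: (intble_bdM (M := 1)) => // x /=; rewrite in_itv/= => /andP[x0 x1].
  exact: th1.
have [v1 [a1 _]] := prim_lim0 (prim_coefa hs) Ia.
have [v0 [b0 bE]] := prim_lim0 (prim_coefb hs) Ib.
exists v0, v1; split => //.
have [C C0 HC] : exists2 C : R, 0 <= C & forall x, 0 < x -> x <= 1 ->
    \int[mu]_(t in `]0, x]) `|rem g h t| <= C * Num.sqrt x by exact: Rint_abs_sq.
exists (w^-1 * C); first by rewrite mulr_ge0// invr_ge0 ltW.
move=> x x0 x1; rewrite bE//.
have sub : `]0, x]%classic `<=` `]0, 1]%classic by apply: subset_itvl; rewrite bnd_simp.
have Ix : intble `]0, x] (rem g h) by apply: intbleS Ir.
have Ibx : intble `]0, x] (fun x => w^-1 * - (th x * rem g h x)) by apply: intbleS Ib.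
rewrite (le_trans (normr_Rint _ Ibx))//.
apply: (@le_trans _ _ (\int[mu]_(t in `]0, x]) (w^-1 * th x * `|rem g h t|))).
  apply: le_Rint => //; first exact: intble_norm.
    by apply: intbleZ => //; exact: intble_norm.
  move=> t /=; rewrite in_itv/= => /andP[t0 tx].
  rewrite normrM normrN normrM -mulrA (gtr0_norm (th_gt0 t0)) gtr0_norm ?invr_gt0//.
  rewrite ler_wpM2l ?invr_ge0 ?(ltW w_gt0)// ler_wpM2r// ge0_ler_powR ?nnegrE ?(ltW t0) ?(ltW x0)//.
  by have := alpha_ge0; rewrite /p; lra.
rewrite RintZ//; last exact: intble_norm.
rewrite (le_trans (ler_wpM2l _ (HC x x0 x1)))//.
  by rewrite mulr_ge0 ?invr_ge0 ?(ltW w_gt0)// ltW// th_gt0.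
by rewrite le_eqVlt; apply/orP; left; apply/eqP; ring.
Qed.

Definition hbv g v0 v1 :=
  (`|x| `^ (alpha / 2) * g x @[x --> (0 : R)^'+] --> (v0 : R)) /\
  (`|x| `^ (- (1 + alpha / 2)) * (g x - v0 * `|x| `^ (- (alpha / 2)))
    @[x --> (0 : R)^'+] --> (v1 : R)).

Let near01 : \forall x \near (0 : R)^'+, 0 < x /\ x <= 1.
Proof. near=> x; split; near: x; [exact: nbhs_right_gt|exact: nbhs_right_le].
Unshelve. all: by end_near. Qed.

(** One has x^(-q) g = a x^w + b and x^(-p) (g - v0 x^q) = a + (b - v0) x^(q-p); by the rate the
    last term is O(x^(1/2-alpha/2)), which tends to 0 since alpha < 1. *)
Lemma coef_hbv g g1 v0 v1 D : coefb g g1 x @[x --> 0^'+] --> v0 ->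
  coefa g g1 x @[x --> 0^'+] --> v1 ->
  (forall x, 0 < x -> x <= 1 -> `|coefb g g1 x - v0| <= D * (th x * Num.sqrt x)) ->
  hbv g v0 v1.
Proof.
move=> b0 a1 HD.
have qp x : 0 < x -> x `^ (- p) = (th x)^-1 by move=> x0; rewrite powRN.
have aq : alpha / 2 = - q by rewrite /q opprK.
have qq x : 0 < x -> x `^ (- q) = (ps x)^-1 by move=> x0; rewrite powRN.
split.
- apply: (@cvg_trans _ ((fun x => coefa g g1 x * x `^ w + coefb g g1 x) x @[x --> (0:R)^'+])).
    apply: near_eq_cvg; near=> x.
    have [x0 x1] : 0 < x /\ x <= 1 by near: x; exact: near01.
    rewrite gtr0_norm// aq qq// [in RHS](coefE g g1 x0).
    rewrite (_ : w = p - q); last by rewrite /w /p /q; lra.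
    rewrite powR_add// qq// -/(th x); field.
    by rewrite gt_eqF// ps_gt0.
  have := cvgD (cvgM a1 (powR_cvg0 w_gt0)) b0.
  by rewrite mulr0 add0r; exact.
- apply: (@cvg_trans _ ((fun x => coefa g g1 x + (coefb g g1 x - v0) * (ps x / th x)) x
      @[x --> (0:R)^'+])).
    apply: near_eq_cvg; near=> x.
    have [x0 x1] : 0 < x /\ x <= 1 by near: x; exact: near01.
    rewrite gtr0_norm// -/p -/q qp// [in RHS](coefE g g1 x0) -/(ps x); field.
    by rewrite gt_eqF// th_gt0.
  suff H : (coefb g g1 x - v0) * (ps x / th x) @[x --> (0:R)^'+] --> (0 : R).
    by have := cvgD a1 H; rewrite addr0; exact.
  have Hs : (fun x => D * x `^ (2^-1 + q)) x @[x --> (0:R)^'+] --> (0 : R).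
    have := cvgM (cvg_cst D) (@powR_cvg0 R (2^-1 + q) _); rewrite mulr0; apply.
    by have := alpha_lt1; rewrite /q; lra.
  apply: norm_cvg0; apply: (@squeeze_cvgr _ _ _ _ (cst 0) _ _ _ _ _ Hs); last exact: cvg_cst.
  near=> x.
  have [x0 x1] : 0 < x /\ x <= 1 by near: x; exact: near01.
  rewrite /= normr_ge0/= normrM [X in _ * X]gtr0_norm ?divr_gt0 ?ps_gt0 ?th_gt0//.
  rewrite (le_trans (ler_wpM2r _ (HD x x0 x1)))//.
    by rewrite ltW// divr_gt0 ?ps_gt0 ?th_gt0.
  rewrite powR_add// powR12_sqrt ?(ltW x0)// -/(ps x).
  rewrite le_eqVlt; apply/orP; left; apply/eqP; field.
  by rewrite gt_eqF// th_gt0.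
Unshelve. all: by end_near. Qed.

End HalfLine.

(** * Green formula on the half-line *)

Section Green.
Variable R : realType.
Local Notation mu := (@lebesgue_measure R).
Local Notation Rp := (`](0 : R), +oo[%classic : set R).
Implicit Types (f g h l F G : R -> R) (x y z t c s e N : R).
Variables (alpha : R) (k : int).
Hypothesis alpha01 : 0 <= alpha < 1.
Local Notation V := (pot alpha k).
Local Notation ca := (coefa alpha).
Local Notation cb := (coefb alpha).

Let alpha_ge0 : 0 <= alpha. Proof. by case/andP : alpha01. Qed.
Let alpha_lt1 : alpha < 1. Proof. by case/andP : alpha01. Qed.
Let cV : contp V. Proof. exact: contp_pot. Qed.

Let mRp : measurable Rp. Proof. exact: measurable_itv. Qed.

Let sub_ray : `[(1 : R), +oo[ `<=` Rp.
Proof. by move=> x /=; rewrite !in_itv/= !andbT; apply: lt_le_trans. Qed.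

Lemma hsol_contp g g1 h : hsol V g g1 h -> contp g /\ contp g1.
Proof. by move=> [pg pg1]; split; [exact: prim_contp pg|exact: prim_contp pg1]. Qed.

(** Otherwise (g^2)' >= 2 e from some point on, and g^2 would grow linearly, against integrability.
    An upper bound on g g' is all that the energy estimates need. *)
Lemma hsol_small g g1 h : hsol V g g1 h -> sq Rp g ->
  forall N e, 0 < e -> exists2 y, N <= y /\ 1 <= y & g y * g1 y < e.
Proof.
move=> hs sg N e e0; apply: contrapT => H.
have [pg pg1] := hs.
pose N0 := Order.max N 1.
have N01 : 1 <= N0 by rewrite /N0 le_max lexx orbT.
have NN0 : N <= N0 by rewrite /N0 le_max lexx.
have Hy y : N0 <= y -> e <= g y * g1 y.
  move=> Ny; rewrite leNgt; apply/negP => lt; apply: H; exists y => //.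
  by split; lra.
(* Past [z] the growth 2 e (y - N0) is at least 1, while integrability provides such a y with g(y)^2
   < 1. *)
pose z := N0 + (2 * e)^-1.
have ei : 0 < (2 * e)^-1 by rewrite invr_gt0; lra.
have zN : N0 <= z by rewrite /z; lra.
have I : intble `[z, +oo[ (fun x => g x ^+ 2).
  apply: intbleS sg.2 => // x /=; rewrite !in_itv/= !andbT; lra.
have [y zy] := intble_small I ltr01.
have N0y : N0 <= y by lra.
have N00 : 0 < N0 by lra.
have E := primE (primM pg pg) N00 N0y.
have le : \int[mu]_(t in `[N0, y]) (2 * e) <= \int[mu]_(t in `[N0, y]) (g t * g1 t + g t * g1 t).
  apply: le_Rint => //; first exact: intble_cst.
    exact: prim_intble (primM pg pg) N00.
  by move=> t /=; rewrite in_itv/= => /andP[/Hy]; lra.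
move: le; rewrite Rint_cst// -E => le.
have h1 : 1 <= 2 * e * (y - N0).
  have : (2 * e) * (2 * e)^-1 <= 2 * e * (y - N0).
    by rewrite ler_wpM2l ?lerBrDl// mulr_ge0// ltW.
  by rewrite divff// gt_eqF; lra.
have g0 := sqr_ge0 (g N0); rewrite ger0_norm ?sqr_ge0// => gy1.
by rewrite !expr2 in g0 gy1; lra.
Qed.

(** Integrate (g g')' = g'^2 + V g^2 - g h over [1,y], drop V g^2 >= 0, and choose y by [hsol_small]
    so that the boundary term is below 1. *)
Lemma sq_deriv g g1 h : hsol V g g1 h -> sq Rp g -> sq Rp h ->
  sq `[(1 : R), +oo[ g1.
Proof.
move=> hs sg sh; have [cg cg1] := hsol_contp hs; have [pg pg1] := hs.
have Igh := sqM mRp sg sh.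
have Iagh := intble_norm mRp Igh.
split.
  by apply: measurable_funS (contp_measurable cg1) => //; exact: sub_ray.
have c11 : contp (fun x => g1 x ^+ 2).
  by have := contpM cg1 cg1; apply: eq_contp => x _; rewrite expr2.
apply: (@intble_ray _ _ (1 - g 1 * g1 1 + \int[mu]_(t in Rp) `|g t * h t|)).
- by move=> x _; exact: sqr_ge0.
- by move=> y; exact: contp_intble.
move=> N; have [y [Ny y1] gy] := hsol_small hs sg N ltr01; exists y => //.
have I1 : intble `[1, y] (fun x => g1 x ^+ 2) by exact: contp_intble.
have I2 : intble `[1, y] (fun t => g t * h t).
  by apply: intbleS Igh => //; exact: subset_itv_pos.
have I3 := prim_intble y (primM pg pg1) ltr01.
have E := primE (primM pg pg1) ltr01 y1.
have : \int[mu]_(x in `[1, y]) (g1 x ^+ 2) <=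
    \int[mu]_(t in `[1, y]) ((g t * (V t * g t - h t) + g1 t * g1 t) + g t * h t).
  apply: le_Rint => //; first exact: intbleD.
  move=> t _; have := mulr_ge0 (pot_ge0 k alpha01 t) (sqr_ge0 (g t)).
  by rewrite !expr2; lra.
rewrite RintD// -E => H.
have : \int[mu]_(t in `[1, y]) (g t * h t) <= \int[mu]_(t in Rp) `|g t * h t|.
  apply: (le_trans (ler_norm _)); apply: (le_trans (normr_Rint _ I2)) => //.
  by apply: Rint_subset => //; exact: subset_itv_pos.
lra.
Qed.

Lemma prim_wronskian g g1 h f f1 l : hsol V g g1 h -> hsol V f f1 l ->
  prim (fun x => g1 x * f x - g x * f1 x) (fun x => - (h x * f x - g x * l x)).
Proof.
move=> [pg pg1] [pf pf1]; have := primB (primM pg1 pf) (primM pg pf1).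
by apply: eq_prim => x _; ring.
Qed.

(** The Wronskian W = g' f - g f' is a primitive of -(h f - g l). It is integrable on [1,+oo[ by
    [sq_deriv], hence small at suitable large y, and its limit at 0 is computed from the
    coefficients by [wronskianE]. *)
Lemma green_half g g1 h f f1 l (v0 v1 u0 u1 : R) :
  hsol V g g1 h -> hsol V f f1 l ->
  sq Rp g -> sq Rp h -> sq Rp f -> sq Rp l ->
  cb g g1 x @[x --> 0^'+] --> v0 -> ca g g1 x @[x --> 0^'+] --> v1 ->
  cb f f1 x @[x --> 0^'+] --> u0 -> ca f f1 x @[x --> 0^'+] --> u1 ->
  \int[mu]_(x in Rp) (h x * f x - g x * l x) = (1 + alpha) * (v1 * u0 - v0 * u1).
Proof.
move=> hg hf sg sh sf sl bg ag bf af.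
have pW := prim_wronskian hg hf.
set W := fun x => g1 x * f x - g x * f1 x in pW.
set D := fun x => h x * f x - g x * l x in pW *.
have ID : intble Rp D by apply: intbleB => //; exact: sqM.
have IW : intble `[(1 : R), +oo[ W.
  have s1 F : sq Rp F -> sq `[(1 : R), +oo[ F by apply: sqS => //; exact: sub_ray.
  apply: intbleB => //; apply: sqM => //; try exact: s1.
    exact: sq_deriv hg _ _.
  exact: sq_deriv hf _ _.
have W0 : W x @[x --> 0^'+] --> (1 + alpha) * (v1 * u0 - v0 * u1).
  apply: (@cvg_trans _ ((fun x => (1 + alpha) *
      (ca g g1 x * cb f f1 x - cb g g1 x * ca f f1 x)) x @[x --> (0:R)^'+])).
    apply: near_eq_cvg; near=> x.
    have x0 : 0 < x by near: x; exact: nbhs_right_gt.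
    by rewrite /W (wronskianE alpha01 g g1 f f1 x0).
  exact: (cvgM (cvg_cst (1 + alpha)) (cvgB (cvgM ag bf) (cvgM bg af))).
set L := (1 + alpha) * _ in W0 *.
apply/eqP; rewrite -subr_eq0 -normr_le0; apply/ler_addgt0Pl => e e0; rewrite addr0.
have e30 : 0 < e / 3 by lra.
have [n Hn] := exhaustion ID e30.
have [y yn Wy] : exists2 y, n.+1%:R <= y & `|W y| < e / 3.
  apply: (@intble_small _ W n.+1%:R) => //.
  apply: intbleS IW => // x /=; rewrite !in_itv/= !andbT; apply: le_trans.
  by rewrite ler1n.
have N : \forall x \near (0 : R)^'+, [/\ 0 < x, x <= n.+1%:R^-1 & `|L - W x| < e / 3].
  near=> x; split; near: x; [exact: nbhs_right_gt| |exact: cvgr_dist_lt].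
  by apply: nbhs_right_le; rewrite invr_gt0.
have [x [x0 xn Lx]] := filter_ex N.
have xy : x <= y.
  apply: (le_trans xn); apply: le_trans yn.
  by rewrite (@le_trans _ _ 1)// ?invf_le1 ?ler1n.
have := Hn x y x0 xn yn.
have -> : \int[mu]_(t in `[x, y]) D t = W x - W y.
  have := primE pW x0 xy; rewrite RintN//; first lra.
  by apply: intbleS ID => //; exact: subset_itv_pos.
move: Lx Wy; rewrite !ltr_norml => /andP[? ?] /andP[? ?] /andP[? ?].
rewrite ler_norml; apply/andP; split; lra.
Unshelve. all: by end_near. Qed.

(** Since (g g')' >= - h g, the integral is bounded below by boundary terms: g g' is small at
    suitable large y, and it tends to 0 at 0 when g_0 = 0. The rate with constant [D] controls the
    term b^2 x^(2q-1) of g g' at 0. *)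
Lemma positive_half g g1 h (v1 D : R) : hsol V g g1 h -> sq Rp g -> sq Rp h ->
  cb g g1 x @[x --> 0^'+] --> (0 : R) -> ca g g1 x @[x --> 0^'+] --> v1 ->
  (forall x, 0 < x -> x <= 1 ->
    `|cb g g1 x| <= D * (x `^ (1 + alpha / 2) * Num.sqrt x)) ->
  0 <= \int[mu]_(x in Rp) (h x * g x).
Proof.
move=> hg sg sh bg ag HD; have [pg pg1] := hg.
have Igh := sqM mRp sh sg.
have G0 : g x * g1 x @[x --> 0^'+] --> (0 : R).
  pose p := 1 + alpha / 2; pose q := - (alpha / 2).
  apply: (@cvg_trans _ ((fun x => p * (ca g g1 x * ca g g1 x) * x `^ (1 + alpha) +
      ca g g1 x * cb g g1 x + q * (cb g g1 x ^+ 2 * (x `^ q * x `^ q / x))) x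
      @[x --> (0:R)^'+])).
    apply: near_eq_cvg; near=> x.
    have x0 : 0 < x by near: x; exact: nbhs_right_gt.
    have xn0 : x != 0 by rewrite gt_eqF.
    rewrite (coefE alpha01 g g1 x0) (coefE1 alpha01 g g1 x0) -/p -/q.
    set A := ca _ _ _; set B := cb _ _ _.
    have E : x `^ p * x `^ q = x.
      by rewrite -powR_add// (_ : p + q = 1) ?powRr1 ?(ltW x0)// /p /q; lra.
    have E1 : x `^ (1 + alpha) = x `^ p * x `^ p / x.
      apply: (mulIf xn0); rewrite divfK//.
      rewrite -{2}(powRr1 (ltW x0)) -!powR_add//; congr (_ `^ _); rewrite /p; lra.
    rewrite E1.
    have -> : (A * x `^ p + B * x `^ q) * (A * (p * (x `^ p / x)) + B * (q * (x `^ q / x))) =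
      p * (A * A) * (x `^ p * x `^ p / x) + (p + q) * (A * B) * ((x `^ p * x `^ q) / x) +
      q * (B ^+ 2 * (x `^ q * x `^ q / x)) by field.
    by rewrite E divff// (_ : p + q = 1) ?mulr1 ?mul1r// /p /q; lra.
  have H1 : p * (ca g g1 x * ca g g1 x) * x `^ (1 + alpha) @[x --> (0:R)^'+] --> (0 : R).
    have w0 : 0 < 1 + alpha by have := alpha_ge0; lra.
    have := cvgM (cvgM (cvg_cst p) (cvgM ag ag)) (powR_cvg0 w0).
    by rewrite mulr0; exact.
  have H2 : ca g g1 x * cb g g1 x @[x --> (0:R)^'+] --> (0 : R).
    by have := cvgM ag bg; rewrite mulr0; exact.
  have H3 : q * (cb g g1 x ^+ 2 * (x `^ q * x `^ q / x)) @[x --> (0:R)^'+] --> (0 : R).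
    suff H : cb g g1 x ^+ 2 * (x `^ q * x `^ q / x) @[x --> (0:R)^'+] --> (0 : R).
      by have := cvgM (cvg_cst q) H; rewrite mulr0; exact.
    have Hs : (fun x => D ^+ 2 * x `^ 2) x @[x --> (0:R)^'+] --> (0 : R).
      by have := cvgM (cvg_cst (D ^+ 2)) (@powR_cvg0 R 2 (ltr0Sn R 1)); rewrite mulr0; exact.
    apply: (@squeeze_cvgr _ _ _ _ (cst 0) _ _ _ _ _ Hs); last exact: cvg_cst.
    near=> x.
    have x0 : 0 < x by near: x; exact: nbhs_right_gt.
    have x1 : x <= 1 by near: x; exact: nbhs_right_le.
    have xn0 : x != 0 by rewrite gt_eqF.
    have r0 : 0 <= x `^ q * x `^ q / x by rewrite divr_ge0 ?mulr_ge0 ?powR_ge0// ltW.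
    rewrite /= mulr_ge0 ?sqr_ge0//=.
    have : cb g g1 x ^+ 2 <= (D * (x `^ p * Num.sqrt x)) ^+ 2.
      rewrite -[leLHS]real_normK ?num_real// ler_sqr ?nnegrE//; first exact: HD.
      by rewrite (le_trans _ (HD x x0 x1)).
    move=> /(ler_wpM2r r0) /le_trans; apply.
    rewrite le_eqVlt; apply/orP; left; apply/eqP.
    rewrite powR_mulrn ?ltW// !exprMn sqr_sqrtr ?ltW//.
    have E : x `^ p * x `^ q = x.
      by rewrite -powR_add// (_ : p + q = 1) ?powRr1 ?(ltW x0)// /p /q; lra.
    rewrite (_ : D ^+ 2 * (x `^ p ^+ 2 * x) * (x `^ q * x `^ q / x) =
      D ^+ 2 * (x `^ p * x `^ q) ^+ 2); last by field.
    by rewrite E.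
  by have := cvgD (cvgD H1 H2) H3; rewrite !addr0; exact.
apply/ler_addgt0Pl => e e0.
have e30 : 0 < e / 3 by lra.
have [n Hn] := exhaustion Igh e30.
have [y [yn y1] Gy] := hsol_small hg sg n.+1%:R e30.
have N : \forall x \near (0 : R)^'+, [/\ 0 < x, x <= n.+1%:R^-1 & `|0 - g x * g1 x| < e / 3].
  near=> x; split; near: x; [exact: nbhs_right_gt| |exact: cvgr_dist_lt].
  by apply: nbhs_right_le; rewrite invr_gt0.
have [x [x0 xn Lx]] := filter_ex N.
have xy : x <= y.
  apply: (le_trans xn); apply: le_trans yn.
  by rewrite (@le_trans _ _ 1)// ?invf_le1 ?ler1n.
have := Hn x y x0 xn yn.
have Ixy : intble `[x, y] (fun t => h t * g t).
  by apply: intbleS Igh => //; exact: subset_itv_pos.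
have : g y * g1 y - g x * g1 x >= - \int[mu]_(t in `[x, y]) (h t * g t).
  rewrite (primE (primM pg pg1) x0 xy) -RintN//.
  apply: le_Rint => //; first exact: intbleN.
    exact: prim_intble (primM pg pg1) x0.
  move=> t _; have := mulr_ge0 (pot_ge0 k alpha01 t) (sqr_ge0 (g t)).
  by have := sqr_ge0 (g1 t); rewrite !expr2; lra.
move: Lx Gy; rewrite !ltr_norml => /andP[? ?] ? ? /andP[? ?]; lra.
Unshelve. all: by end_near. Qed.

End Green.

(** * The maximal domain on the half-line *)

Section HalfDomain.
Variable R : realType.
Local Notation mu := (@lebesgue_measure R).
Local Notation Rp := (`](0 : R), +oo[%classic : set R).
Implicit Types (f g h l F G : R -> R) (x y z t c s e N : R).
Variables (alpha : R) (k : int).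
Hypothesis alpha01 : 0 <= alpha < 1.
Local Notation V := (pot alpha k).
Local Notation ca := (coefa alpha).
Local Notation cb := (coefb alpha).

Let alpha_ge0 : 0 <= alpha. Proof. by case/andP : alpha01. Qed.
Let alpha_lt1 : alpha < 1. Proof. by case/andP : alpha01. Qed.
Let cV : contp V. Proof. exact: contp_pot. Qed.
Let mRp : measurable Rp. Proof. exact: measurable_itv. Qed.

(* [hbv] for some representative of the almost-everywhere class of [g]. *)
Definition hbva g (v0 v1 : R) :=
  exists2 g', aep (fun x => g x = g' x) & hbv alpha g' v0 v1.

Definition hdom g h := [/\ sq Rp g, sq Rp h &
  exists g' g1, aep (fun x => g x = g' x) /\ hsol V g' g1 h].

Lemma aep_all (P : R -> Prop) : (forall x, 0 < x -> P x) -> aep P.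
Proof.
move=> HP; apply: negligibleS (@negligible_set0 _ _ _ mu) => x /= [x0 nP].
by apply: nP; exact: HP.
Qed.

Lemma hbva_uniq g v0 v1 u0 u1 : hbva g v0 v1 -> hbva g u0 u1 -> v0 = u0 /\ v1 = u1.
Proof.
move=> [f gf [f0 f1]] [l gl [l0 l1]].
have fl : aep (fun x => f x = l x).
  by apply: aep_mono (aep_and gf gl) => x _ [<- <-].
have E0 : v0 = u0 by apply: aep_lim f0 l0; apply: aep_mono fl => x _ ->.
split => //; rewrite -E0 in l1; apply: aep_lim f1 l1.
by apply: aep_mono fl => x _ ->.
Qed.

Lemma hbva_ae g f v0 v1 : aep (fun x => g x = f x) -> hbva g v0 v1 -> hbva f v0 v1.
Proof.
move=> gf [g' gg' H]; exists g' => //.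
by apply: aep_mono (aep_and gf gg') => x _ [<- <-].
Qed.

Lemma hbva_lin c g f v0 v1 u0 u1 : hbva g v0 v1 -> hbva f u0 u1 ->
  hbva (fun x => c * g x + f x) (c * v0 + u0) (c * v1 + u1).
Proof.
move=> [g' gg' [g0 g1]] [f' ff' [f0 f1]]; exists (fun x => c * g' x + f' x).
  by apply: aep_mono (aep_and gg' ff') => x _ [-> ->].
split.
  apply: (@cvg_trans _ ((fun x => c * (`|x| `^ (alpha / 2) * g' x) +
    `|x| `^ (alpha / 2) * f' x) x @[x --> (0:R)^'+])).
    by apply: near_eq_cvg; apply: nearW => x; ring.
  exact: (cvgD (cvgM (cvg_cst c) g0) f0).
apply: (@cvg_trans _ ((fun x => c * (`|x| `^ (- (1 + alpha / 2)) * (g' x - v0 * `|x| `^ (- (alpha / 2)))) +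
    `|x| `^ (- (1 + alpha / 2)) * (f' x - u0 * `|x| `^ (- (alpha / 2)))) x @[x --> (0:R)^'+])).
  by apply: near_eq_cvg; apply: nearW => x; ring.
exact: (cvgD (cvgM (cvg_cst c) g1) f1).
Qed.

Lemma hdom_lin c g f h l : hdom g h -> hdom f l ->
  hdom (fun x => c * g x + f x) (fun x => c * h x + l x).
Proof.
move=> [sg sh [g' [g1 [gg' [pg pg1]]]]] [sf sl [f' [f1 [ff' [pf pf1]]]]].
split; [by apply: sqD => //; exact: sqZ|by apply: sqD => //; exact: sqZ|].
exists (fun x => c * g' x + f' x), (fun x => c * g1 x + f1 x); split.
  by apply: aep_mono (aep_and gg' ff') => x _ [-> ->].
split; first exact: primD (primZ c pg) pf.
by have := primD (primZ c pg1) pf1; apply: eq_prim => x _; ring.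
Qed.

Lemma hdom_coef g h : hdom g h -> exists g' g1, exists v0 v1 D : R,
  [/\ [/\ aep (fun x => g x = g' x), sq Rp g' & hsol V g' g1 h],
    hbva g v0 v1, cb g' g1 x @[x --> 0^'+] --> v0,
    ca g' g1 x @[x --> 0^'+] --> v1 &
    forall x, 0 < x -> x <= 1 ->
      `|cb g' g1 x - v0| <= D * (x `^ (1 + alpha / 2) * Num.sqrt x)].
Proof.
move=> [sg sh [g' [g1 [gg' hs]]]].
have mg' := contp_measurable (hsol_contp hs).1.
have sg' : sq Rp g'.
  split => //; apply: (Rint_ae (f := fun x => g x ^+ 2) _ (@subset_refl _ Rp) _ _ _).1 => //.
  - exact: sg.2.
  - exact: measurable_funX.
  - by apply: aep_mono gg' => x _ ->.
have [v0 [v1 [b0 a1 [D D0 HD]]]] := coef_lim alpha01 hs sg' sh.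
exists g', g1, v0, v1, D; split => //.
by exists g' => //; exact: coef_hbv b0 a1 HD.
Qed.

Lemma hdom_hbva g h : hdom g h -> exists v0 v1, hbva g v0 v1.
Proof. by move=> /hdom_coef[g' [g1 [v0 [v1 [D [_ H _ _ _]]]]]]; exists v0, v1. Qed.

Lemma hdom_green g h f l v0 v1 u0 u1 : hdom g h -> hdom f l ->
  hbva g v0 v1 -> hbva f u0 u1 ->
  \int[mu]_(x in Rp) (h x * f x - g x * l x) = (1 + alpha) * (v1 * u0 - v0 * u1).
Proof.
move=> dg df bg bf.
have [g' [g1 [w0 [w1 [D [[gg' sg' hg] bg' cg0 cg1 _]]]]]] := hdom_coef dg.
have [f' [f1 [z0 [z1 [E [[ff' sf' hf] bf' cf0 cf1 _]]]]]] := hdom_coef df.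
have [-> ->] := hbva_uniq bg bg'; have [-> ->] := hbva_uniq bf bf'.
have [sg sh _] := dg; have [sf sl _] := df.
rewrite -(green_half alpha01 hg hf sg' sh sf' sl cg0 cg1 cf0 cf1).
apply: (Rint_ae _ (@subset_refl _ Rp) _ _ _).2 => //.
- by apply: intbleB => //; exact: sqM.
- apply: measurable_funB; first by apply: measurable_funM; [exact: sh.1|exact: sf'.1].
  by apply: measurable_funM; [exact: sg'.1|exact: sl.1].
- by apply: aep_mono (aep_and gg' ff') => x _ [-> ->].
Qed.

Lemma hdom_ge0 g h v1 : hdom g h -> hbva g 0 v1 ->
  0 <= \int[mu]_(x in Rp) (h x * g x).
Proof.
move=> dg bg.
have [g' [g1 [w0 [w1 [D [[gg' sg' hg] bg' cg0 cg1 HD]]]]]] := hdom_coef dg.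
have [E0 _] := hbva_uniq bg bg'.
have [sg sh _] := dg.
have HD' x : 0 < x -> x <= 1 -> `|cb g' g1 x| <= D * (x `^ (1 + alpha / 2) * Num.sqrt x).
  by move=> x0 x1; have := HD x x0 x1; rewrite -E0 subr0.
rewrite -E0 in cg0.
have P := positive_half alpha01 hg sg' sh cg0 cg1 HD'.
have m : measurable_fun Rp (fun x => h x * g' x).
  by apply: measurable_funM; [exact: sh.1|exact: sg'.1].
have E : aep (fun x => h x * g x = h x * g' x) by apply: aep_mono gg' => x _ ->.
by have [_ ->] := Rint_ae mRp (@subset_refl _ Rp) (sqM mRp sh sg) m E.
Qed.

(** For small x the factor x^(alpha/2) is at most 1, so x^(alpha/2) |g x| <= M sqrt x tends to 0
    along a set of full measure. *)
Lemma hbva_bound g (v0 v1 M : R) : hbva g v0 v1 ->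
  aep (fun x => `|g x| <= M * Num.sqrt x) -> v0 = 0.
Proof.
move=> [g' gg' [g0 _]] gM; apply/eqP; apply: contrapT => /negP v00.
have e0 : 0 < `|v0| / 2 by rewrite divr_gt0// normr_gt0.
have M0 : M * Num.sqrt x @[x --> (0:R)^'+] --> (0 : R).
  have h20 : 0 < 2^-1 :> R by lra.
  apply: (@cvg_trans _ ((fun x => M * x `^ 2^-1) x @[x --> (0:R)^'+])).
    apply: near_eq_cvg; near=> x.
    by rewrite powR12_sqrt//; near: x; exact: nbhs_right_ge.
  by have := cvgM (cvg_cst M) (powR_cvg0 h20); rewrite mulr0; exact.
have N : \forall x \near (0 : R)^'+, [/\ 0 < x, x <= 1,
    `|v0 - `|x| `^ (alpha / 2) * g' x| < `|v0| / 2 & `|0 - M * Num.sqrt x| < `|v0| / 2].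
  near=> x; split; near: x; [exact: nbhs_right_gt|exact: nbhs_right_le|
    exact: cvgr_dist_lt|exact: cvgr_dist_lt].
have [x [x0 [gg'x gMx] [_ x1 H1 H2]]] := aep_near (aep_and gg' gM) N.
have P0 : 0 <= x `^ (alpha / 2) by exact: powR_ge0.
have P1 : x `^ (alpha / 2) <= 1 by apply: powR_le1 => //; have := alpha_ge0; lra.
rewrite (gtr0_norm x0) in H1; rewrite gg'x in gMx.
have h3 : `|x `^ (alpha / 2) * g' x| <= `|g' x|.
  by rewrite normrM ger0_norm// ler_piMl.
have h4 := ler_distD (x `^ (alpha / 2) * g' x) v0 0; rewrite !subr0 in h4.
rewrite sub0r normrN in H2; have h5 := ler_norm (M * Num.sqrt x); lra.
Unshelve. all: by end_near. Qed.

(** Only the behaviour on x > 0 is constrained, so that test functions of the line, which may live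
    on both sides of 0, qualify ([test_htest]). *)
Definition htest (u : R -> R) := smooth u /\ exists e M : R, 0 < e /\
  forall x, 0 < x -> (x < e \/ M < x) -> u x = 0.

Definition Sreal (u : R -> R) x := - u^`(2)%classic x + V x * u x.

Lemma htest_derive1 u : htest u -> htest u^`()%classic.
Proof.
move=> [su [e [M [e0 H]]]]; split; first exact: smooth_derive1.
exists e, M; split => // x x0 Hx.
have : is_derive x 1 u 0.
  apply: (@is_derive_near _ (fun=> 0)) => //.
  have N : \forall y \near x, 0 < y /\ (y < e \/ M < y).
    near=> y; split; first by near: y; exact: lt_nbhsr.
    near: y; case: Hx => Hx; near=> y; first by left; near: y; exact: lt_nbhsl.
    by right; near: y; exact: lt_nbhsr.
  near=> y; have [y0 Hy] : 0 < y /\ (y < e \/ M < y) by near: y; exact: N.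
  by rewrite H.
by rewrite derive1E => -[].
Unshelve. all: by end_near. Qed.

Lemma htest_contp u : htest u -> contp u.
Proof. by move=> [su _]; apply: continuous_contp; exact: smooth_continuous. Qed.

Lemma htest_prim u : htest u -> prim u u^`()%classic.
Proof.
move=> pu; apply: prim_derive => [x _|]; first exact: smooth_is_derive pu.1.
exact/htest_contp/htest_derive1.
Qed.

Lemma csupp_intble f : contp f ->
  (exists e M : R, 0 < e /\ forall x, 0 < x -> (x < e \/ M < x) -> f x = 0) ->
  intble Rp f.
Proof.
move=> cf [e [M [e0 H]]].
apply: (@intble_supp _ `[e, M]) => //; first exact: subset_itv_pos.
  move=> x /=; rewrite in_itv/= andbT => x0; rewrite in_itv/= => /negP.
  by rewrite negb_and -!ltNge => /orP; exact: H.
exact: contp_intble.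
Qed.

Lemma htest_sq u F : htest u -> contp F -> sq Rp (fun x => F x * u x).
Proof.
move=> pu cF; have cu := htest_contp pu; have cFu := contpM cF cu.
split; first exact: contp_measurable.
apply: csupp_intble.
  by have := contpM cFu cFu; apply: eq_contp => x _; rewrite expr2.
case: pu => _ [e [M [e0 H]]]; exists e, M; split => // x x0 Hx.
by rewrite H// mulr0 expr0n.
Qed.

Lemma htest_sq1 u : htest u -> sq Rp u.
Proof.
move=> pu; have := htest_sq pu (@contp_cst R 1).
by congr sq; apply/funext => x; rewrite mul1r.
Qed.

Lemma htest_hdom u : htest u -> hdom u (Sreal u).
Proof.
move=> pu; have pu1 := htest_derive1 pu; have pu2 := htest_derive1 pu1.
have E : u^`(2)%classic = (u^`()^`())%classic by rewrite derive1nS derive1n1.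
split.
- exact: htest_sq1.
- rewrite /Sreal E; apply: sqD => //; last exact: htest_sq.
  have := sqZ (-1) mRp (htest_sq1 pu2).
  by congr sq; apply/funext => x; rewrite mulN1r.
exists u, u^`()%classic; split; first exact: aep_all.
split; first exact: htest_prim.
have := htest_prim pu1; apply: eq_prim => x _.
by rewrite /Sreal E; ring.
Qed.

Lemma htest_hbva u : htest u -> hbva u 0 0.
Proof.
move=> [su [e [M [e0 H]]]]; exists u; first exact: aep_all.
have N : \forall x \near (0 : R)^'+, u x = 0.
  near=> x; apply: H; first by near: x; exact: nbhs_right_gt.
  by left; near: x; exact: nbhs_right_lt.
split; apply: (@cvg_trans _ ((fun=> 0 : R) x @[x --> (0:R)^'+])); try exact: cvg_cst.
  by apply: near_eq_cvg; near=> x; rewrite (near N x)// mulr0.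
by apply: near_eq_cvg; near=> x; rewrite (near N x)// mul0r subr0 mulr0.
Unshelve. all: by end_near. Qed.

(** Green's formula with vanishing boundary values of [u]. This is the converse of [weak_hsol]. *)
Lemma hdom_weak g h u : hdom g h -> htest u ->
  \int[mu]_(x in Rp) (Sreal u x * g x) = \int[mu]_(x in Rp) (u x * h x).
Proof.
move=> dg pu; have [v0 [v1 bg]] := hdom_hbva dg.
have := hdom_green (htest_hdom pu) dg (htest_hbva pu) bg.
have [sg sh _] := dg; have [su sSu _] := htest_hdom pu.
rewrite RintB//; [|exact: sqM|exact: sqM]; rewrite !mul0r subr0 mulr0.
by move/eqP; rewrite subr_eq0 => /eqP.
Qed.

(** Integration by parts bounds the integral of u'^2 by Q = <S u, u> as V >= 0, and u x is the
    integral of u' from near 0. Cauchy-Schwarz is replaced by the family 2 |u x| <= s Q + x / s,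
    optimized in s. *)
Lemma htest_energy u : htest u -> forall x, 0 < x ->
  u x ^+ 2 <= x * \int[mu]_(t in Rp) (Sreal u t * u t).
Proof.
move=> pu; have pu1 := htest_derive1 pu; have pu2 := htest_derive1 pu1.
have E : u^`(2)%classic = (u^`()^`())%classic by rewrite derive1nS derive1n1.
set u1 := (u^`())%classic in pu1 pu2 E *; set u2 := (u1^`())%classic in pu2 E *.
have [su [e [M [e0 He]]]] := pu.
have [_ [e1 [M1 [e10 He1]]]] := pu1.
have [_ [e2 [M2 [e20 He2]]]] := pu2.
have cu := htest_contp pu; have cu1 := htest_contp pu1; have cu2 := htest_contp pu2.
have c11 : contp (fun t => u1 t ^+ 2).
  by have := contpM cu1 cu1; apply: eq_contp => t _; rewrite expr2.
have cVuu : contp (fun t => V t * (u t ^+ 2)).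
  by have := contpM cV (contpM cu cu); apply: eq_contp => t _; rewrite expr2.
have I11 : intble Rp (fun t => u1 t ^+ 2).
  by apply: csupp_intble => //; exists e1, M1; split => // t t0 Ht; rewrite He1// expr0n.
have IV : intble Rp (fun t => V t * (u t ^+ 2)).
  by apply: csupp_intble => //; exists e, M; split => // t t0 Ht; rewrite He// expr0n mulr0.
have I2 : intble Rp (fun t => u t * u2 t).
  by apply: csupp_intble; [exact: contpM|exists e, M; split => // t t0 Ht; rewrite He// mul0r].
have Z : \int[mu]_(t in Rp) (u t * u2 t + u1 t * u1 t) = 0.
  have pU := primM (htest_prim pu) (htest_prim pu1).
  have mn0 : 0 < Order.min e e1 by rewrite lt_min e0.
  (* [prim_supp] asks for vanishing on the negative axis too, where [htest] says nothing; hence the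
     cut at 0. *)
  pose G t := if 0 < t then u t * u1 t else 0.
  have pG : prim G (fun t => u t * u2 t + u1 t * u1 t).
    by apply: eq_priml pU => t t0; rewrite /G t0.
  apply: (@prim_supp _ _ _ _ (Order.max M M1) pG mn0).
    move=> t; rewrite /G; case: ifP => // t0.
    by rewrite lt_min gt_max => -[|] /andP[h1 h2]; rewrite He ?mul0r//; by [left|right].
  move=> t t0; rewrite lt_min gt_max => -[|] /andP[h1 h2];
    rewrite He ?He1 ?mul0r ?addr0//; by [left|right].
have En : \int[mu]_(t in Rp) (Sreal u t * u t) =
    \int[mu]_(t in Rp) (u1 t ^+ 2 + V t * (u t ^+ 2)).
  have -> : \int[mu]_(t in Rp) (Sreal u t * u t) =
      \int[mu]_(t in Rp) ((u1 t ^+ 2 + V t * (u t ^+ 2)) - (u t * u2 t + u1 t * u1 t)).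
    by apply: eq_Rint => t _; rewrite /Sreal E; ring.
  rewrite RintB ?Z ?subr0//; first exact: intbleD.
  by apply: intbleD => //; apply: eq_intble I11 => // t _; rewrite expr2.
have E1 : \int[mu]_(t in Rp) (u1 t ^+ 2) <= \int[mu]_(t in Rp) (Sreal u t * u t).
  rewrite En; apply: le_Rint => //; first exact: intbleD.
  by move=> t _; rewrite lerDl mulr_ge0 ?sqr_ge0// pot_ge0.
set Q := (\int[mu]_(t in Rp) (Sreal u t * u t))%R in E1 *.
move=> x x0.
have Q0 : 0 <= Q by apply: le_trans E1; apply: Rintegral_ge0 => t _; exact: sqr_ge0.
have key s : 0 < s -> 2 * `|u x| <= s * Q + x / s.
  move=> s0.
  pose a := Order.min x (e / 2).
  have a0 : 0 < a by rewrite lt_min x0 divr_gt0.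
  have ax : a <= x by rewrite ge_min lexx.
  have ua : u a = 0.
    apply: He => //; left; apply: (@le_lt_trans _ _ (e / 2)); last lra.
    by rewrite ge_min lexx orbT.
  have := primE (htest_prim pu) a0 ax; rewrite ua subr0 => ->.
  have Iax : intble `[a, x] u1 by exact: contp_intble.
  have I1ax : intble `[a, x] (fun t => u1 t ^+ 2) by exact: contp_intble.
  have h1 : 2 * \int[mu]_(t in `[a, x]) `|u1 t| <=
      \int[mu]_(t in `[a, x]) (s * u1 t ^+ 2 + s^-1).
    rewrite -RintZ//; last exact: intble_norm.
    apply: le_Rint => //.
    - by apply: intbleZ => //; exact: intble_norm.
    - by apply: intbleD => //; [exact: intbleZ|exact: intble_cst].
    - move=> t _; rewrite -subr_ge0.
      have -> : s * u1 t ^+ 2 + s^-1 - 2 * `|u1 t| = s^-1 * (s * `|u1 t| - 1) ^+ 2.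
        rewrite -[u1 t ^+ 2]real_normK ?num_real//; field; by rewrite gt_eqF.
      by rewrite mulr_ge0 ?sqr_ge0// invr_ge0 ltW.
  have h2 : \int[mu]_(t in `[a, x]) (s * u1 t ^+ 2 + s^-1) <= s * Q + x / s.
    rewrite RintD//; [|exact: intbleZ|exact: intble_cst].
    rewrite RintZ// Rint_cst//; apply: lerD.
      rewrite ler_pM2l//; apply: le_trans E1; apply: Rint_subset => //.
        exact: subset_itv_pos.
      by move=> t _; exact: sqr_ge0.
    by rewrite mulrC ler_wpM2r ?invr_ge0 ?(ltW s0)// gerBl ltW.
  by have := normr_Rint (measurable_itv _) Iax; lra.
have [->|ux0] := eqVneq (u x) 0; first by rewrite expr0n mulr_ge0// ltW.
have nu0 : 0 < `|u x| by rewrite normr_gt0.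
(* If Q = 0, the choice s = x / |u x| gives 2 |u x| <= |u x|; otherwise s = |u x| / Q gives |u x| <=
   x Q / |u x|. *)
have [Q00|Q0'] := eqVneq Q 0.
  have := key (x / `|u x|); rewrite divr_gt0// => /(_ isT).
  rewrite Q00 mulr0 add0r invf_div mulrCA divff ?gt_eqF// mulr1; lra.
have Qp : 0 < Q by rewrite lt_neqAle eq_sym Q0'.
have := key (`|u x| / Q); rewrite divr_gt0// => /(_ isT).
rewrite divfK ?gt_eqF// invf_div => H.
have : `|u x| * `|u x| <= x * (Q / `|u x|) * `|u x| by rewrite ler_pM2r//; lra.
rewrite -[u x ^+ 2]real_normK ?num_real// expr2.
by move=> /le_trans; apply; rewrite mulrA divfK// gt_eqF.
Qed.

End HalfDomain.

(** * Surjectivity of the boundary map *)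

Section Surjectivity.
Variable R : realType.
Local Notation mu := (@lebesgue_measure R).
Local Notation Rp := (`](0 : R), +oo[%classic : set R).
Local Notation I01 := (`](0 : R), 1]%classic : set R).
Implicit Types (f g h l F G : R -> R) (x y z t c s e N : R).
Variables (alpha : R) (k : int).
Hypothesis alpha01 : 0 <= alpha < 1.
Local Notation V := (pot alpha k).

Let alpha_ge0 : 0 <= alpha. Proof. by case/andP : alpha01. Qed.
Let alpha_lt1 : alpha < 1. Proof. by case/andP : alpha01. Qed.
Let mRp : measurable Rp. Proof. exact: measurable_itv. Qed.
Let mI01 : measurable I01. Proof. exact: measurable_itv. Qed.
Let I01Rp : I01 `<=` Rp.
Proof. by move=> x /=; rewrite !in_itv/= andbT => /andP[]. Qed.

Lemma in_I01 x : 0 < x -> (x \in I01) = (x <= 1).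
Proof.
move=> x0; case: (leP x 1) => x1; first by rewrite mem_set//= in_itv/= x0.
by rewrite memNset//= in_itv/= => /andP[_]; rewrite leNgt x1.
Qed.

(** The condition F 1 = 0 keeps the cut-off function continuous at 1, so its increments carry no
    jump. *)
Lemma prim_cut F f : prim F f -> F 1 = 0 -> prim (F \_ I01) (f \_ I01).
Proof.
move=> pF F1 x y x0 xy.
have cut1 a b : 0 < a -> a <= b -> b <= 1 -> intble `[a, b] (f \_ I01) /\
    (F \_ I01) b - (F \_ I01) a = \int[mu]_(t in `[a, b]) (f \_ I01) t.
  move=> a0 ab b1; have [If FE] := pF a b a0 ab.
  have E t : `[a, b]%classic t -> f t = (f \_ I01) t.
    move=> /=; rewrite in_itv/= => /andP[at_ tb].
    by rewrite patchE in_I01 ?(le_trans tb b1)//; exact: lt_le_trans at_.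
  split; first exact: eq_intble If.
  rewrite -(eq_Rint E) -FE !patchE !in_I01//; last exact: lt_le_trans ab.
  by rewrite b1 (le_trans ab b1).
have cut2 a b : 1 <= a -> a <= b -> intble `[a, b] (f \_ I01) /\
    (F \_ I01) b - (F \_ I01) a = \int[mu]_(t in `[a, b]) (f \_ I01) t.
  move=> a1 ab; have a0 : 0 < a by lra.
  have b0 : 0 < b by lra.
  have E t : `]a, b]%classic t -> 0 = (f \_ I01) t.
    move=> /=; rewrite in_itv/= => /andP[at_ tb].
    by rewrite patchE in_I01 ?ifF//; [apply/negbTE; rewrite -ltNge; lra|lra].
  have Ioc : intble `]a, b] (f \_ I01).
    apply: (eq_intble _ E) => //.
    by apply: intbleS (intble_cst a b 0) => //; exact: subset_itv_oc_cc.
  have FZ t : 1 <= t -> (F \_ I01) t = 0.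
    move=> t1; rewrite patchE in_I01; last lra.
    by case: ifP => // t1'; rewrite (_ : t = 1)//; lra.
  split.
    apply/integrableP; split.
      apply/measurable_EFinP; apply/measurable_fun_itv_obnd_cbndP.
      exact: intble_measurable Ioc.
    rewrite -integral_itv_obnd_cbnd; first by case/integrableP : Ioc.
    apply/measurable_EFinP; apply: measurableT_comp => //.
    exact: intble_measurable Ioc.
  rewrite !FZ ?subrr//; last lra.
  rewrite -Rintegral_itv_obnd_cbnd//.
  by rewrite -(eq_Rint E) Rintegral_cst// mul0r.
have [y1|y1] := leP y 1; first exact: cut1.
have [x1|x1] := leP 1 x; first exact: cut2.
have [J1 E1] := cut1 x 1 x0 (ltW x1) (lexx 1).
have [J2 E2] := cut2 1 y (lexx 1) (ltW y1).
have J := intble_itvU (ltW x1) (ltW y1) J1 J2.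
split => //; rewrite (Rint_chasles (ltW x1) (ltW y1))// -E1 -E2; ring.
Qed.

Lemma sq_cut F : sq I01 F -> measurable_fun setT (F \_ I01) /\ sq Rp (F \_ I01).
Proof.
move=> [mF IF].
have mT : measurable_fun setT (F \_ I01) by exact: (measurable_restrictT F mI01).1 mF.
split => //; split; first exact: measurable_funTS.
apply: (@intble_supp _ I01) => //.
  by move=> x _ Ix; rewrite patchE memNset// expr0n.
by apply: eq_intble IF => // x Ix; rewrite patchE mem_set.
Qed.

Lemma sq_powR s : - 2^-1 < s -> sq I01 (fun x => x `^ s).
Proof.
move=> s1; split; first by apply: measurable_funTS; exact: measurable_powR.
have : -1 < s + s by lra.
move=> /intble_powR; apply: eq_intble => // x /=; rewrite in_itv/= => /andP[x0 _].
by rewrite powR_add// expr2.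
Qed.

(** The factor (1 - x^2)^2 has a double zero at 1, so the function and its derivative can both be
    cut off there. The equation for [s] cancels the term of order x^(s-2) in - g'' + V g, and s >
    -1/2 makes what remains square integrable. *)
Lemma cut_poly s : - 2^-1 < s -> s * (s - 1) = alpha * (2 + alpha) / 4 ->
  let g := (fun x => x `^ s * (1 - x ^+ 2) ^+ 2) \_ I01 in
  exists h, [/\ measurable_fun setT g, measurable_fun setT h,
    forall x, x <= 0 -> g x = 0 /\ h x = 0 & hdom alpha k g h].
Proof.
move=> s1 sE.
have p2 t x : 0 < x -> x `^ (t + 2) = x `^ t * x ^+ 2.
  by move=> x0; rewrite powR_add// (powR_mulrn 2) ?ltW.
have p4 t x : 0 < x -> x `^ (t + 4) = x `^ t * x ^+ 4.
  by move=> x0; rewrite powR_add// (powR_mulrn 4) ?ltW.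
pose P x := x `^ s * (1 - x ^+ 2) ^+ 2.
pose P1 x := s * (x `^ s / x) - 2 * ((s + 2) * (x `^ (s + 2) / x)) +
  (s + 4) * (x `^ (s + 4) / x).
pose P2 x := s * (s - 1) * (x `^ s / x ^+ 2) -
  2 * ((s + 2) * (s + 2 - 1) * (x `^ (s + 2) / x ^+ 2)) +
  (s + 4) * (s + 4 - 1) * (x `^ (s + 4) / x ^+ 2).
have pP : prim P P1.
  have := primD (primB (@prim_powR R s) (@primZ R 2 _ _ (@prim_powR R (s + 2))))
    (@prim_powR R (s + 4)).
  apply: eq_priml => x x0; rewrite p2// p4// /P; ring.
have pP1 : prim P1 P2.
  exact: (primD (primB (@prim_powR2 R s) (@primZ R 2 _ _ (@prim_powR2 R (s + 2))))
    (@prim_powR2 R (s + 4))).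
have P10 : P 1 = 0 by rewrite /P expr1n subrr expr0n mulr0.
have P110 : P1 1 = 0 by rewrite /P1 !powR1; field.
have sqs := sq_powR s1.
have sqb (b : R -> R) (M : R) f : measurable_fun I01 b -> (forall x, I01 x -> `|b x| <= M) ->
    sq I01 f -> sq I01 (fun x => b x * f x) by move=> mb bM; exact: sq_bdM mb bM.
have mX n : measurable_fun I01 (fun x : R => x ^+ n).
  exact: exprn_measurable.
have sqP : sq I01 P.
  have -> : P = fun x => (1 - x ^+ 2) ^+ 2 * x `^ s by apply/funext => x; rewrite mulrC.
  apply: (sqb _ 1) => //.
    by apply: measurable_funX; apply: measurable_funB.
  move=> x /=; rewrite in_itv/= => /andP[x0 x1].
  have h1 : 0 <= x ^+ 2 <= 1 by rewrite sqr_ge0 expr_le1// ltW.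
  by rewrite ger0_norm ?sqr_ge0// expr_le1//; lra.
have sqH : sq I01 (fun x => V x * P x - P2 x).
  have sA : sq I01 (fun x => (k%:~R ^+ 2 * x `^ (2 * alpha)) * P x).
    apply: (sqb _ (k%:~R ^+ 2)) => //.
      by apply: measurable_funM => //; apply: measurable_funTS; exact: measurable_powR.
    move=> x /=; rewrite in_itv/= => /andP[x0 x1].
    rewrite ger0_norm ?(mulr_ge0 (sqr_ge0 _) (powR_ge0 _ _))//.
    by rewrite ler_piMr ?sqr_ge0// powR_le1// mulr_ge0.
  (* Coefficients of x^s and x^(s+2) in - P'' + alpha (2 + alpha) / (4 x^2) P, once the terms in
     x^(s-2) have cancelled. *)
  pose c0 := 2 * (s + 2) * (s + 1) - 2 * (s * (s - 1)).
  pose c2 := s * (s - 1) - (s + 4) * (s + 3).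
  have sB : sq I01 (fun x => (c0 + c2 * x ^+ 2) * x `^ s).
    apply: (sqb _ (`|c0| + `|c2|)) => //.
      by apply: measurable_funD => //; apply: measurable_funM.
    move=> x /=; rewrite in_itv/= => /andP[x0 x1].
    rewrite (le_trans (ler_normD _ _))// lerD2l normrM ler_piMr//.
    by rewrite ger0_norm ?sqr_ge0// expr_le1// ltW.
  have [m1 i1] := sqD mI01 sA sB.
  have EE x : I01 x -> k%:~R ^+ 2 * x `^ (2 * alpha) * P x + (c0 + c2 * x ^+ 2) * x `^ s =
      V x * P x - P2 x.
    move=> /=; rewrite in_itv/= => /andP[x0 _].
    rewrite potE// -sE /P2 p2// p4// /P /c0 /c2; field.
    by rewrite gt_eqF.
  split; first by apply: eq_measurable_fun m1 => x; rewrite inE => /EE.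
  by apply: eq_intble i1 => // x Ix; rewrite EE.
set g := _ \_ _; exists ((fun x => V x * P x - P2 x) \_ I01).
have [mg sg] := sq_cut sqP; have [mh sh] := sq_cut sqH.
split => //.
  move=> x x0; have xN : x \notin I01.
    by rewrite notin_setE /= in_itv/= => /andP[xp _]; lra.
  by rewrite /g !patchE (negbTE xN).
split => //; exists g, (P1 \_ I01); split; first exact: aep_all.
split; first exact: prim_cut.
have := prim_cut pP1 P110; apply: eq_prim => x x0.
by rewrite /g !patchE; case: ifP => _; rewrite /P ?mulr0 ?subr0//; ring.
Qed.

Let near01 : \forall x \near (0 : R)^'+, 0 < x /\ x <= 1.
Proof. near=> x; split; near: x; [exact: nbhs_right_gt|exact: nbhs_right_le].
Unshelve. all: by end_near. Qed.

Let cvgi : (fun x : R => x) x @[x --> (0 : R)^'+] --> (0 : R).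
Proof. by apply: cvg_at_right_filter; exact: cvg_id. Qed.

Let cvgX : (fun x => (1 - x ^+ 2) ^+ 2) x @[x --> (0 : R)^'+] --> (1 : R).
Proof.
have h : (fun x : R => 1 - x * x) x @[x --> (0 : R)^'+] --> (1 - 0 * 0 : R).
  by apply: cvgB; [exact: cvg_cst|apply: cvgM; exact: cvgi].
have h2 : (fun x : R => (1 - x * x) * (1 - x * x)) x @[x --> (0 : R)^'+] -->
    ((1 - 0 * 0) * (1 - 0 * 0) : R) by apply: cvgM; exact: h.
rewrite mulr0 subr0 mulr1 in h2; apply: cvg_trans h2.
by apply: near_eq_cvg; apply: nearW => x; rewrite !expr2.
Qed.

(** Here x^(-p) (g - x^q) = x^(1-alpha) (x^2 - 2) on ]0,1], which tends to 0 because alpha < 1. *)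
Lemma cut_hbva_q : hbva alpha
  ((fun x => x `^ (- (alpha / 2)) * (1 - x ^+ 2) ^+ 2) \_ I01) 1 0.
Proof.
eexists; first exact: aep_all.
split.
  apply: (@cvg_trans _ ((fun x => (1 - x ^+ 2) ^+ 2) x @[x --> (0:R)^'+])); last exact: cvgX.
  apply: near_eq_cvg; near=> x.
  have [x0 x1] : 0 < x /\ x <= 1 by near: x; exact: near01.
  rewrite patchE in_I01// x1 gtr0_norm// mulrA -powR_add//.
  by rewrite subrr powRr0 mul1r.
have w0 : 0 < 1 - alpha by have := alpha_lt1; lra.
apply: (@cvg_trans _ ((fun x => x `^ (1 - alpha) * (-2 + x * x)) x @[x --> (0:R)^'+])).
  apply: near_eq_cvg; near=> x.
  have [x0 x1] : 0 < x /\ x <= 1 by near: x; exact: near01.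
  rewrite patchE in_I01// x1 gtr0_norm// mul1r.
  have -> : x `^ (1 - alpha) = x `^ (- (1 + alpha / 2)) * x `^ (- (alpha / 2)) * x ^+ 2.
    by rewrite -(powR_mulrn 2) ?(ltW x0)// -!powR_add//; congr (_ `^ _); lra.
  ring.
have h : (fun x : R => x `^ (1 - alpha) * (-2 + x * x)) x @[x --> (0 : R)^'+] -->
    (0 * (-2 + 0 * 0) : R).
  apply: cvgM; first exact: powR_cvg0.
  by apply: cvgD; [exact: cvg_cst|apply: cvgM; exact: cvgi].
by rewrite mul0r in h; exact: h.
Unshelve. all: by end_near. Qed.

Lemma cut_hbva_p : hbva alpha
  ((fun x => x `^ (1 + alpha / 2) * (1 - x ^+ 2) ^+ 2) \_ I01) 0 1.
Proof.
eexists; first exact: aep_all.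
split.
  have w0 : 0 < 1 + alpha by have := alpha_ge0; lra.
  apply: (@cvg_trans _ ((fun x => x `^ (1 + alpha) * (1 - x ^+ 2) ^+ 2) x @[x --> (0:R)^'+])).
    apply: near_eq_cvg; near=> x.
    have [x0 x1] : 0 < x /\ x <= 1 by near: x; exact: near01.
    rewrite patchE in_I01// x1 gtr0_norm// mulrA -powR_add//.
    by congr (_ `^ _ * _); lra.
  by have h := cvgM (powR_cvg0 w0) cvgX; rewrite mul0r in h; exact: h.
apply: (@cvg_trans _ ((fun x => (1 - x ^+ 2) ^+ 2) x @[x --> (0:R)^'+])); last exact: cvgX.
apply: near_eq_cvg; near=> x.
have [x0 x1] : 0 < x /\ x <= 1 by near: x; exact: near01.
rewrite patchE in_I01// x1 gtr0_norm// mul0r subr0 mulrA -powR_add//.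
by rewrite addNr powRr0 mul1r.
Unshelve. all: by end_near. Qed.

(** Vanishing on x <= 0 and measurability on the whole line allow two such functions, one of them
    reflected, to be added in [rdom_surj]. *)
Lemma hdom_surj (v0 v1 : R) : exists g h, [/\ measurable_fun setT g, measurable_fun setT h,
  forall x, x <= 0 -> g x = 0 /\ h x = 0, hdom alpha k g h & hbva alpha g v0 v1].
Proof.
have [h1 [mg1 mh1 z1 d1]] := @cut_poly (- (alpha / 2))
  ltac:(have := alpha_lt1; lra) ltac:(lra).
have [h2 [mg2 mh2 z2 d2]] := @cut_poly (1 + alpha / 2)
  ltac:(have := alpha_ge0; lra) ltac:(lra).
have b1 := cut_hbva_q; have b2 := cut_hbva_p.
set g1 := _ \_ I01 in mg1 z1 d1 b1; set g2 := _ \_ I01 in mg2 z2 d2 b2.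
(* [hdom_lin] produces c g + f; the combination - g1 + g1 serves as a zero last summand. *)
have d22 := hdom_lin v1 d2 (hdom_lin (- 1) d1 d1).
exists (fun x => v0 * g1 x + (v1 * g2 x + (-1 * g1 x + g1 x))),
  (fun x => v0 * h1 x + (v1 * h2 x + (-1 * h1 x + h1 x))); split.
- by apply: measurable_funD; [|apply: measurable_funD; [|apply: measurable_funD => //]];
    apply: measurable_funM.
- by apply: measurable_funD; [|apply: measurable_funD; [|apply: measurable_funD => //]];
    apply: measurable_funM.
- by move=> x x0; have [-> ->] := z1 x x0; have [-> ->] := z2 x x0; rewrite !mulr0 !addr0.
- exact: hdom_lin.
- have := hbva_lin v0 b1 (hbva_lin v1 b2 (hbva_lin (-1) b1 b1)).
  by congr hbva; ring.
Qed.

End Surjectivity.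

(** * From the half-line to the line *)

Section Reflection.
Variable R : realType.
Local Notation mu := (@lebesgue_measure R).
Local Notation Rp := (`](0 : R), +oo[%classic : set R).
Implicit Types (f g h l F G u : R -> R) (x y z t c s e N : R).

Definition refl f x := f (- x).

Lemma measurable_refl f : measurable_fun setT f -> measurable_fun setT (refl f).
Proof. by move=> mf; apply: (measurableT_comp mf); exact: oppr_measurable. Qed.

Let mN : @measurable_fun _ _ (measurableTypeR R) (measurableTypeR R) setT -%R.
Proof. exact: (@oppr_measurable R setT). Qed.

Lemma intble_refl f : intble setT f -> intble setT (refl f) /\
  \int[mu]_x f x = \int[mu]_x refl f x.
Proof.
move=> If; have mf := intble_measurable measurableT If.
have mT : @measurable _ (measurableTypeR R) setT by exact: measurableT.
have mr := measurable_refl mf.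
have mfE : @measurable_fun _ _ (measurableTypeR R) _ setT (EFin \o f).
  exact/measurable_EFinP.
have muN (g : measurableTypeR R -> \bar R) :
    (\int[pushforward mu (-%R : measurableTypeR R -> measurableTypeR R)]_x g x = \int[mu]_x g x)%E.
  by apply: eq_measure_integral => A mA _; exact: lebesgue_measureN.
have Ir : intble setT (refl f).
  apply/integrableP; split; first exact/measurable_EFinP.
  case/integrableP : If => _; rewrite -muN ge0_integral_pushforward//.
  exact: measurableT_comp.
split => //.
by rewrite /Rintegral -[in LHS]muN integral_pushforward.
Qed.

Lemma Rint_split f : intble setT f ->
  \int[mu]_x f x = \int[mu]_(x in Rp) f x + \int[mu]_(x in Rp) refl f x.
Proof.
move=> If; have [Ir _] := intble_refl If.
have m1 : measurable `]-oo, (0 : R)] by exact: measurable_itv.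
have m2 : measurable Rp by exact: measurable_itv.
have m3 : measurable `[(0 : R), +oo[ by exact: measurable_itv.
have := @Rint_setD R `]-oo, (0 : R)] setT f m1 measurableT (@subsetT _ _) If.
have -> : setT `\` `]-oo, (0 : R)] = Rp.
  by apply/seteqP; split => x /=; rewrite !in_itv/= andbT;
    [move=> [_ /negP]; rewrite -ltNge|move=> x0; split => //; apply/negP; rewrite -ltNge].
have -> : \int[mu]_(x in `]-oo, (0 : R)]) f x = \int[mu]_(x in Rp) refl f x.
  rewrite Rintegral_mkcond (intble_refl _).2; last first.
    apply: (@intble_supp _ `]-oo, (0 : R)]) => //.
      by move=> x _ Ax; rewrite patchE memNset.
    apply: (@eq_intble _ _ f) => //; first by move=> x Ax; rewrite patchE mem_set.
    exact: intbleS If.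
  rewrite Rintegral_itv_obnd_cbnd; last exact: intbleS Ir.
  rewrite [RHS]Rintegral_mkcond; apply: eq_Rint => x _.
  rewrite /refl !patchE.
  have -> // : (- x \in (`]-oo, (0 : R)]%classic : set R)) = (x \in (`[(0 : R), +oo[%classic : set R)).
  by apply/idP/idP; rewrite !inE/= !in_itv/= andbT oppr_le0.
by move=> <-; rewrite subrK.
Qed.

Lemma intble_split f : measurable_fun setT f -> intble Rp f -> intble Rp (refl f) ->
  intble setT f.
Proof.
move=> mf I1 I2.
have m2 : measurable Rp by exact: measurable_itv.
have J g : intble Rp g -> intble setT (g \_ Rp).
  move=> Ig; apply: (@intble_supp _ Rp) => //.
    by move=> x _ Ax; rewrite patchE memNset.
  by apply: eq_intble Ig => // x Ax; rewrite patchE mem_set.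
have [J2 _] := intble_refl (J _ I2).
(* The cut-offs to the two open half-lines miss the point 0; a multiple of its indicator restores
   equality with [f] everywhere. *)
have I0 : intble setT (fun x => f 0 * \1_[set 0 : R] x).
  apply: intbleZ => //; have := @integrable_indic_itv R 0 0 true false.
  by rewrite set_itv1.
have I := intbleD measurableT (intbleD measurableT (J _ I1) J2) I0.
have inRp y : (y \in Rp) = (0 < y).
  by apply/idP/idP; rewrite inE/= in_itv/= andbT.
have in0 y : (y \in [set (0 : R)]) = (y == 0) by apply/idP/eqP; rewrite inE.
apply: eq_intble I => // x _; rewrite /refl !patchE indicE !inRp in0 oppr_gt0.
by case: ltgtP => [x0|x0|->] /=; rewrite ?opprK ?mulr0 ?mulr1 ?addr0 ?add0r.
Qed.

Lemma sq_refl f : sq setT f -> sq setT (refl f).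
Proof.
by move=> [mf If]; split; [exact: measurable_refl|have [] := intble_refl If].
Qed.

Lemma sq_split f : measurable_fun setT f -> sq Rp f -> sq Rp (refl f) -> sq setT f.
Proof.
move=> mf [_ I1] [_ I2]; split => //; apply: intble_split => //.
exact: measurable_funX.
Qed.

Lemma sqT_Rp f : sq setT f -> sq Rp f.
Proof. by apply: sqS => //; exact: measurable_itv. Qed.

Lemma is_derive_refl u x a : is_derive (- x) 1 u a -> is_derive x 1 (refl u) (- a).
Proof.
by move=> du; apply: (@is_derive_val _ _ _ (a * -1)); rewrite mulrN1.
Qed.

Lemma smooth_refl u : smooth u -> smooth (refl u).
Proof.
move=> su; have := @smooth_affine R u (-1) 0 su.
by congr smooth; apply/funext => x; rewrite mulN1r addr0.
Qed.

Lemma derive1_refl u : smooth u -> (refl u)^`()%classic = fun x => - refl u^`()%classic x.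
Proof.
by move=> su; apply: derive1_fun => x; apply: is_derive_refl; exact: smooth_is_derive.
Qed.

Lemma derive2_refl u : smooth u -> (refl u)^`(2)%classic = refl u^`(2)%classic.
Proof.
move=> su; rewrite [in LHS]derive1nS [in RHS]derive1nS !derive1n1 derive1_refl//.
apply: derive1_fun => x.
have := is_derive_scale (-1) (is_derive_refl (smooth_is_derive (- x) (smooth_derive1 su))).
rewrite mulN1r opprK.
by congr is_derive; apply/funext => y; rewrite mulN1r.
Qed.

Definition test_real u := smooth u /\ supp_cpt0 u.

Lemma test_refl u : test_real u -> test_real (refl u).
Proof.
move=> [su [e [M [e0 H]]]]; split; first exact: smooth_refl.
by exists e, M; split => // x Hx; apply: H; rewrite normrN.
Qed.

Lemma test_htest u : test_real u -> htest u.
Proof.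
move=> [su [e [M [e0 H]]]]; split => //; exists e, M; split => // x x0 Hx.
by apply: H; rewrite gtr0_norm.
Qed.

Lemma ptest_test u : ptest u -> test_real u.
Proof.
move=> [su [e [M [e0 H]]]]; split => //; exists e, M; split => // x [xe|Mx].
  by apply: H; left; exact: le_lt_trans (ler_norm x) xe.
have [x0|x0] := ltP 0 x; first by apply: H; right; rewrite gtr0_norm in Mx.
by apply: H; left; exact: le_lt_trans e0.
Qed.

Lemma testD c u v : test_real u -> test_real v -> test_real (fun x => c * u x + v x).
Proof.
move=> [su [e [M [e0 H]]]] [sv [e' [M' [e'0 H']]]]; split.
  by apply: smoothD => //; exact: smoothZ.
exists (Order.min e e'), (Order.max M M'); split; first by rewrite lt_min e0.
by move=> x; rewrite lt_min gt_max => -[|] /andP[h1 h2]; rewrite H ?H' ?mulr0 ?addr0//; by [left|right].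
Qed.

Lemma test_cst0 : test_real (fun=> 0).
Proof. by split; [exact: smooth_cst|exists 1, 1; split]. Qed.

End Reflection.

(** * The maximal domain on the line, for real functions *)

Section Line.
Variable R : realType.
Local Notation mu := (@lebesgue_measure R).
Local Notation Rp := (`](0 : R), +oo[%classic : set R).
Implicit Types (f g h l F G : R -> R) (x y z t c s e N : R).
Variables (alpha : R) (k : int).
Hypothesis alpha01 : 0 <= alpha < 1.
Local Notation V := (pot alpha k).
Local Notation S := (Sreal alpha k).
Local Notation hd := (hdom alpha k).
Local Notation hb := (hbva alpha).

Let mRp : measurable Rp. Proof. exact: measurable_itv. Qed.

Lemma pot_even x : V (- x) = V x.
Proof. by rewrite /pot normrN sqrrN. Qed.

Lemma measurable_pot : measurable_fun setT V.
Proof.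
have -> : V = fun x => k%:~R ^+ 2 * `|x| `^ (2 * alpha) +
    alpha * (2 + alpha) / 4 * `|x| `^ (- 2).
  apply/funext => x; rewrite /pot invfM mulrA; congr (_ + _ * _).
  (* At 0 both sides are 0, by the default values of the inverse and of the power with nonzero
     exponent. *)
  have [->|x0] := eqVneq x 0.
    by rewrite normr0 powR0 ?expr0n ?invr0// oppr_eq0.
  rewrite powRN (powR_mulrn 2)// real_normK ?num_real//.
by apply: measurable_funD; apply: measurable_funM => //;
  apply: (measurableT_comp (measurable_powR _)); exact: normr_measurable.
Qed.

Lemma Sreal_refl u x : smooth u -> S (refl u) x = S u (- x).
Proof. by move=> su; rewrite /Sreal derive2_refl// pot_even. Qed.

Lemma smooth_measurable (u : R -> R) : smooth u -> measurable_fun setT u.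
Proof. by move=> su; apply: continuous_measurable_fun; exact: smooth_continuous. Qed.

Lemma Sreal_measurable u : smooth u -> measurable_fun setT (S u).
Proof.
move=> su; rewrite /Sreal; apply: measurable_funD.
  apply: measurableT_comp => //; apply: smooth_measurable.
  by rewrite derive1nS derive1n1; do 2 apply: smooth_derive1.
by apply: measurable_funM; [exact: measurable_pot|exact: smooth_measurable].
Qed.

Lemma test_sq u : test_real u -> sq setT u /\ sq setT (S u).
Proof.
move=> tu; have [sh1 sh2 _] := htest_hdom alpha k (test_htest tu).
have [sh3 sh4 _] := htest_hdom alpha k (test_htest (test_refl tu)).
split; apply: sq_split => //.
- exact: smooth_measurable tu.1.
- exact: Sreal_measurable tu.1.
- by move: sh4; congr sq; apply/funext => x; rewrite Sreal_refl//; exact: tu.1.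
Qed.

(* Real pairs in the graph of the adjoint of [A_alpha(k)]. *)
Definition rdom g h := [/\ sq setT g, sq setT h & forall u, test_real u ->
  \int[mu]_x (S u x * g x) = \int[mu]_x (u x * h x)].

(** A test function of (0,+oo) extended by zero is a test function of the line, and integrals
    against it live on the half-line; [weak_hsol] then gives regularity. *)
Lemma rdom_half g h : rdom g h -> hd g h.
Proof.
move=> [sg sh H]; split; [exact: sqT_Rp|exact: sqT_Rp|].
apply: weak_hsol; [exact: contp_pot|exact: sqT_Rp|exact: sqT_Rp|].
move=> u pu; have := H u (ptest_test pu).
have [e [M [e0 eM He]]] := ptest_supp pu.
have [_ [e1 [M1 [e10 He1]]]] := ptest_derive1 (ptest_derive1 pu).
have neg x : ~ Rp x -> x <= 0.
  by rewrite /= in_itv/= andbT => /negP; rewrite -leNgt.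
rewrite (@Rint_supp _ Rp setT)//; last first.
  move=> x _ /neg x0; rewrite /Sreal derive1nS derive1n1 He1; last by left; lra.
  by rewrite He ?mulr0 ?oppr0 ?addr0 ?mul0r//; left; lra.
rewrite (@Rint_supp _ Rp setT)// => x _ /neg x0.
by rewrite He ?mul0r//; left; lra.
Qed.

Lemma rdom_refl g h : rdom g h -> rdom (refl g) (refl h).
Proof.
move=> [sg sh H]; split; [exact: sq_refl|exact: sq_refl|].
move=> u tu; have tru := test_refl tu.
have [su sSu] := test_sq tu; have [sru sSru] := test_sq tru.
have [_ E1] := intble_refl (sqM measurableT sSu (sq_refl sg)).
have [_ E2] := intble_refl (sqM measurableT su (sq_refl sh)).
rewrite E1 E2.
transitivity (\int[mu]_x (S (refl u) x * g x)).
  by apply: eq_Rint => x _; rewrite /refl Sreal_refl ?opprK//; exact: tu.1.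
rewrite (H _ tru); apply: eq_Rint => x _; by rewrite /refl opprK.
Qed.

Lemma hdom_rdom g h : sq setT g -> sq setT h -> hd g h -> hd (refl g) (refl h) -> rdom g h.
Proof.
move=> sg sh d1 d2; split => // u tu; have tru := test_refl tu.
have [su sSu] := test_sq tu.
rewrite (Rint_split (sqM measurableT sSu sg)) (Rint_split (sqM measurableT su sh)).
congr (_ + _); first exact: hdom_weak (test_htest tu).
have := hdom_weak alpha01 d2 (test_htest tru); rewrite /refl => <-.
by apply: eq_Rint => x _; rewrite -Sreal_refl//; exact: tu.1.
Qed.

(** Boundary values from the left are defined through |x|, so reflection transports them without a
    sign; this is why both halves enter [rdom_green] with the same sign. *)
Definition rbv g (v0m v1m v0p v1p : R) := hb (refl g) v0m v1m /\ hb g v0p v1p.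

Lemma rdom_rbv g h : rdom g h -> exists v0m v1m v0p v1p, rbv g v0m v1m v0p v1p.
Proof.
move=> dg; have [a [b H1]] := hdom_hbva alpha01 (rdom_half (rdom_refl dg)).
have [c [d H2]] := hdom_hbva alpha01 (rdom_half dg).
by exists a, b, c, d.
Qed.

Lemma rbv_lin c g f v0 v1 v2 v3 u0 u1 u2 u3 : rbv g v0 v1 v2 v3 -> rbv f u0 u1 u2 u3 ->
  rbv (fun x => c * g x + f x) (c * v0 + u0) (c * v1 + u1) (c * v2 + u2) (c * v3 + u3).
Proof. by move=> [g1 g2] [f1 f2]; split; [exact: (hbva_lin c g1 f1)|exact: hbva_lin]. Qed.

Lemma rdom_lin c g h f l : rdom g h -> rdom f l ->
  rdom (fun x => c * g x + f x) (fun x => c * h x + l x).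
Proof.
move=> dg df; have [sg sh _] := dg; have [sf sl _] := df.
apply: hdom_rdom.
- by apply: sqD => //; exact: sqZ.
- by apply: sqD => //; exact: sqZ.
- by apply: hdom_lin; exact: rdom_half.
- by apply: (hdom_lin c); apply: rdom_half; exact: rdom_refl.
Qed.

Lemma rdom_green g h f l v0 v1 v2 v3 u0 u1 u2 u3 : rdom g h -> rdom f l ->
  rbv g v0 v1 v2 v3 -> rbv f u0 u1 u2 u3 ->
  \int[mu]_x (h x * f x) - \int[mu]_x (g x * l x) =
  (1 + alpha) * ((v1 * u0 - v0 * u1) + (v3 * u2 - v2 * u3)).
Proof.
move=> dg df [bg1 bg2] [bf1 bf2].
have [sg sh _] := dg; have [sf sl _] := df.
have I1 := sqM measurableT sh sf; have I2 := sqM measurableT sg sl.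
rewrite -RintB// Rint_split; last exact: intbleB.
rewrite (hdom_green alpha01 (rdom_half dg) (rdom_half df) bg2 bf2).
have := hdom_green alpha01 (rdom_half (rdom_refl dg)) (rdom_half (rdom_refl df)) bg1 bf1.
rewrite /refl => ->; ring.
Qed.

Lemma rdom_ge0 g h b d : rdom g h -> rbv g 0 b 0 d -> 0 <= \int[mu]_x (h x * g x).
Proof.
move=> dg [b1 b2]; have [sg sh _] := dg.
rewrite (Rint_split (sqM measurableT sh sg)) addr_ge0//.
  exact: hdom_ge0 (rdom_half dg) b2.
exact: (hdom_ge0 alpha01 (rdom_half (rdom_refl dg)) b1).
Qed.

Lemma rdom_surj v0 v1 v2 v3 : exists g h, rdom g h /\ rbv g v0 v1 v2 v3.
Proof.
have [g1 [h1 [mg1 mh1 z1 d1 b1]]] := hdom_surj k alpha01 v0 v1.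
have [g2 [h2 [mg2 mh2 z2 d2 b2]]] := hdom_surj k alpha01 v2 v3.
pose g x := refl g1 x + g2 x; pose h x := refl h1 x + h2 x.
have Ep x : 0 < x -> g x = g2 x /\ h x = h2 x.
  move=> x0; have xn : - x <= 0 by rewrite oppr_le0 ltW.
  by have [E1 E2] := z1 _ xn; rewrite /g /h /refl E1 E2 !add0r.
have En x : 0 < x -> refl g x = g1 x /\ refl h x = h1 x.
  move=> x0; have xn : - x <= 0 by rewrite oppr_le0 ltW.
  by have [E1 E2] := z2 _ xn; rewrite /g /h /refl E1 E2 !opprK !addr0.
have mg : measurable_fun setT g by apply: measurable_funD => //; exact: measurable_refl.
have mh : measurable_fun setT h by apply: measurable_funD => //; exact: measurable_refl.
have eqsq f f' : (forall x, 0 < x -> f x = f' x) -> sq Rp f' -> sq Rp f.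
  move=> E [m i]; split; last first.
    by apply: eq_intble i => // x /=; rewrite in_itv/= andbT => /E ->.
  by apply: eq_measurable_fun m => x; rewrite inE/= in_itv/= andbT => /E.
have eqd f f' l l' : (forall x, 0 < x -> f x = f' x /\ l x = l' x) -> hd f' l' -> hd f l.
  move=> E [s1 s2 [f1 [f2 [a [pf1 pf2]]]]]; split.
  - by apply: eqsq s1 => x /E[].
  - by apply: eqsq s2 => x /E[].
  - exists f1, f2; split; first by apply: aep_mono a => x /E[-> _].
    by split => //; apply: eq_prim pf2 => x /E[_ ->].
have dp := eqd g g2 h h2 Ep d2; have dn := eqd (refl g) g1 (refl h) h1 En d1.
have [sgp shp _] := dp; have [sgn shn _] := dn.
exists g, h; split.
  by apply: hdom_rdom => //; exact: sq_split.
split.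
  by apply: hbva_ae b1; apply: aep_all => x /En[].
by apply: hbva_ae b2; apply: aep_all => x /Ep[].
Qed.

Lemma test_rdom u : test_real u -> rdom u (S u) /\ rbv u 0 0 0 0.
Proof.
move=> tu; have tru := test_refl tu; have [su sSu] := test_sq tu.
split; last by split; apply: htest_hbva; exact: test_htest.
apply: hdom_rdom => //; first exact: htest_hdom (test_htest tu).
have := htest_hdom alpha k (test_htest tru).
by congr hdom; apply/funext => x; rewrite Sreal_refl//; exact: tu.1.
Qed.

End Line.

(** * The form closure of the test functions *)

Section Friedrichs.
Variable R : realType.
Local Notation mu := (@lebesgue_measure R).
Local Notation Rp := (`](0 : R), +oo[%classic : set R).
Implicit Types (f g h l F G : R -> R) (x y z t c s e M : R).
Variables (alpha : R) (k : int).
Hypothesis alpha01 : 0 <= alpha < 1.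
Local Notation S := (Sreal alpha k).
Local Notation rd := (rdom alpha k).
Local Notation rb := (rbv alpha).

Let mRp : measurable Rp. Proof. exact: measurable_itv. Qed.

Lemma derive1n2 f : f^`(2)%classic = (f^`()^`())%classic.
Proof. by rewrite derive1nS derive1n1. Qed.

Lemma Sreal_lin c (u v : R -> R) x : smooth u -> smooth v ->
  S (fun y => c * u y + v y) x = c * S u x + S v x.
Proof.
move=> su sv; rewrite /Sreal !derive1n2.
have H (a b : R -> R) : smooth a -> smooth b ->
    (fun y => c * a y + b y)^`()%classic = fun y => c * a^`()%classic y + b^`()%classic y.
  move=> sa sb; apply: derive1_fun => y; apply: is_derive_add.
    by apply: is_derive_scale; exact: smooth_is_derive.
  exact: smooth_is_derive.
by rewrite H// H; [ring|exact: smooth_derive1|exact: smooth_derive1].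
Qed.

Definition energy (u : R -> R) := \int[mu]_x (S u x * u x).

Lemma energy_half (u : R -> R) : test_real u ->
  energy u = \int[mu]_(x in Rp) (S u x * u x) +
    \int[mu]_(x in Rp) (S (refl u) x * refl u x) /\
  0 <= \int[mu]_(x in Rp) (S u x * u x) /\
  0 <= \int[mu]_(x in Rp) (S (refl u) x * refl u x).
Proof.
move=> tu; have [su sSu] := test_sq alpha k tu.
split.
  rewrite /energy (Rint_split (sqM measurableT sSu su)); congr (_ + _).
  by apply: eq_Rint => x _; rewrite /refl Sreal_refl//; exact: tu.1.
have H v : test_real v -> 0 <= \int[mu]_(x in Rp) (S v x * v x).
  move=> /test_htest tv; have := htest_energy k alpha01 tv (@ltr01 R).
  by rewrite mul1r; apply: le_trans; exact: sqr_ge0.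
by split; apply: H => //; exact: test_refl.
Qed.

Lemma energy_ge0 (u : R -> R) : test_real u -> 0 <= energy u.
Proof. by move=> /energy_half[-> [h1 h2]]; exact: addr_ge0. Qed.

Lemma test_energy (u : R -> R) x : test_real u -> u x ^+ 2 <= `|x| * energy u.
Proof.
move=> tu; have [E [h1 h2]] := energy_half tu.
have [x0|x0|->] := ltgtP x 0.
- have x0' : 0 < - x by rewrite oppr_gt0.
  have := htest_energy k alpha01 (test_htest (test_refl tu)) x0'.
  rewrite {1}/refl opprK ltr0_norm// => /le_trans; apply.
  by rewrite ler_pM2l// E lerDr.
- have := htest_energy k alpha01 (test_htest tu) x0.
  rewrite gtr0_norm// => /le_trans; apply.
  by rewrite ler_pM2l// E lerDl.
- have [_ [e [M [e0 H]]]] := tu; rewrite H; last by left; rewrite normr0.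
  by rewrite expr0n normr0 mul0r.
Qed.

Lemma Rint_eq0 A f : measurable A -> intble A f -> (forall x, A x -> 0 <= f x) ->
  \int[mu]_(x in A) f x <= 0 -> mu.-negligible [set x | A x /\ f x <> 0].
Proof.
move=> mA If f0 I0.
have mfE : @measurable_fun _ _ (measurableTypeR R) _ A (EFin \o f).
  by apply/measurable_EFinP; exact: (intble_measurable mA If).
have : (\int[mu]_(x in A) `|(EFin \o f) x| = 0)%E.
  transitivity (\int[mu]_(x in A) (EFin \o f) x)%E.
    by apply: eq_integral => x; rewrite inE => Ax /=; rewrite ger0_norm// f0.
  rewrite -[LHS]fineK; last exact: (integrable_fin_num (measurableT_R mA) If).
  congr EFin; apply/eqP; rewrite eq_le I0/=.
  by apply: Rintegral_ge0.
move/(ae_eq_integral_abs mu (measurableT_R mA) mfE) => [N [mN N0 sN]].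
exists N; split => // x /= [Ax fx]; apply: sN => /= H; apply: fx.
by have /= [] := H Ax.
Qed.

(** The excess [d] of |g| over M sqrt x is at most |phi n - g| pointwise, so its L^2 norm is 0. This
    transfers the bound without extracting an almost everywhere convergent subsequence. *)
Lemma L2lim_bound (phi : nat -> R -> R) g M n0 : sq Rp g -> (forall n, sq Rp (phi n)) ->
  (forall n x, (n0 <= n)%N -> 0 < x -> `|phi n x| <= M * Num.sqrt x) ->
  (forall e, 0 < e -> exists2 n, (n0 <= n)%N & \int[mu]_(x in Rp) ((phi n x - g x) ^+ 2) < e) ->
  aep (fun x => `|g x| <= M * Num.sqrt x).
Proof.
move=> sg sphi bd lim.
pose d x := Order.max (`|g x| - M * Num.sqrt x) 0.
have md : measurable_fun Rp d.
  apply: measurable_maxr => //; apply: measurable_funB.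
    by apply: measurableT_comp => //; exact: sg.1.
  apply: measurable_funM => //; apply: measurable_funTS.
  apply: continuous_measurable_fun; exact: sqrt_continuous.
have d0 x : 0 <= d x by rewrite /d le_max lexx orbT.
have dle n x : (n0 <= n)%N -> 0 < x -> d x ^+ 2 <= (phi n x - g x) ^+ 2.
  move=> nn x0; rewrite -[leRHS]real_normK ?num_real// ler_sqr ?nnegrE//.
  rewrite /d ge_max normr_ge0 andbT.
  have h1 := bd n x nn x0; have := ler_distD (phi n x) (g x) 0; rewrite !subr0.
  by rewrite distrC; lra.
have Isq n : intble Rp (fun x => (phi n x - g x) ^+ 2) by exact: (sqB mRp (sphi n) sg).2.
have Id : intble Rp (fun x => d x ^+ 2).
  apply: le_intble (Isq n0) => //; first exact: measurable_funX.
  move=> x /=; rewrite in_itv/= andbT => x0.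
  by rewrite ger0_norm ?sqr_ge0//; exact: dle.
have I0 : \int[mu]_(x in Rp) (d x ^+ 2) <= 0.
  apply/ler_addgt0Pl => e /lim[n nn lt]; rewrite addr0.
  apply: le_trans (ltW lt); apply: le_Rint => //.
  by move=> x /=; rewrite in_itv/= andbT => x0; exact: dle.
apply: negligibleS (Rint_eq0 mRp Id (fun x _ => sqr_ge0 _) I0) => x /= [x0 H].
split; first by rewrite in_itv/= x0.
move=> /eqP; rewrite sqrf_eq0 => /eqP d00; apply: H.
have h : `|g x| - M * Num.sqrt x <= d x by rewrite /d le_max lexx.
by rewrite d00 in h; lra.
Qed.

(** Compare with the fixed function phi N: [test_energy] bounds phi N and the difference phi n - phi
    N, whose energy is below 1. *)
Lemma cauchy_sqrt_bound (phi : nat -> R -> R) : (forall n, test_real (phi n)) ->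
  (forall e, 0 < e -> exists N, forall n m, (N <= n)%N -> (N <= m)%N ->
    energy (fun x => phi n x - phi m x) < e) ->
  exists M n0, forall n x, (n0 <= n)%N -> `|phi n x| <= M * Num.sqrt `|x|.
Proof.
move=> tphi cau; have [N HN] := cau 1 ltr01.
exists (Num.sqrt (energy (phi N)) + 1), N => n x Nn.
have tD : test_real (fun y => phi n y - phi N y).
  have := testD (-1) (tphi N) (tphi n).
  by congr test_real; apply/funext => y; rewrite mulN1r addrC.
have sqb (u : R -> R) : test_real u -> `|u x| <= Num.sqrt (energy u) * Num.sqrt `|x|.
  move=> tu; rewrite -sqrtrM ?energy_ge0// -sqrtr_sqr ler_wsqrtr// mulrC.
  exact: test_energy.
have h1 := sqb _ (tphi N); have h2 := sqb _ tD.
have h3 : Num.sqrt (energy (fun y => phi n y - phi N y)) <= 1.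
  by rewrite -[leRHS]sqrtr1 ler_wsqrtr// ltW// HN.
have h4 : `|phi n x| <= `|phi N x| + `|phi n x - phi N x|.
  by rewrite (le_trans _ (ler_normD _ _))// addrC subrK.
rewrite mulrDl mul1r (le_trans h4)// lerD// (le_trans h2)//.
by rewrite ler_piMl// sqrtr_ge0.
Qed.

Lemma form_closure_half (phi : nat -> R -> R) g M n0 v0 v1 : sq Rp g ->
  (forall n, sq setT (phi n)) -> sq setT g ->
  (forall n x, (n0 <= n)%N -> `|phi n x| <= M * Num.sqrt `|x|) ->
  (forall e, 0 < e -> exists N, forall n, (N <= n)%N -> \int[mu]_x ((phi n x - g x) ^+ 2) < e) ->
  hbva alpha g v0 v1 -> v0 = 0.
Proof.
move=> sg sphi sgT bd lim hb; apply: (hbva_bound (M := M) alpha01 hb).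
apply: (L2lim_bound (n0 := n0) sg (fun n => sqT_Rp (sphi n))) => [n x nn x0|e e0].
  by have := bd n x nn; rewrite (gtr0_norm x0).
have [N HN] := lim e e0; exists (maxn N n0); first exact: leq_maxr.
apply: le_lt_trans (HN _ (leq_maxl _ _)); apply: (Rint_subset measurableT mRp (@subsetT _ _)).
  exact: (sqB measurableT (sphi _) sgT).2.
by move=> x _; exact: sqr_ge0.
Qed.

(** [cauchy_sqrt_bound] gives |phi n x| <= M sqrt |x| uniformly in n; the bound survives in the L^2
    limit and is incompatible with a nonzero g_0. *)
Lemma rform_sub g h (phi : nat -> R -> R) v0 v1 v2 v3 : rd g h -> rb g v0 v1 v2 v3 ->
  (forall n, test_real (phi n)) ->
  (forall e, 0 < e -> exists N, forall n, (N <= n)%N -> \int[mu]_x ((phi n x - g x) ^+ 2) < e) ->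
  (forall e, 0 < e -> exists N, forall n m, (N <= n)%N -> (N <= m)%N ->
    energy (fun x => phi n x - phi m x) < e) ->
  v0 = 0 /\ v2 = 0.
Proof.
move=> dg [b1 b2] tphi lim cau.
have [M [n0 bd]] := cauchy_sqrt_bound tphi cau.
have [sg _ _] := dg.
have sphi n : sq setT (phi n) by have [] := test_sq alpha k (tphi n).
split; last by apply: (form_closure_half (sqT_Rp sg) sphi sg bd lim b2).
have sr n := sq_refl (sphi n).
apply: (form_closure_half (sqT_Rp (sq_refl sg)) sr (sq_refl sg) (n0 := n0) (M := M) _ _ b1).
  by move=> n x nn; have := bd n (- x) nn; rewrite normrN.
move=> e /lim[N HN]; exists N => n /HN; apply: le_lt_trans.
by rewrite (intble_refl (sqB measurableT (sphi n) sg).2).2.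
Qed.

End Friedrichs.

(** * Minimization of the form norm distance *)

Section FriedrichsClosure.
Variable R : realType.
Local Notation mu := (@lebesgue_measure R).
Implicit Types (f g h l F G : R -> R) (x y z t c s e M C : R).
Variables (alpha : R) (k : int).
Hypothesis alpha01 : 0 <= alpha < 1.
Local Notation S := (Sreal alpha k).
Local Notation rd := (rdom alpha k).
Local Notation rb := (rbv alpha).
Local Notation energy := (energy alpha k).
Local Notation T := (measurableTypeR R).

Lemma Rint_fatou (f_ : nat -> R -> R) F C : (forall n, intble setT (f_ n)) ->
  (forall n x, 0 <= f_ n x) -> (forall x, f_ n x @[n --> \oo] --> F x) ->
  (forall n, \int[mu]_x f_ n x <= C) ->
  intble setT F /\ \int[mu]_x F x <= C.
Proof.
move=> If f0 fF fC.
have mT : @measurable _ T setT by exact: measurableT.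
have mf n := intble_measurable measurableT (If n).
have mfE n : @measurable_fun _ _ T _ setT (fun x => (f_ n x)%:E).
  by apply/measurable_EFinP; exact: mf.
have mF : @measurable_fun _ _ T _ setT F.
  by apply: (measurable_fun_cvg (h := f_)) => [m|x _]; [exact: mf|exact: fF].
have F0 x : 0 <= F x.
  by apply: (cvgr_to_ge (fF x)); apply: nearW => n; exact: f0.
have H : (\int[mu]_x (F x)%:E <= C%:E)%E.
  have := fatou mu mT mfE (fun n x _ => f0 n x).
  have -> : (fun x : T => limn_einf (fun n => (f_ n x)%:E)) = (fun x => (F x)%:E).
    apply/funext => x.
    have cE : (f_ n x)%:E @[n --> \oo] --> (F x)%:E by apply: cvg_EFin; [exact: nearW|exact: fF].
    by have [-> _] := cvg_limn_einf_sup cE.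
  move=> /le_trans; apply.
  rewrite limn_einf_lim; apply: lime_le; first exact: is_cvg_einfs.
  apply: nearW => n.
  apply: (@le_trans _ _ (\int[mu]_x (f_ n x)%:E)%E).
    by apply: ereal_inf_lbound; exists n => //=.
  rewrite -[leLHS]fineK ?lee_fin; first exact: fC.
  exact: (integrable_fin_num mT (If n)).
have IF : intble setT F.
  apply/integrableP; split; first exact/measurable_EFinP.
  apply: le_lt_trans (ltry C).
  by under eq_integral => x _ do rewrite /= ger0_norm//.
split => //; rewrite -lee_fin fineK//; exact: (integrable_fin_num mT IF).
Qed.

Lemma archi C e : 0 < e -> exists N, forall n, (N <= n)%N -> C / n.+1%:R < e.
Proof.
move=> e0; exists (Num.truncn (C / e)) => n Nn.
rewrite ltr_pdivrMr// mulrC -ltr_pdivrMr//.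
by apply: (lt_le_trans (truncnS_gt _)); rewrite ler_nat.
Qed.

Section Minimizer.
Variables (g h : R -> R) (b d : R).
Hypotheses (dg : rd g h) (bg : rb g 0 b 0 d).

(* [q u] is the squared form norm of [g - u], written through the operator so
   that it makes sense for [g]. *)
Let Q f l := \int[mu]_x ((l x + f x) * f x).
Let a (u : R -> R) x := -1 * u x + g x.
Let la (u : R -> R) x := -1 * S u x + h x.
Let q (u : R -> R) := Q (a u) (la u).

Let a_rdom (u : R -> R) : test_real u -> rd (a u) (la u) /\ rb (a u) 0 b 0 d.
Proof.
move=> tu; have [du bu] := test_rdom k alpha01 tu.
split; first exact: rdom_lin.
have := rbv_lin (-1) bu bg; rewrite !mulr0 !add0r; exact.
Qed.

Let Qint f l : sq setT f -> sq setT l -> intble setT (fun x => (l x + f x) * f x).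
Proof. by move=> sf sl; apply: sqM => //; exact: sqD. Qed.

Let a_sq (u : R -> R) : test_real u -> sq setT (a u) /\ sq setT (la u).
Proof. by move=> /a_rdom[[]]. Qed.

Let q_ge0 (u : R -> R) : test_real u -> 0 <= q u.
Proof.
move=> tu; have [du bu] := a_rdom tu; have [sa sl] := a_sq tu.
rewrite /q /Q (@eq_Rint _ _ _ (fun x => la u x * a u x + a u x * a u x)); last first.
  by move=> x _; rewrite mulrDl.
rewrite RintD//; [|exact: sqM|exact: sqM]; rewrite addr_ge0//.
  exact: rdom_ge0 du bu.
by apply: Rintegral_ge0 => x _; rewrite -expr2 sqr_ge0.
Qed.

Let A := [set r | exists2 u, test_real u & r = q u].
Let hA : has_inf A.
Proof.
split; first by exists (q (fun=> 0)), (fun=> 0) => //; exact: test_cst0.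
by exists 0 => _ [u tu ->]; exact: q_ge0.
Qed.
Let dmin := inf A.

Let dmin_le (u : R -> R) : test_real u -> dmin <= q u.
Proof. by move=> tu; apply: ge_inf; [exact: hA.2|exists u]. Qed.

(** Parallelogram law for g - u and g - v: the midpoint [m] of u and v is again a test function, so
    q m >= dmin. It makes a minimizing sequence Cauchy for the form norm. *)
Let parallelogram (u v : R -> R) : test_real u -> test_real v ->
  Q (fun x => -1 * v x + u x) (S (fun x => -1 * v x + u x)) <= 2 * q u + 2 * q v - 4 * dmin.
Proof.
move=> tu tv; set D := fun x => -1 * v x + u x.
have tD : test_real D by exact: testD.
set m := fun x => 2^-1 * D x + v x.
have tm : test_real m by exact: testD.
have [sau slu] := a_sq tu; have [sav slv] := a_sq tv; have [sam slm] := a_sq tm.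
have [sD sSD] := test_sq alpha k tD.
have E : Q D (S D) + 4 * q m = 2 * q u + 2 * q v.
  rewrite /q /Q -!RintZ//; try exact: Qint.
  rewrite -!RintD//; try exact: Qint; try (by apply: intbleZ => //; exact: Qint).
  apply: eq_Rint => x _.
  have SD : S D x = -1 * S v x + S u x by rewrite /D Sreal_lin//; [exact: tv.1|exact: tu.1].
  have Sm : S m x = 2^-1 * S D x + S v x by rewrite /m Sreal_lin//; [exact: tD.1|exact: tv.1].
  by rewrite /la /a Sm SD /m /D; field.
by have := dmin_le tm; lra.
Qed.

Let phi_ex n : exists u, test_real u /\ q u < dmin + n.+1%:R^-1.
Proof.
have [|_ [u tu ->] lt] := @inf_adherent _ A (n.+1%:R^-1) _ hA; first by rewrite invr_gt0.
by exists u.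
Qed.

Let phi n := sval (cid (phi_ex n)).
Let phi_test n : test_real (phi n). Proof. by rewrite /phi; case: cid => u []. Qed.
Let phi_q n : q (phi n) < dmin + n.+1%:R^-1. Proof. by rewrite /phi; case: cid => u []. Qed.

Let diff n m x := -1 * phi m x + phi n x.
Let diff_test n m : test_real (diff n m). Proof. exact: testD. Qed.

Let invS_le n m : (n <= m)%N -> m.+1%:R^-1 <= n.+1%:R^-1 :> R.
Proof. by move=> nm; rewrite lef_pV2 ?posrE// ler_nat. Qed.

Let diff_Q n m N : (N <= n)%N -> (N <= m)%N -> Q (diff n m) (S (diff n m)) <= 4 / N.+1%:R.
Proof.
move=> Nn Nm; apply: (le_trans (parallelogram (phi_test n) (phi_test m))).
have h1 := phi_q n; have h2 := phi_q m; have h3 := invS_le Nn; have h4 := invS_le Nm.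
move: h1 h2 h3 h4; move: (N.+1%:R^-1) (n.+1%:R^-1) (m.+1%:R^-1) => X Y Z ? ? ? ?; lra.
Qed.

Let QE n m : Q (diff n m) (S (diff n m)) = energy (diff n m) + \int[mu]_x (diff n m x ^+ 2).
Proof.
have [sD sSD] := test_sq alpha k (diff_test n m).
rewrite /energy -RintD//; [|exact: sqM|exact: sD.2].
by apply: eq_Rint => x _; rewrite mulrDl expr2.
Qed.

Let diff_energy n m N : (N <= n)%N -> (N <= m)%N -> energy (diff n m) <= 4 / N.+1%:R.
Proof.
move=> Nn Nm; apply: le_trans (diff_Q Nn Nm); rewrite QE lerDl.
by apply: Rintegral_ge0 => x _; exact: sqr_ge0.
Qed.

Let diff_sq n m N : (N <= n)%N -> (N <= m)%N -> \int[mu]_x (diff n m x ^+ 2) <= 4 / N.+1%:R.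
Proof.
by move=> Nn Nm; apply: le_trans (diff_Q Nn Nm); rewrite QE lerDr energy_ge0.
Qed.

(** [test_energy] turns smallness of the energy of differences into a Cauchy condition at every
    point, so the limit exists everywhere and not merely almost everywhere. *)
Let phi_cvg x : cvg (phi n x @[n --> \oo]).
Proof.
apply/cauchy_cvgP; apply: cauchy_exP => e e0.
have e20 : 0 < e ^+ 2 by rewrite exprn_gt0.
have [N HN] := archi (`|x| * 4) e20.
exists (phi N x); exists N => // n /= Nn; rewrite /ball/=.
have -> : phi N x - phi n x = diff N n x by rewrite /diff mulN1r addrC.
rewrite -ltr_sqr ?nnegrE ?(ltW e0)// real_normK ?num_real//.
apply: le_lt_trans (HN N (leqnn N)); apply: (le_trans (test_energy k alpha01 x (diff_test _ _))).
by rewrite -mulrA ler_wpM2l// diff_energy.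
Qed.

Let P x : R := lim (phi n x @[n --> \oo]).

Let sphi n : sq setT (phi n). Proof. by have [] := test_sq alpha k (phi_test n). Qed.

(** Fatou's lemma applied to the squares of phi n - phi (m + n) as m grows, with n fixed. *)
Let phiP n : sq setT (fun x => phi n x - P x) /\
  \int[mu]_x ((phi n x - P x) ^+ 2) <= 4 / n.+1%:R.
Proof.
have H := @Rint_fatou (fun m x => diff n (m + n)%N x ^+ 2) (fun x => (phi n x - P x) ^+ 2)
  (4 / n.+1%:R).
have [] := H.
- by move=> m; have [[]] := test_sq alpha k (diff_test n (m + n)).
- by move=> m x; exact: sqr_ge0.
- move=> x.
  have c1 : phi (m + n)%N x @[m --> \oo] --> P x.
    apply: (cvg_comp (fun m => (m + n)%N) (phi^~ x) (cvg_addnr n)); exact: phi_cvg.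
  have c2 : (fun m => phi n x - phi (m + n)%N x) m @[m --> \oo] --> phi n x - P x.
    by apply: cvgB; [exact: cvg_cst|exact: c1].
  have c3 : (fun m => (phi n x - phi (m + n)%N x) * (phi n x - phi (m + n)%N x)) m
      @[m --> \oo] --> (phi n x - P x) * (phi n x - P x) by apply: cvgM; exact: c2.
  rewrite expr2; apply: cvg_trans c3; apply: near_eq_cvg; apply: nearW => m.
  by rewrite /diff expr2 mulN1r addrC.
- by move=> m; apply: diff_sq => //; exact: leq_addl.
move=> I1 I2; split => //; split => //.
apply: measurable_funB; first exact: (sphi n).1.
apply: (measurable_fun_cvg (h := phi)) => [m|x _]; first exact: (sphi m).1.
exact: phi_cvg.
Qed.

Let sP : sq setT P.
Proof.
have := sqB measurableT (sphi 0) (phiP 0).1.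
by congr sq; apply/funext => x; rewrite subKr.
Qed.

Let sg : sq setT g. Proof. by case: dg. Qed.
Let sh : sq setT h. Proof. by case: dg. Qed.

Let N x := g x - P x.
Let sN : sq setT N. Proof. exact: sqB. Qed.

(* First variation of [q] at [phi n] in the direction [eta]. *)
Let variation n (eta : R -> R) s : test_real eta ->
  2 * s * \int[mu]_x ((S eta x + eta x) * a (phi n) x) <=
  s ^+ 2 * Q eta (S eta) + n.+1%:R^-1.
Proof.
move=> te; have tn := phi_test n.
have tm : test_real (fun x => s * eta x + phi n x) by exact: testD.
have [sau slu] := a_sq tn; have [sam slm] := a_sq tm.
have [se sSe] := test_sq alpha k te.
have [[_ _ wk] _] := a_rdom tn.
have sz := sqD measurableT sSe se.
have I1 := sqM measurableT sz sau.
have I2 := sqM measurableT (sqD measurableT slu sau) se.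
(* Symmetry of the form: the weak equation for g - phi n moves S onto [eta]. *)
have W : \int[mu]_x ((la (phi n) x + a (phi n) x) * eta x) =
    \int[mu]_x ((S eta x + eta x) * a (phi n) x).
  transitivity (\int[mu]_x (eta x * la (phi n) x) + \int[mu]_x (eta x * a (phi n) x)).
    rewrite -RintD//; [|exact: sqM|exact: sqM].
    by apply: eq_Rint => x _; ring.
  rewrite -wk// -RintD//; [|exact: sqM|exact: sqM].
  by apply: eq_Rint => x _; ring.
have E : q (fun x => s * eta x + phi n x) = q (phi n) -
    2 * s * \int[mu]_x ((S eta x + eta x) * a (phi n) x) + s ^+ 2 * Q eta (S eta).
  have -> : 2 * s * \int[mu]_x ((S eta x + eta x) * a (phi n) x) =
      s * \int[mu]_x ((S eta x + eta x) * a (phi n) x) +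
      s * \int[mu]_x ((la (phi n) x + a (phi n) x) * eta x) by rewrite W; ring.
  rewrite /q /Q -!RintZ//; last exact: Qint.
  have J1 := intbleZ s measurableT I1; have J2 := intbleZ s measurableT I2.
  have J3 := Qint sau slu; have J4 := intbleZ (s ^+ 2) measurableT (Qint se sSe).
  rewrite -RintD// -RintB//; last exact: intbleD.
  rewrite -RintD//; last by apply: intbleB => //; exact: intbleD.
  apply: eq_Rint => x _.
  have Sm : S (fun y => s * eta y + phi n y) x = s * S eta x + S (phi n) x.
    by rewrite Sreal_lin//; [exact: te.1|exact: tn.1].
  by rewrite /la /a Sm; ring.
have h1 := dmin_le tm; have h2 := phi_q n; rewrite E in h1.
move: h1 h2; move: (n.+1%:R^-1) (q (phi n)) dmin (2 * s * _) (s ^+ 2 * _) => X Y Z U W' ? ?; lra.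
Qed.

(** [P] is only a limit of test functions, so the first variation is available at phi n alone. The
    estimate 2 s <z, phi n - P> <= s^2 |z|^2 + |phi n - P|^2 with z = (S + 1) eta passes to the
    limit, and the resulting bound 2 s X <= s^2 K for all s forces X = 0. *)
Let N_weak (eta : R -> R) : test_real eta ->
  \int[mu]_x ((S eta x + eta x) * N x) = 0.
Proof.
move=> te; have [se sSe] := test_sq alpha k te.
have sz := sqD measurableT sSe se.
set X := (\int[mu]_x ((S eta x + eta x) * N x))%R.
pose Z := \int[mu]_x ((S eta x + eta x) ^+ 2).
have Z0 : 0 <= Z by apply: Rintegral_ge0 => x _; exact: sqr_ge0.
(* The 5 collects 1 from [variation] and 4 from [phiP]. *)
have key s n : 2 * s * X <= s ^+ 2 * (Q eta (S eta) + Z) + 5 / n.+1%:R.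
  have [sau _] := a_sq (phi_test n); have [sp Hp] := phiP n.
  have E : \int[mu]_x ((S eta x + eta x) * (phi n x - P x)) =
      X - \int[mu]_x ((S eta x + eta x) * a (phi n) x).
    rewrite /X -RintB//; [|exact: sqM|exact: sqM].
    by apply: eq_Rint => x _; rewrite /N /a; ring.
  have : \int[mu]_x ((2 * s) * ((S eta x + eta x) * (phi n x - P x))) <=
      \int[mu]_x (s ^+ 2 * (S eta x + eta x) ^+ 2 + (phi n x - P x) ^+ 2).
    apply: le_Rint => //.
    - by apply: intbleZ => //; exact: sqM.
    - by apply: intbleD => //; [apply: intbleZ => //; exact: sz.2|exact: sp.2].
    - move=> x _; have := sqr_ge0 (s * (S eta x + eta x) - (phi n x - P x)).
      by rewrite !expr2; nra.
  rewrite RintD//; [|by apply: intbleZ => //; exact: sz.2|exact: sp.2].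
  rewrite !RintZ//; [|exact: sz.2|exact: sqM].
  rewrite E -/Z => H; have := variation n s te; move: H Hp.
rewrite !mulrBr !mulrDr.
move: (n.+1%:R^-1) (Q eta _) (\int[mu]_x ((S eta x + eta x) * a (phi n) x))%R (\int[mu]_x _)%R => Y W I J ? ? ?; lra.
set K := Q eta (S eta) + Z in key.
have key' s : 2 * s * X <= s ^+ 2 * K.
  apply/ler_addgt0Pl => e /(archi 5)[n Hn].
  have h1 := key s n; have h2 := Hn n (leqnn n); move: h1 h2; move: (5 / n.+1%:R) (2 * s * X) (s ^+ 2 * K) => Y U W ? ?; lra.
have K0 : 0 <= K.
  have h1 := key' 1; have h2 := key' (-1); rewrite sqrrN expr1n in h2.
  rewrite expr1n in h1; lra.
(* Dividing by K + 1 instead of K covers the case K = 0. *)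
have := key' (X / (K + 1)).
have K1 : 0 < K + 1 by lra.
have -> : 2 * (X / (K + 1)) * X = 2 * (X ^+ 2 / (K + 1)).
  by rewrite expr2; field; rewrite gt_eqF.
have -> : (X / (K + 1)) ^+ 2 * K = (X ^+ 2 / (K + 1)) * (K / (K + 1)).
  by field; rewrite gt_eqF.
have h0 : 0 <= X ^+ 2 / (K + 1) by rewrite divr_ge0 ?sqr_ge0// ltW.
have h1 : K / (K + 1) <= 1 by rewrite ler_pdivrMr//; lra.
have := ler_wpM2l h0 h1; set Y := X ^+ 2 / (K + 1) in h0 *; move=> h2 h3.
have Y0 : Y = 0 by lra.
move/eqP: Y0; rewrite /Y mulf_eq0 invr_eq0 (gt_eqF K1) orbF sqrf_eq0.
by move/eqP.
Qed.

Let N_rdom : rd N (fun x => - N x).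
Proof.
split => //.
  have := sqZ (-1) measurableT sN; congr sq; apply/funext => x; exact: mulN1r.
move=> u tu; have [su sSu] := test_sq alpha k tu.
have := N_weak tu.
rewrite (@eq_Rint _ _ _ (fun x => S u x * N x + u x * N x)); last by move=> x _; rewrite mulrDl.
rewrite RintD//; [|exact: sqM|exact: sqM] => H.
rewrite (@eq_Rint _ _ (fun x => u x * - N x) (fun x => - (u x * N x))); last first.
  by move=> x _; rewrite mulrN.
by rewrite RintN//; [lra|exact: sqM].
Qed.

Let phi_cauchy e : 0 < e -> exists N0, forall n m, (N0 <= n)%N -> (N0 <= m)%N ->
  energy (fun x => phi n x - phi m x) < e.
Proof.
move=> e0; have [N0 HN] := archi 4 e0; exists N0 => n m Nn Nm.
have -> : (fun x => phi n x - phi m x) = diff n m.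
  by apply/funext => x; rewrite /diff mulN1r addrC.
exact: le_lt_trans (diff_energy Nn Nm) (HN N0 (leqnn _)).
Qed.

Let phiP_lim e : 0 < e -> exists N0, forall n, (N0 <= n)%N ->
  \int[mu]_x ((phi n x - P x) ^+ 2) < e.
Proof.
move=> e0; have [N0 HN] := archi 4 e0; exists N0 => n Nn.
exact: le_lt_trans (phiP n).2 (HN n Nn).
Qed.

(** Since N is in the domain of the adjoint, so is P = g - N; as P is a form limit of the phi n,
    [rform_sub] gives P_0 = 0, hence N_0 = g_0 - P_0 = 0. *)
Let N_bv : exists b1 b3, rb N 0 b1 0 b3.
Proof.
have dP : rd P (fun x => -1 * - N x + h x).
  have := rdom_lin alpha01 (-1) N_rdom dg; congr rdom; apply/funext => x.
  by rewrite /N; ring.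
have [p0 [p1 [p2 [p3 bP]]]] := rdom_rbv alpha01 dP.
have [p00 p20] := rform_sub alpha01 dP bP phi_test phiP_lim phi_cauchy.
have := rbv_lin (-1) bP bg; rewrite p00 p20 !mulr0 !addr0 => H.
exists (-1 * p1 + b), (-1 * p3 + d).
by move: H; congr rbv; apply/funext => x; rewrite /N mulN1r addrC.
Qed.

(** Positivity applied to S N = - N gives - |N|^2 >= 0, so P = g almost everywhere and the
    minimizing sequence itself converges to g. *)
Lemma rform_sup_aux : exists phi : nat -> R -> R, [/\ forall n, test_real (phi n),
  forall e, 0 < e -> exists N0, forall n, (N0 <= n)%N -> \int[mu]_x ((phi n x - g x) ^+ 2) < e &
  forall e, 0 < e -> exists N0, forall n m, (N0 <= n)%N -> (N0 <= m)%N ->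
    energy (fun x => phi n x - phi m x) < e].
Proof.
exists phi; split; [exact: phi_test| |exact: phi_cauchy].
move=> e e0; have [b1 [b3 bN]] := N_bv.
have N20 : \int[mu]_x (N x ^+ 2) <= 0.
  have := rdom_ge0 alpha01 N_rdom bN.
  rewrite (@eq_Rint _ _ _ (fun x => - (N x ^+ 2))); last by move=> x _; rewrite expr2 mulNr.
  by rewrite RintN//; [lra|exact: sN.2].
have e20 : 0 < e / 2 by lra.
have [N0 HN] := phiP_lim e20; exists N0 => n /HN H.
have [sp _] := phiP n.
have : \int[mu]_x ((phi n x - g x) ^+ 2) <=
    \int[mu]_x (2 * (phi n x - P x) ^+ 2 + 2 * N x ^+ 2).
  apply: le_Rint => //.
  - exact: (sqB measurableT (sphi n) sg).2.
  - by apply: intbleD => //; apply: intbleZ => //; [exact: sp.2|exact: sN.2].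
  - move=> x _; have := sqr_ge0 ((phi n x - P x) + N x).
    by rewrite /N !expr2; nra.
rewrite RintD//; [|by apply: intbleZ => //; exact: sp.2|by apply: intbleZ => //; exact: sN.2].
rewrite !RintZ//; [lra|exact: sN.2|exact: sp.2].
Qed.

End Minimizer.

End FriedrichsClosure.

(** * Complex-valued functions *)

Section ComplexLine.
Variable R : realType.
Local Notation C := (R[i]).
Local Notation mu := (@lebesgue_measure R).
Variables (alpha : R) (k : int).
Hypothesis alpha01 : 0 <= alpha < 1.
Local Notation S := (Sreal alpha k).
Local Notation ReC := complex.Re.
Local Notation ImC := complex.Im.
Implicit Types (f g h : R -> C).

Lemma complexP (z w : C) : ReC z = ReC w -> ImC z = ImC w -> z = w.
Proof. by case: z w => a b [c d] /= -> ->. Qed.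

Lemma L2E f : L2 f <-> sq setT (reF f) /\ sq setT (imF f).
Proof.
split=> [[mr [mi lt]]|[[mr Ir] [mi Ii]]].
- have H (a b : R -> R) : measurable_fun setT a -> measurable_fun setT b ->
      (\int[mu]_x (a x ^+ 2 + b x ^+ 2)%:E < +oo)%E -> sq setT a.
    move=> ma mb ltab; split => //.
    have mab : measurable_fun setT (fun x => a x ^+ 2 + b x ^+ 2).
      by apply: measurable_funD; exact: measurable_funX.
    apply: (@le_intble _ _ _ (fun x => a x ^+ 2 + b x ^+ 2)) => //.
    + exact: measurable_funX.
    + by move=> x _; rewrite ger0_norm ?sqr_ge0// lerDl sqr_ge0.
    + apply/integrableP; split.
        apply/measurable_EFinP; exact: mab.
      apply: le_lt_trans ltab; rewrite le_eqVlt; apply/orP; left; apply/eqP.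
      by apply: eq_integral => x _ /=; rewrite ger0_norm ?addr_ge0 ?sqr_ge0.
  split; first exact: H lt.
  apply: (H _ _ mi mr); move: lt; congr (_ < _)%E.
  by apply: eq_integral => x _; rewrite addrC.
- split => //; split => //.
  have /integrableP[_] := intbleD measurableT Ir Ii.
  congr (_ < _)%E; apply: eq_integral => x _ /=.
  by rewrite ger0_norm ?addr_ge0 ?sqr_ge0.
Qed.

Lemma ipE f g : L2 f -> L2 g -> ip f g =
  Complex (\int[mu]_x (reF f x * reF g x) + \int[mu]_x (imF f x * imF g x))
          (\int[mu]_x (imF f x * reF g x) - \int[mu]_x (reF f x * imF g x)).
Proof.
move=> /L2E[fr fi] /L2E[gr gi].
rewrite -RintD//; [|exact: sqM|exact: sqM].
rewrite -RintB//; [|exact: sqM|exact: sqM].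
rewrite /ip (@eq_Rint _ _ _ (fun x => reF f x * reF g x + imF f x * imF g x)); last first.
  by move=> x _; rewrite /reF /imF; case: (f x) (g x) => a b [c d] /=; ring.
rewrite [X in _ + _ * cR X](@eq_Rint _ _ _ (fun x => imF f x * reF g x - reF f x * imF g x));
    last first.
  by move=> x _; rewrite /reF /imF; case: (f x) (g x) => a b [c d] /=; ring.
by apply: complexP => /=; ring.
Qed.

Lemma test_funE f : test_fun f <-> test_real (reF f) /\ test_real (imF f).
Proof.
split=> [[u [v [su [sv [hu [hv ->]]]]]]|[[su hu] [sv hv]]].
  by split; split; [exact: su|exact: hu|exact: sv|exact: hv].
exists (reF f), (imF f); do 4 split => //.
by apply/funext => x; rewrite /reF /imF; case: (f x).
Qed.

Lemma SopE f : (reF (Sop alpha k f) = S (reF f)) * (imF (Sop alpha k f) = S (imF f)).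
Proof. by []. Qed.

Lemma test_L2 f : test_fun f -> L2 f /\ L2 (Sop alpha k f).
Proof.
move=> /test_funE[/(test_sq alpha k)[s1 s2] /(test_sq alpha k)[s3 s4]].
by split; apply/L2E.
Qed.

Lemma Sreal_cst0 : S (fun=> 0) = fun=> 0.
Proof.
have e0 : (fun y => -1 * (fun=> 0) y + (fun=> 0) y) = (fun=> 0) :> (R -> R).
  by apply/funext => y; rewrite mulr0 addr0.
apply/funext => x.
have := Sreal_lin alpha k (-1) x (@smooth_cst R 0) (@smooth_cst R 0).
by rewrite e0 mulN1r addNr.
Qed.

(** [S] has real coefficients, so testing against real functions already separates real and
    imaginary parts. *)
Lemma AstarE p : Astar alpha k p <->
  rdom alpha k (reF p.1) (reF p.2) /\ rdom alpha k (imF p.1) (imF p.2).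
Proof.
split=> [[/[dup] L1 /L2E[s1 s2] [/[dup] L2' /L2E[s3 s4] H]]|[[s1 s3 H1] [s2 s4 H2]]].
- have H' u : test_real u ->
      \int[mu]_x (S u x * reF p.1 x) = \int[mu]_x (u x * reF p.2 x) /\
      \int[mu]_x (S u x * imF p.1 x) = \int[mu]_x (u x * imF p.2 x).
    move=> tu; pose f x := Complex (u x) 0.
    have tf : test_fun f by apply/test_funE; split => //; exact: test_cst0.
    have [f2 Sf2] := test_L2 tf.
    have := H (f, Sop alpha k f) (conj tf erefl).
    rewrite /= !ipE// !(SopE f) /reF /imF /= -/(reF _) Sreal_cst0.
    have Z (g : R -> R) : \int[mu]_x (0 * g x) = 0.
      by rewrite (@eq_Rint _ _ _ (fun=> 0)); [rewrite Rintegral_cst ?mul0r//|move=> x _; rewrite mul0r].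
    by rewrite !Z !addr0 !sub0r => -[-> /oppr_inj ->].
  by split; split => // u /H'[].
- have L1 : L2 p.1 by apply/L2E.
  have L2' : L2 p.2 by apply/L2E.
  split => //; split => // -[f _] [/= tf ->].
  have [f2 Sf2] := test_L2 tf; have /test_funE[t1 t2] := tf.
  by rewrite !ipE// !(SopE f) !H1// !H2//.
Qed.

Definition crbv g (v0 v1 v2 v3 : C) :=
  rbv alpha (reF g) (ReC v0) (ReC v1) (ReC v2) (ReC v3) /\
  rbv alpha (imF g) (ImC v0) (ImC v1) (ImC v2) (ImC v3).

Lemma crbv_uniq g v0 v1 v2 v3 u0 u1 u2 u3 : crbv g v0 v1 v2 v3 -> crbv g u0 u1 u2 u3 ->
  [/\ v0 = u0, v1 = u1, v2 = u2 & v3 = u3].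
Proof.
move=> [[a1 a2] [b1 b2]] [[c1 c2] [d1 d2]].
have [e1 e2] := hbva_uniq a1 c1; have [e3 e4] := hbva_uniq a2 c2.
have [e5 e6] := hbva_uniq b1 d1; have [e7 e8] := hbva_uniq b2 d2.
by split; exact: complexP.
Qed.

Lemma negligible_oppr (N : set R) : mu.-negligible N -> mu.-negligible [set x | N (- x)].
Proof.
move=> [A [mA A0 NA]]; exists [set x | A (- x)]; split.
- by have := @oppr_measurable R setT measurableT A mA; rewrite setTI.
- by rewrite -A0; have := @lebesgue_measureN R A mA.
- by move=> x /NA.
Qed.

Let ReMc (a : R) (z : C) : ReC (cR a * z) = a * ReC z.
Proof. by case: z => x y /=; rewrite mul0r subr0. Qed.

Let ImMc (a : R) (z : C) : ImC (cR a * z) = a * ImC z.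
Proof. by case: z => x y /=; rewrite mul0r addr0. Qed.

Let ReB2 (z w : C) (a : R) : ReC (z - w * cR a) = ReC z - ReC w * a.
Proof. by case: z w => x y [z w] /=; rewrite mulr0 subr0. Qed.

Let ImB2 (z w : C) (a : R) : ImC (z - w * cR a) = ImC z - ImC w * a.
Proof. by case: z w => x y [z w] /=; rewrite mulr0 add0r. Qed.

Let climRE h (v0 v1 : C) :
  climR (fun x => cR (`|x| `^ (alpha / 2)) * h x) v0 /\
  climR (fun x => cR (`|x| `^ (- (1 + alpha / 2))) *
                    (h x - v0 * cR (`|x| `^ (- (alpha / 2))))) v1 <->
  hbv alpha (reF h) (ReC v0) (ReC v1) /\ hbv alpha (imF h) (ImC v0) (ImC v1).
Proof.
have E (a : R -> R) (f : R -> C) : reF (fun x => cR (a x) * f x) = (fun x => a x * reF f x) /\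
    imF (fun x => cR (a x) * f x) = (fun x => a x * imF f x).
  by split; apply/funext => x; [exact: ReMc|exact: ImMc].
have E' (w : C) (a : R -> R) (f : R -> C) :
    reF (fun x => f x - w * cR (a x)) = (fun x => reF f x - ReC w * a x) /\
    imF (fun x => f x - w * cR (a x)) = (fun x => imF f x - ImC w * a x).
  by split; apply/funext => x; [exact: ReB2|exact: ImB2].
rewrite /climR !(E _ _).1 !(E _ _).2 !(E' _ _ _).1 !(E' _ _ _).2.
by split => [[[? ?] [? ?]]|[[? ?] [? ?]]].
Qed.

Let climLE f (v : C) : climL f v <-> climR (fun x => f (- x)) v.
Proof.
have H (u : R -> R) (l : R) :
    u x @[x --> 0^'-] --> l <-> u (- x) @[x --> (0 : R)^'+] --> l.
  have := @cvg_at_leftNP R R u 0 l; rewrite oppr0; exact.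
by rewrite /climL /climR (H (reF f)) (H (imF f)).
Qed.

Let climLE2 h (v0 v1 : C) :
  climL (fun x => cR (`|x| `^ (alpha / 2)) * h x) v0 /\
  climL (fun x => cR (`|x| `^ (- (1 + alpha / 2))) *
                    (h x - v0 * cR (`|x| `^ (- (alpha / 2))))) v1 <->
  hbv alpha (refl (reF h)) (ReC v0) (ReC v1) /\ hbv alpha (refl (imF h)) (ImC v0) (ImC v1).
Proof.
rewrite !climLE; under [fun x => _ * h _]eq_fun do rewrite normrN.
under [X in _ /\ climR X _]eq_fun do rewrite normrN.
exact: (climRE (fun x => h (- x)) v0 v1).
Qed.

(** The converse direction assembles one complex representative from four real ones, for the two
    parts on the two sides of 0. *)
Lemma bvals_crbv g v0 v1 v2 v3 : bvals alpha g v0 v1 v2 v3 <-> crbv g v0 v1 v2 v3.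
Proof.
split.
- move=> [h [[N [nN hg]] [l0 [l1 [r0 r1]]]]].
  have /climLE2[a1 a2] := conj l0 l1; have /climRE[b1 b2] := conj r0 r1.
  split; split.
  + exists (refl (reF h)) => //; apply: negligibleS (negligible_oppr nN) => x /= [x0 gh].
    by apply: contrapT => nx; apply: gh; rewrite /refl /reF hg.
  + exists (reF h) => //; apply: negligibleS nN => x /= [x0 gh].
    by apply: contrapT => nx; apply: gh; rewrite /reF hg.
  + exists (refl (imF h)) => //; apply: negligibleS (negligible_oppr nN) => x /= [x0 gh].
    by apply: contrapT => nx; apply: gh; rewrite /refl /imF hg.
  + exists (imF h) => //; apply: negligibleS nN => x /= [x0 gh].
    by apply: contrapT => nx; apply: gh; rewrite /imF hg.
- move=> [[[a ga ha] [b gb hb]] [[c gc hc] [d gd hd]]].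
  (* The value [g 0] at the origin makes h agree with g there, so that the exceptional set consists
     of the two one-sided ones only. *)
  pose h x := if 0 < x then Complex (b x) (d x) else
    if x < 0 then Complex (a (- x)) (c (- x)) else g 0.
  exists h; split.
    exists ([set x | 0 < x /\ ~ (reF g x = b x /\ imF g x = d x)] `|`
      [set x | 0 < - x /\ ~ (refl (reF g) (- x) = a (- x) /\ refl (imF g) (- x) = c (- x))]).
    split; first by apply: negligibleU; [exact: aep_and|apply: negligible_oppr (aep_and ga gc)].
    move=> x /not_orP[n1 n2]; rewrite /h; case: ltgtP => [x0|x0|<-//].
      apply: contrapT => E; apply: n1; split => // -[e1 e2]; apply: E.
      by apply: complexP; [exact: esym e1|exact: esym e2].
    apply: contrapT => E; apply: n2; split; first by rewrite oppr_gt0.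
    rewrite /refl opprK => -[e1 e2]; apply: E.
    by apply: complexP; [exact: esym e1|exact: esym e2].
  have near0 (f f' : R -> R) w0 w1 : (forall x, 0 < x -> f x = f' x) -> hbv alpha f w0 w1 ->
      hbv alpha f' w0 w1.
    move=> ff' [h1 h2]; split.
      apply: cvg_trans h1; apply: near_eq_cvg; near=> x.
      by rewrite ff'//; near: x; exact: nbhs_right_gt.
    apply: cvg_trans h2; apply: near_eq_cvg; near=> x.
    by rewrite ff'//; near: x; exact: nbhs_right_gt.
  have /climLE2[? ?] : hbv alpha (refl (reF h)) (ReC v0) (ReC v1) /\
      hbv alpha (refl (imF h)) (ImC v0) (ImC v1).
    by split; [apply: near0 ha|apply: near0 hc] => x x0;
      rewrite /refl /reF /imF /h oppr_gt0 oppr_lt0 x0 ltNge (ltW x0) opprK.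
  have /climRE[? ?] : hbv alpha (reF h) (ReC v2) (ReC v3) /\
      hbv alpha (imF h) (ImC v2) (ImC v3).
    by split; [apply: near0 hb|apply: near0 hd] => x x0; rewrite /reF /imF /h x0.
  by [].
Unshelve. all: by end_near.
Qed.

Lemma Astar_bvals p : Astar alpha k p -> exists v0 v1 v2 v3, bvals alpha p.1 v0 v1 v2 v3.
Proof.
move=> /AstarE[/(rdom_rbv alpha01)[a0 [a1 [a2 [a3 ba]]]] /(rdom_rbv alpha01)[b0 [b1 [b2 [b3 bb]]]]].
exists (Complex a0 b0), (Complex a1 b1), (Complex a2 b2), (Complex a3 b3).
exact/bvals_crbv.
Qed.

Lemma bvals_uniq g v0 v1 v2 v3 u0 u1 u2 u3 : bvals alpha g v0 v1 v2 v3 ->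
  bvals alpha g u0 u1 u2 u3 -> [/\ v0 = u0, v1 = u1, v2 = u2 & v3 = u3].
Proof. by move=> /bvals_crbv b1 /bvals_crbv b2; exact: (crbv_uniq b1 b2). Qed.

Lemma bvals_surj v0 v1 v2 v3 : exists2 p, Astar alpha k p & bvals alpha p.1 v0 v1 v2 v3.
Proof.
have [g [h [dg bg]]] := rdom_surj k alpha01 (ReC v0) (ReC v1) (ReC v2) (ReC v3).
have [f [l [df bf]]] := rdom_surj k alpha01 (ImC v0) (ImC v1) (ImC v2) (ImC v3).
exists (fun x => Complex (g x) (f x), fun x => Complex (h x) (l x)).
  exact/AstarE.
exact/bvals_crbv.
Qed.

Lemma graphA_bvals p : graphA alpha k p -> Astar alpha k p /\ bvals alpha p.1 0 0 0 0.
Proof.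
case: p => f _ [/= /test_funE[t1 t2] ->].
have [d1 b1] := test_rdom k alpha01 t1; have [d2 b2] := test_rdom k alpha01 t2.
by split; [exact/AstarE|exact/bvals_crbv].
Qed.

Lemma Astar_green p q v0 v1 v2 v3 u0 u1 u2 u3 : Astar alpha k p -> Astar alpha k q ->
  bvals alpha p.1 v0 v1 v2 v3 -> bvals alpha q.1 u0 u1 u2 u3 ->
  ip p.2 q.1 - ip p.1 q.2 =
  cR (1 + alpha) * ((v1 * u0^*%C - v0 * u1^*%C) + (v3 * u2^*%C - v2 * u3^*%C)).
Proof.
move=> Ap Aq /bvals_crbv[bp1 bp2] /bvals_crbv[bq1 bq2].
have [Lp1 [Lp2 _]] := Ap; have [Lq1 [Lq2 _]] := Aq.
move/AstarE: Ap => [dp1 dp2]; move/AstarE: Aq => [dq1 dq2].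
have g11 := rdom_green alpha01 dp1 dq1 bp1 bq1.
have g12 := rdom_green alpha01 dp1 dq2 bp1 bq2.
have g21 := rdom_green alpha01 dp2 dq1 bp2 bq1.
have g22 := rdom_green alpha01 dp2 dq2 bp2 bq2.
rewrite !ipE//; apply: complexP => /=; last first.
  rewrite [LHS](_ : _ =
    (\int[mu]_x (imF p.2 x * reF q.1 x) - \int[mu]_x (imF p.1 x * reF q.2 x)) -
    (\int[mu]_x (reF p.2 x * imF q.1 x) - \int[mu]_x (reF p.1 x * imF q.2 x))); last by ring.
  rewrite g12 g21.
  by case: v0 v1 v2 v3 u0 u1 u2 u3 {bp1 bp2 bq1 bq2 g11 g12 g21 g22}
    => [? ?] [? ?] [? ?] [? ?] [? ?] [? ?] [? ?] [? ?] /=; ring.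
rewrite [LHS](_ : _ =
  (\int[mu]_x (reF p.2 x * reF q.1 x) - \int[mu]_x (reF p.1 x * reF q.2 x)) +
  (\int[mu]_x (imF p.2 x * imF q.1 x) - \int[mu]_x (imF p.1 x * imF q.2 x))); last by ring.
rewrite g11 g22.
by case: v0 v1 v2 v3 u0 u1 u2 u3 {bp1 bp2 bq1 bq2 g11 g12 g21 g22}
  => [? ?] [? ?] [? ?] [? ?] [? ?] [? ?] [? ?] [? ?] /=; ring.
Qed.

End ComplexLine.

(** * Identification of the Friedrichs extension *)

Section FriedrichsGraph.
Variable R : realType.
Local Notation C := (R[i]).
Local Notation mu := (@lebesgue_measure R).
Variables (alpha : R) (k : int).
Hypothesis alpha01 : 0 <= alpha < 1.
Local Notation energy := (energy alpha k).

Lemma test_realB (u v : R -> R) : test_real u -> test_real v -> test_real (fun x => u x - v x).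
Proof.
move=> tu tv; have := testD (-1) tv tu; congr test_real; apply/funext => x.
by rewrite mulN1r addrC.
Qed.

Lemma energyE (f g : R -> C) : test_fun f -> test_fun g ->
  complex.Re (ip (Sop alpha k (fun x => f x - g x)) (fun x => f x - g x)) =
  energy (fun x => reF f x - reF g x) + energy (fun x => imF f x - imF g x).
Proof.
move=> /test_funE[f1 f2] /test_funE[g1 g2]; set D := (fun x => f x - g x).
have reD : reF D = (fun x => reF f x - reF g x).
  by apply/funext => x; rewrite /reF /D; case: (f x) (g x) => ? ? [].
have imD : imF D = (fun x => imF f x - imF g x).
  by apply/funext => x; rewrite /imF /D; case: (f x) (g x) => ? ? [].
have tD : test_fun D by apply/test_funE; rewrite reD imD; split; exact: test_realB.
have [L1 L2] := test_L2 alpha k tD.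
by rewrite ipE//= !(SopE alpha k) -reD -imD.
Qed.

Lemma nrm2B (f g : R -> C) : L2 f -> L2 g -> nrm2 (fun x => f x - g x) =
  \int[mu]_x ((reF f x - reF g x) ^+ 2) + \int[mu]_x ((imF f x - imF g x) ^+ 2).
Proof.
move=> /L2E[f1 f2] /L2E[g1 g2].
rewrite -RintD//; [|exact: (sqB measurableT f1 g1).2|exact: (sqB measurableT f2 g2).2].
by apply: eq_Rint => x _; rewrite /reF /imF; case: (f x) (g x) => ? ? [].
Qed.

(** Squared norm and form are sums of nonnegative contributions of the real and imaginary parts, so
    L^2 convergence and the Cauchy condition hold for a complex sequence iff they hold for both
    parts; [rform_sub] and [rform_sup_aux] then apply to each part. *)
Lemma friedrichs_restr : friedrichs alpha k = restrA alpha k (@domF R).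
Proof.
apply/seteqP; split => p.
- move=> [Ap [phi [tphi [phil phic]]]]; split => //.
  have [v0 [v1 [v2 [v3 bv]]]] := Astar_bvals alpha01 Ap.
  exists v0, v1, v2, v3; split => //.
  have /AstarE[d1 d2] := Ap; have [Lp _] := Ap.
  have /bvals_crbv[b1 b2] := bv.
  have Lphi n := (test_L2 alpha k (tphi n)).1.
  have t1 n : test_real (reF (phi n)) by have /test_funE[] := tphi n.
  have t2 n : test_real (imF (phi n)) by have /test_funE[] := tphi n.
  have l e : 0 < e -> exists N, forall n, (N <= n)%N -> nrm2 (fun x => phi n x - p.1 x) < e.
    move=> e0; have /cvgrPdist_lt/(_ e e0)[N _ HN] := phil.
    exists N => n Nn; apply: le_lt_trans (HN n Nn).
    by rewrite distrC subr0 ler_norm.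
  have [] := rform_sub alpha01 d1 b1 t1.
  + move=> e /l[N HN]; exists N => n /HN; apply: le_lt_trans.
    by rewrite nrm2B// lerDl; apply: Rintegral_ge0 => x _; exact: sqr_ge0.
  + move=> e /phic[N HN]; exists N => n m Nn Nm; apply: le_lt_trans (HN n m Nn Nm).
    by rewrite energyE// lerDl energy_ge0//; exact: test_realB.
  move=> r0 r2.
  have [] := rform_sub alpha01 d2 b2 t2.
  + move=> e /l[N HN]; exists N => n /HN; apply: le_lt_trans.
    by rewrite nrm2B// lerDr; apply: Rintegral_ge0 => x _; exact: sqr_ge0.
  + move=> e /phic[N HN]; exists N => n m Nn Nm; apply: le_lt_trans (HN n m Nn Nm).
    by rewrite energyE// lerDr energy_ge0//; exact: test_realB.
  by move=> i0 i2; split; exact: complexP.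
- move=> [Ap [v0 [v1 [v2 [v3 [bv [v00 v20]]]]]]]; split => //.
  have /AstarE[d1 d2] := Ap; have [Lp _] := Ap.
  have /bvals_crbv := bv; rewrite v00 v20 => -[b1 b2].
  have [phi [t1 l1 c1]] := rform_sup_aux alpha01 d1 b1.
  have [psi [t2 l2 c2]] := rform_sup_aux alpha01 d2 b2.
  pose chi n x := Complex (phi n x) (psi n x).
  have tchi n : test_fun (chi n) by apply/test_funE; split; [exact: t1|exact: t2].
  have Lchi n := (test_L2 alpha k (tchi n)).1.
  exists chi; split => //; split.
    apply/cvgrPdist_lt => e e0; have e20 : 0 < e / 2 by lra.
    have [N1 H1] := l1 _ e20; have [N2 H2] := l2 _ e20.
    exists (maxn N1 N2) => // n /=; rewrite geq_max => /andP[/H1 h1 /H2 h2].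
    rewrite distrC subr0 nrm2B// ger0_norm; first lra.
    by apply: addr_ge0; apply: Rintegral_ge0 => x _; exact: sqr_ge0.
  move=> e e0; have e20 : 0 < e / 2 by lra.
  have [N1 H1] := c1 _ e20; have [N2 H2] := c2 _ e20.
  exists (maxn N1 N2) => n m; rewrite !geq_max => /andP[n1 n2] /andP[m1 m2].
  have h1 := H1 n m n1 m1; have h2 := H2 n m n2 m2.
  by rewrite energyE//; lra.
Qed.

End FriedrichsGraph.

(** * Lagrangian subspaces of the boundary space *)

Section Lagrangian.
Variable R : realType.
Local Notation C := (R[i]).
Local Notation "z ^*" := (conjc z) : ring_scope.
Implicit Types (P : C -> C -> C -> C -> Prop) (v u w : C).

(* The boundary form of the Green identity [Astar_green]. *)
Definition symp (u0 u1 u2 u3 v0 v1 v2 v3 : C) : C :=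
  (u1 * v0^* - u0 * v1^*) + (u3 * v2^* - u2 * v3^*).

(** A condition equal to its own symplectic complement; linearity is a consequence, by
    [lagrangian_lin]. *)
Definition lagrangian P := forall v0 v1 v2 v3, P v0 v1 v2 v3 <->
  forall u0 u1 u2 u3, P u0 u1 u2 u3 -> symp u0 u1 u2 u3 v0 v1 v2 v3 = 0.

Definition bcIR (c : R) : C -> C -> C -> C -> Prop :=
  fun v0 v1 v2 v3 => v0 = 0 /\ v3 = cR c * v2.
Definition bcIL (c : R) : C -> C -> C -> C -> Prop :=
  fun v0 v1 v2 v3 => v2 = 0 /\ v1 = cR c * v0.
Definition bcII (a : C) (c : R) : C -> C -> C -> C -> Prop :=
  fun v0 v1 v2 v3 => v2 = a * v0 /\ v1 + a^* * v3 = cR c * v0.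
Definition bcIII (c1 c2 c3 c4 : R) : C -> C -> C -> C -> Prop :=
  fun v0 v1 v2 v3 => v1 = cR c1 * v0 + Complex c2 c3 * v2 /\
    v3 = (Complex c2 c3)^* * v0 + cR c4 * v2.

Lemma conj_cR (c : R) : (cR c)^* = cR c.
Proof. by rewrite /cR /= oppr0. Qed.

Lemma conj_real v : v^* = v -> exists c : R, v = cR c.
Proof. by case: v => a b [] /eqP; rewrite -subr_eq0 -opprD oppr_eq0 -mulr2n mulrn_eq0/= => /eqP ->; exists a. Qed.

Lemma conjcD v u : (v + u)^* = v^* + u^*. Proof. exact: rmorphD. Qed.
Lemma conjcM v u : (v * u)^* = v^* * u^*. Proof. exact: rmorphM. Qed.

Lemma lagrangianF : lagrangian (@domF R).
Proof.
move=> v0 v1 v2 v3; split=> [[-> ->] u0 u1 u2 u3 [-> ->]|H].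
  by rewrite /symp !conjc0 !mulr0 !mul0r !subr0 addr0.
split.
  have := H 0 1 0 0 (conj erefl erefl); rewrite /symp !mul0r mul1r !subr0 addr0.
  by move/(congr1 conjc); rewrite conjcK conjc0.
have := H 0 0 0 1 (conj erefl erefl); rewrite /symp !mul0r mul1r !subr0 add0r.
by move/(congr1 conjc); rewrite conjcK conjc0.
Qed.

(** Here, as for families II and III below, orthogonality to a basis of the condition returns its
    two equations, conjugated. *)
Lemma lagrangianIR c : lagrangian (bcIR c).
Proof.
move=> v0 v1 v2 v3; split=> [[-> ->] u0 u1 u2 u3 [-> ->]|H].
  by rewrite /symp conjcM (conj_cR c) conjc0; ring.
have e1 := H 0 1 0 0 (conj erefl (esym (mulr0 _))).
have e2 := H 0 0 1 (cR c) (conj erefl (esym (mulr1 _))).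
split; apply: (can_inj (@conjcK R)); rewrite ?conjcM ?conjc0 ?(conj_cR c).
  by rewrite -[RHS]e1 /symp; ring.
by apply/esym/eqP; rewrite -subr_eq0 -[X in _ == X]e2 /symp; apply/eqP; ring.
Qed.

Lemma lagrangianII a c : lagrangian (bcII a c).
Proof.
move=> v0 v1 v2 v3; split=> [[-> e] u0 u1 u2 u3 [-> f]|H].
  have e' : v1^* + a * v3^* = cR c * v0^*.
    by have := congr1 conjc e; rewrite conjcD !conjcM conjcK (conj_cR c).
  rewrite /symp conjcM.
  transitivity ((u1 + a^* * u3) * v0^* - u0 * (v1^* + a * v3^*)); first by ring.
  by rewrite f e'; ring.
(* The vectors (0, conj a, 0, -1) and (1, c, a, 0) span the condition. *)
have e1 := H 0 a^* 0 (- 1) _; have e2 := H 1 (cR c) a 0 _.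
split; apply: (can_inj (@conjcK R)).
  rewrite conjcM; apply/esym/eqP; rewrite -subr_eq0 -[X in _ == X]e1.
    by rewrite /symp; apply/eqP; ring.
  by split; ring.
rewrite conjcD !conjcM conjcK ?(conj_cR c).
apply/esym/eqP; rewrite -subr_eq0 -[X in _ == X]e2.
  by rewrite /symp; apply/eqP; ring.
by split; ring.
Qed.

Lemma bcIL_II c : bcIL c = bcII 0 c.
Proof.
apply/funext => v0; apply/funext => v1; apply/funext => v2; apply/funext => v3.
by rewrite /bcIL /bcII mul0r conjc0 mul0r addr0.
Qed.

Lemma lagrangianIII c1 c2 c3 c4 : lagrangian (bcIII c1 c2 c3 c4).
Proof.
move=> v0 v1 v2 v3; rewrite /bcIII; move: (Complex c2 c3) => z.
split=> [[-> ->] u0 u1 u2 u3 [-> ->]|H].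
  by rewrite /symp !conjcD !conjcM conjcK ?(conj_cR c1) ?(conj_cR c4); ring.
have e1 := H 1 (cR c1) 0 z^* _; have e2 := H 0 z 1 (cR c4) _.
split; apply: (can_inj (@conjcK R));
    rewrite conjcD !conjcM ?conjcK ?(conj_cR c1) ?(conj_cR c4);
    apply/esym/eqP; rewrite -subr_eq0; [rewrite -[X in _ == X]e1|rewrite -[X in _ == X]e2].
- by rewrite /symp; apply/eqP; ring.
- by split; ring.
- by rewrite /symp; apply/eqP; ring.
- by split; ring.
Qed.

Lemma lagrangian_lin P c v0 v1 v2 v3 u0 u1 u2 u3 : lagrangian P ->
  P v0 v1 v2 v3 -> P u0 u1 u2 u3 -> P (c * v0 + u0) (c * v1 + u1) (c * v2 + u2) (c * v3 + u3).
Proof.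
move=> LP /LP Hv /LP Hu; apply/LP => w0 w1 w2 w3 Pw.
transitivity (c^* * symp w0 w1 w2 w3 v0 v1 v2 v3 + symp w0 w1 w2 w3 u0 u1 u2 u3).
  by rewrite /symp !conjcD !conjcM; ring.
by rewrite Hv// Hu// mulr0 addr0.
Qed.

(** Taking symplectic complements reverses inclusions, so an inclusion of Lagrangian conditions is
    an equality; each case of the classification then needs one inclusion only. *)
Lemma lagrangian_sub P Q : lagrangian P -> lagrangian Q ->
  (forall v0 v1 v2 v3, P v0 v1 v2 v3 -> Q v0 v1 v2 v3) -> P = Q.
Proof.
move=> LP LQ PQ; apply/funext => v0; apply/funext => v1; apply/funext => v2; apply/funext => v3.
apply/propext; split; first exact: PQ.
by move=> /LQ H; apply/LP => u0 u1 u2 u3 /PQ; exact: H.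
Qed.

End Lagrangian.

(** * Classification of Lagrangian conditions by rank *)

Section Classification.
Variable R : realType.
Local Notation C := (R[i]).
Local Notation "z ^*" := (conjc z) : ring_scope.
Implicit Types (P Q : C -> C -> C -> C -> Prop) (v u w : C).

Lemma lagrangian0 P : lagrangian P -> P 0 0 0 0.
Proof. by move=> LP; apply/LP => u0 u1 u2 u3 _; rewrite /symp conjc0; ring. Qed.

Lemma lagrangianZ P c v0 v1 v2 v3 : lagrangian P -> P v0 v1 v2 v3 ->
  P (c * v0) (c * v1) (c * v2) (c * v3).
Proof.
by move=> LP Pv; have := lagrangian_lin c LP Pv (lagrangian0 LP); rewrite !addr0.
Qed.

Let eq_subr0 (a b c : C) : c = 0 -> a - b = c -> a = b.
Proof. by move=> -> /subr0_eq. Qed.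

(** The two vectors lie over the standard basis of the (v0, v2) plane. Their mutual and self
    orthogonality makes p1 and q3 real and p3 the conjugate of q1; orthogonality of a general vector
    to both is then condition III. *)
Lemma lagrangian_rank2 P p1 p3 q1 q3 : lagrangian P -> P 1 p1 0 p3 -> P 0 q1 1 q3 ->
  exists c1 c2 c3 c4, P = bcIII c1 c2 c3 c4.
Proof.
move=> LP Pp Pq; have /LP Hp := Pp; have /LP Hq := Pq.
have [c1 p1E] : exists c : R, p1 = cR c.
  apply: conj_real; apply/esym; apply: (eq_subr0 (Hp _ _ _ _ Pp)).
  by rewrite /symp conjc0 conjc1; ring.
have [c4 q3E] : exists c : R, q3 = cR c.
  apply: conj_real; apply/esym; apply: (eq_subr0 (Hq _ _ _ _ Pq)).
  by rewrite /symp conjc0 conjc1; ring.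
have p3E : p3 = q1^*.
  apply: (eq_subr0 (Hq _ _ _ _ Pp)).
  by rewrite /symp conjc0 conjc1; ring.
exists c1, (complex.Re q1), (complex.Im q1), c4.
apply: (lagrangian_sub LP (@lagrangianIII _ _ _ _ _)) => v0 v1 v2 v3 Pv.
have zE : Complex (complex.Re q1) (complex.Im q1) = q1 by case: (q1).
rewrite /bcIII zE; split.
  apply: (eq_subr0 (Hp _ _ _ _ Pv)).
  by rewrite /symp p3E conjcK p1E (conj_cR c1) conjc0 conjc1; ring.
apply: (eq_subr0 (Hq _ _ _ _ Pv)).
by rewrite /symp q3E (conj_cR c4) conjc0 conjc1; ring.
Qed.

Lemma lagrangian_rank1R P e1 e3 : lagrangian P -> P 0 e1 1 e3 ->
  (forall v0 v1 v2 v3, P v0 v1 v2 v3 -> v0 = 0) -> exists c, P = bcIR c.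
Proof.
move=> LP Pe P0; have /LP He := Pe.
have [c e3E] : exists c : R, e3 = cR c.
  apply: conj_real; apply/esym; apply: (eq_subr0 (He _ _ _ _ Pe)).
  by rewrite /symp conjc0 conjc1; ring.
exists c; apply: (lagrangian_sub LP (@lagrangianIR _ _)) => v0 v1 v2 v3 Pv.
have v00 := P0 _ _ _ _ Pv; split => //.
apply: (eq_subr0 (He _ _ _ _ Pv)).
by rewrite /symp v00 e3E (conj_cR c) conjc0 conjc1; ring.
Qed.

(** Isotropy of the single vector makes e1 + conj a e3 real, and this number is the parameter of the
    family. The case a = 0 is family I_L. *)
Lemma lagrangian_rank1L P e1 a e3 : lagrangian P -> P 1 e1 a e3 ->
  (forall v0 v1 v2 v3, P v0 v1 v2 v3 -> v2 = a * v0) -> exists c, P = bcII a c.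
Proof.
move=> LP Pe P0; have /LP He := Pe.
have [c cE] : exists c : R, e1 + a^* * e3 = cR c.
  apply: conj_real; apply/esym; apply: (eq_subr0 (He _ _ _ _ Pe)).
  by rewrite /symp conjcD conjcM conjcK conjc1; ring.
have cE' : e1^* + a * e3^* = cR c by rewrite -(conj_cR c) -cE conjcD conjcM conjcK.
exists c; apply: (lagrangian_sub LP (@lagrangianII _ _ _)) => v0 v1 v2 v3 Pv.
have v2E := P0 _ _ _ _ Pv; split => //.
apply: (eq_subr0 (He _ _ _ _ Pv)).
by rewrite /symp v2E -cE' conjc1; ring.
Qed.

Lemma lagrangian_classification P : lagrangian P ->
  P = @domF R \/ (exists c, P = bcIR c) \/ (exists c, P = bcIL c) \/
  (exists a c, a != 0 /\ P = bcII a c) \/ exists c1 c2 c3 c4, P = bcIII c1 c2 c3 c4.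
Proof.
move=> LP.
(* A nonzero determinant of the (v0, v2) components detects a projection of rank 2; Cramer's rule
   then gives vectors over (1,0) and (0,1). *)
have [[e0 [e1 [e2 [e3 [f0 [f1 [f2 [f3 [Pe [Pf d0]]]]]]]]]]|H] :=
  pselect (exists e0 e1 e2 e3 f0 f1 f2 f3,
    P e0 e1 e2 e3 /\ P f0 f1 f2 f3 /\ e0 * f2 - e2 * f0 != 0).
  do 4 right; set d := e0 * f2 - e2 * f0 in d0.
  have Pp := lagrangian_lin (d^-1 * f2) LP Pe (lagrangianZ (- (d^-1 * e2)) LP Pf).
  have Pq := lagrangian_lin (d^-1 * e0) LP Pf (lagrangianZ (- (d^-1 * f0)) LP Pe).
  have E1 : d^-1 * f2 * e0 + - (d^-1 * e2) * f0 = 1 by rewrite /d; field.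
  have E2 : d^-1 * f2 * e2 + - (d^-1 * e2) * f2 = 0 by ring.
  have E3 : d^-1 * e0 * f0 + - (d^-1 * f0) * e0 = 0 by ring.
  have E4 : d^-1 * e0 * f2 + - (d^-1 * f0) * e2 = 1 by rewrite /d; field.
  rewrite E1 E2 in Pp; rewrite E3 E4 in Pq.
  exact: lagrangian_rank2 LP Pp Pq.
(* All projections are now proportional: a nonzero v0 gives the ratio a, and v0 = 0 throughout
   leaves I_R or the Friedrichs condition. *)
have {}H e0 e1 e2 e3 f0 f1 f2 f3 : P e0 e1 e2 e3 -> P f0 f1 f2 f3 -> e0 * f2 = e2 * f0.
  move=> Pe Pf; apply/subr0_eq/eqP; apply: contrapT => /negP ?.
  by apply: H; exists e0, e1, e2, e3, f0, f1, f2, f3.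
have [[e0 [e1 [e2 [e3 [Pe e00]]]]]|H0] :=
  pselect (exists e0 e1 e2 e3, P e0 e1 e2 e3 /\ e0 != 0).
  have := lagrangianZ e0^-1 LP Pe; rewrite mulVf// => Pe'.
  have [c PE] : exists c, P = bcII (e0^-1 * e2) c.
    apply: (lagrangian_rank1L LP Pe') => v0 v1 v2 v3 Pv.
    by rewrite -(H _ _ _ _ _ _ _ _ Pe' Pv) mul1r.
  have [a0|a0] := eqVneq (e0^-1 * e2) 0.
    by right; right; left; exists c; rewrite bcIL_II -a0.
  by do 3 right; left; exists (e0^-1 * e2), c.
have {}H0 v0 v1 v2 v3 : P v0 v1 v2 v3 -> v0 = 0.
  move=> Pv; apply/eqP; apply: contrapT => /negP ?.
  by apply: H0; exists v0, v1, v2, v3.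
have [[e0 [e1 [e2 [e3 [Pe e20]]]]]|H2] :=
  pselect (exists e0 e1 e2 e3, P e0 e1 e2 e3 /\ e2 != 0).
  have := lagrangianZ e2^-1 LP Pe; rewrite mulVf// (H0 _ _ _ _ Pe) mulr0 => Pe'.
  by right; left; exact: lagrangian_rank1R LP Pe' H0.
left; apply: (lagrangian_sub LP (@lagrangianF R)) => v0 v1 v2 v3 Pv; split; first exact: H0 Pv.
apply/eqP; apply: contrapT => /negP ?.
by apply: H2; exists v0, v1, v2, v3.
Qed.

End Classification.

(** * Self-adjoint extensions and Lagrangian conditions *)

Section Extensions.
Variable R : realType.
Local Notation C := (R[i]).
Variables (alpha : R) (k : int).
Hypothesis alpha01 : 0 <= alpha < 1.
Local Notation restr := (restrA alpha k).
Implicit Types (P Q : C -> C -> C -> C -> Prop) (G : graph R).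

Lemma sa_extension_sub G : sa_extension alpha k G -> G `<=` Astar alpha k.
Proof.
move=> [GE AG] p; rewrite GE => -[L1 [L2 H]]; split => //; split => // q /AG; exact: H.
Qed.

(** Every boundary vector is attained ([bvals_surj]) and determined by its function ([bvals_uniq]),
    so the condition can be read off from the operator. *)
Lemma restrA_inj P Q : restr P = restr Q -> P = Q.
Proof.
suff H P' Q' : restr P' = restr Q' -> forall v0 v1 v2 v3, P' v0 v1 v2 v3 -> Q' v0 v1 v2 v3.
  move=> E; apply/funext => v0; apply/funext => v1; apply/funext => v2; apply/funext => v3.
  by apply/propext; split; apply: H.
move=> E v0 v1 v2 v3 Pv; have [p Ap bp] := bvals_surj k alpha01 v0 v1 v2 v3.
have : restr P' p by split => //; exists v0, v1, v2, v3.
rewrite E => -[_ [u0 [u1 [u2 [u3 [bp' Qu]]]]]].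
by have [-> -> -> ->] := bvals_uniq bp bp'.
Qed.

Lemma Astar_symp p q v0 v1 v2 v3 u0 u1 u2 u3 : Astar alpha k p -> Astar alpha k q ->
  bvals alpha p.1 v0 v1 v2 v3 -> bvals alpha q.1 u0 u1 u2 u3 ->
  ip q.2 p.1 = ip q.1 p.2 <-> symp u0 u1 u2 u3 v0 v1 v2 v3 = 0.
Proof.
move=> Ap Aq bp bq; have E := Astar_green alpha01 Aq Ap bq bp.
have w0 : cR (1 + alpha) != 0.
  by apply/eqP => -[/eqP]; rewrite gt_eqF//; case/andP: alpha01; lra.
split=> [e|e].
  by move/eqP: E; rewrite e subrr eq_sym mulf_eq0 (negPf w0) => /eqP.
by apply/subr0_eq; rewrite E -/(symp _ _ _ _ _ _ _ _) e mulr0.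
Qed.

(** Within [Astar], the adjoint relation is orthogonality of boundary values ([Astar_symp]), and
    surjectivity of the boundary map provides enough elements to test against. *)
Lemma lagrangian_sa P : lagrangian P -> sa_extension alpha k (restr P).
Proof.
move=> LP; have AG : graphA alpha k `<=` restr P.
  move=> p /(graphA_bvals alpha01)[Ap bp]; split => //.
  by exists 0, 0, 0, 0; split => //; exact: lagrangian0.
split=> //; apply/seteqP; split => p.
- move=> [Ap [v0 [v1 [v2 [v3 [bp /LP Pv]]]]]]; have [L1 [L2 _]] := Ap.
  split => //; split => // q [Aq [u0 [u1 [u2 [u3 [bq Pu]]]]]].
  by apply/(Astar_symp Ap Aq bp bq); exact: Pv.
- move=> [L1 [L2 H]]; have Ap : Astar alpha k p.
    by split => //; split => // q /AG; exact: H.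
  have [v0 [v1 [v2 [v3 bp]]]] := Astar_bvals alpha01 Ap.
  split => //; exists v0, v1, v2, v3; split => //; apply/LP => u0 u1 u2 u3 Pu.
  have [q Aq bq] := bvals_surj k alpha01 u0 u1 u2 u3.
  apply/(Astar_symp Ap Aq bp bq); apply: H; split => //.
  by exists u0, u1, u2, u3.
Qed.

(** [P] collects the boundary values of the elements of G. Whether an element of [Astar] belongs to
    G = adj G depends on its boundary values only ([GP]), so G is recovered from [P]. *)
Lemma sa_lagrangian G : sa_extension alpha k G -> exists2 P, lagrangian P & G = restr P.
Proof.
move=> saG; have GA := sa_extension_sub saG; have [GE _] := saG.
pose P v0 v1 v2 v3 := exists2 p, G p & bvals alpha p.1 v0 v1 v2 v3.
have GP p v0 v1 v2 v3 : Astar alpha k p -> bvals alpha p.1 v0 v1 v2 v3 ->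
    (forall u0 u1 u2 u3, P u0 u1 u2 u3 -> symp u0 u1 u2 u3 v0 v1 v2 v3 = 0) -> G p.
  move=> Ap bp H; have [L1 [L2 _]] := Ap.
  rewrite GE; split => //; split => // q Gq.
  have [u0 [u1 [u2 [u3 bq]]]] := Astar_bvals alpha01 (GA _ Gq).
  by apply/(Astar_symp Ap (GA _ Gq) bp bq); apply: H; exists q.
have Psymp v0 v1 v2 v3 : P v0 v1 v2 v3 ->
    forall u0 u1 u2 u3, P u0 u1 u2 u3 -> symp u0 u1 u2 u3 v0 v1 v2 v3 = 0.
  move=> [p Gp bp] u0 u1 u2 u3 [q Gq bq].
  apply/(Astar_symp (GA _ Gp) (GA _ Gq) bp bq).
  by move: (Gp); rewrite GE => -[_ [_]]; exact.
exists P.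
  move=> v0 v1 v2 v3; split; first exact: Psymp.
  move=> H; have [p Ap bp] := bvals_surj k alpha01 v0 v1 v2 v3.
  by exists p => //; exact: GP bp H.
apply/seteqP; split => p.
  move=> Gp; split; first exact: GA.
  have [v0 [v1 [v2 [v3 bp]]]] := Astar_bvals alpha01 (GA _ Gp).
  by exists v0, v1, v2, v3; split => //; exists p.
by move=> [Ap [v0 [v1 [v2 [v3 [bp /Psymp Pv]]]]]]; exact: GP bp Pv.
Qed.

End Extensions.

Theorem theorem5p1 (R : realType) (alpha : R) (k : int) :
  0 <= alpha < 1 ->
  (* the Friedrichs extension has domain {g in D(A star) | g^-_0 = g^+_0 = 0} *)
  friedrichs alpha k = restrA alpha k (@domF R) /\
  (* every self-adjoint extension is a restriction of A star *)
  (forall G, sa_extension alpha k G -> G `<=` Astar alpha k) /\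
  (* exhaustion *)
  (forall G, sa_extension alpha k G <->
     (G = friedrichs alpha k \/
      (exists gamma : R, G = ext_IR alpha k gamma) \/
      (exists gamma : R, G = ext_IL alpha k gamma) \/
      (exists (a : R[i]) (gamma : R), a != 0 /\ G = ext_II alpha k a gamma) \/
      (exists g1 g2 g3 g4 : R, G = ext_III alpha k g1 g2 g3 g4))) /\
  (* mutual disjointness of the families *)
  (forall gamma gamma' : R, ext_IR alpha k gamma <> ext_IL alpha k gamma') /\
  (forall (gamma gamma' : R) (a : R[i]), a != 0 ->
     ext_IR alpha k gamma <> ext_II alpha k a gamma') /\
  (forall (gamma : R) (a : R[i]) (gamma' : R), a != 0 ->
     ext_IL alpha k gamma <> ext_II alpha k a gamma') /\
  (forall gamma g1 g2 g3 g4 : R, ext_IR alpha k gamma <> ext_III alpha k g1 g2 g3 g4) /\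
  (forall gamma g1 g2 g3 g4 : R, ext_IL alpha k gamma <> ext_III alpha k g1 g2 g3 g4) /\
  (forall (a : R[i]) (gamma g1 g2 g3 g4 : R), a != 0 ->
     ext_II alpha k a gamma <> ext_III alpha k g1 g2 g3 g4) /\
  (forall (a b : R[i]) (gamma gamma' : R), a != 0 -> b != 0 -> a != b ->
     ext_II alpha k a gamma <> ext_II alpha k b gamma').
Proof.
move=> alpha01.
have FE := friedrichs_restr k alpha01.
(* It suffices to exhibit one boundary vector that satisfies the first condition and not the
   second. *)
have neq P Q v0 v1 v2 v3 : P v0 v1 v2 v3 -> ~ Q v0 v1 v2 v3 ->
    restrA alpha k P <> restrA alpha k Q.
  by move=> Pv nQ /(restrA_inj alpha01) PQ; apply: nQ; rewrite -PQ.
have one0 : (1 : R[i]) = 0 -> False by move/eqP; rewrite oner_eq0.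
split; first exact: FE.
split; first exact: sa_extension_sub.
split.
  move=> G; split.
    move=> /(sa_lagrangian alpha01)[P LP ->].
    have [->|[[c ->]|[[c ->]|[[a [c [a0 ->]]]|[c1 [c2 [c3 [c4 ->]]]]]]]] :=
      lagrangian_classification LP.
    - by left; rewrite FE.
    - by right; left; exists c.
    - by right; right; left; exists c.
    - by right; right; right; left; exists a, c.
    - by right; right; right; right; exists c1, c2, c3, c4.
  move=> [->|[[c ->]|[[c ->]|[[a [c [a0 ->]]]|[c1 [c2 [c3 [c4 ->]]]]]]]].
  - by rewrite FE; apply: lagrangian_sa => //; exact: lagrangianF.
  - exact: (lagrangian_sa k alpha01 (@lagrangianIR R c)).
  - apply: (lagrangian_sa k alpha01 (P := bcIL c)); rewrite bcIL_II; exact: lagrangianII.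
  - exact: (lagrangian_sa k alpha01 (@lagrangianII R a c)).
  - exact: (lagrangian_sa k alpha01 (@lagrangianIII R c1 c2 c3 c4)).
split=> [c c'|].
  by apply: (@neq _ _ 0 0 1 (cR c)); [split; rewrite ?mulr1|case=> /one0].
split=> [c c' a _|].
  by apply: (@neq _ _ 0 0 1 (cR c)); [split; rewrite ?mulr1|case=> + _; rewrite mulr0 => /one0].
split=> [c a c' a0|].
  apply: (@neq _ _ 1 (cR c) 0 0); first by split; rewrite ?mulr1.
  by case=> + _; rewrite mulr1 => /esym/eqP; apply/negP.
(* Condition III with v0 = v2 = 0 forces v1 = v3 = 0, so in this and the next two cases a nonzero
   vector (0, v1, 0, v3) separates the families. *)
split=> [c g1 g2 g3 g4|].
  apply: (@neq _ _ 0 1 0 0); first by split; rewrite ?mulr0.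
  by case=> + _; rewrite !mulr0 addr0 => /one0.
split=> [c g1 g2 g3 g4|].
  apply: (@neq _ _ 0 0 0 1); first by split; rewrite ?mulr0.
  by case=> _; rewrite !mulr0 addr0 => /one0.
split=> [a c g1 g2 g3 g4 _|].
  apply: (@neq _ _ 0 (conjc a) 0 (- 1)).
    by split; rewrite ?mulr0// mulrN1 subrr.
  by case=> _; rewrite !mulr0 addr0 => /eqP; rewrite oppr_eq0 => /eqP/one0.
move=> a b c c' _ _ ab; apply: (@neq _ _ 1 (cR c) a 0).
  by split; rewrite ?mulr1// mulr0 addr0.
by case=> + _; rewrite mulr1 => /eqP; apply/negP.
Qed.
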